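(* Let $\varphi:[0,1]\to[0,\infty)$ and suppose there exist $m_0,c,\alpha>0$ such that $\varphi(m)=cm^\alpha$ on $[0,m_0)$ and $\varphi$ is continuous and bounded uniformly away from $0$ on $[m_0,1]$. Let $A=-i\varphi(m)\frac{\partial}{\partial\theta}$ acting in $L^2(\mathcal A)$, with resolution of the identity $\{E(\lambda)\}_{\lambda\in\mathbb R}$. Assume that $s\in(1/2,1)$ and $\gamma\ge0$ satisfy $$\gamma+\frac s\alpha>\frac12 .$$ Then there exist $r>0$ and a constant $C>0$ such that for all $\lambda\in(-r,r)\setminus\{0\}$ and all $f,g\in\dot{\mathcal H}^{s,\gamma}_0$ the derivative $\frac{d}{d\lambda}(E(\lambda)f,g)_{L^2(\mathcal A)}$ exists and $$\left|\frac{d}{d\lambda}(E(\lambda)f,g)_{L^2(\mathcal A)}\right|\le C\,|\lambda|^{\frac{2s}{\alpha}-1}\,\|f\|_{s,\gamma}\,\|g\|_{s,\gamma},$$ where $C$ does not depend on $f$, $g$ or $\lambda$.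
   Context: $\mathbb S=[0,1]_{\mathrm{per}}$ is the circle of length $1$ (variable $\theta$) and $\mathcal A=[0,1]_m\times\mathbb S_\theta$. The operator $A$ is self-adjoint in $L^2(\mathcal A)$, and $E(\lambda)$ is its spectral projection onto $(-\infty,\lambda]$, i.e. $A=\int_{\mathbb R}\lambda\,dE(\lambda)$. The bilinear (sesquilinear) form $\frac{d}{d\lambda}(E(\lambda)\cdot,\cdot)$ on a subspace is called the density of states (DoS) of $A$ at $\lambda$. Function spaces. Elements $f\in L^2(\mathcal A)=L^2([0,1];L^2(\mathbb S))$ are written via their fibers $f_m\in L^2(\mathbb S)$, $m\in[0,1]$. For $g\in L^2(\mathbb S)$, $\widehat g(k)=\int_0^1 g(\theta)e^{-2\pi i k\theta}\,d\theta$, $k\in\mathbb Z$. Let $L^2_0(\mathbb S)=\{g\in L^2(\mathbb S):\widehat g(0)=0\}$. For $\gamma\ge0$, $$\dot H^\gamma=\Big\{g\in L^2_0(\mathbb S):\|g\|_{\dot H^\gamma}^2:=\sum_{k\in\mathbb Z}|k|^{2\gamma}|\widehat g(k)|^2<\infty\Big\}$$ (the $k=0$ term is zero). For $s\in(0,1)$ and $\gamma\ge0$, $\dot{\mathcal H}^{s,\gamma}=W^{s,2}([0,1];\dot H^\gamma)$ is the space of $f\in L^2([0,1];\dot H^\gamma)$ for which $$\|f\|_{s,\gamma}^2:=\|f\|_{L^2([0,1];\dot H^\gamma)}^2+\int_0^1\!\!\int_0^1\frac{\|f_m-f_{m'}\|_{\dot H^\gamma}^2}{|m-m'|^{1+2s}}\,dm\,dm'<\infty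 .$$ For $s>1/2$ every $f\in\dot{\mathcal H}^{s,\gamma}$ has a representative for which $m\mapsto f_m\in\dot H^\gamma$ is continuous on $[0,1]$, and this representative is always used; then $\dot{\mathcal H}^{s,\gamma}_0=\{f\in\dot{\mathcal H}^{s,\gamma}:f_0=0\}$ (the fiber at $m=0$ vanishes), with norm $\|\cdot\|_{s,\gamma}$. *)

(* Defs.v *)
(* Elements of complex L^2 spaces are represented by functions, identified    *)
(* when they are equal almost everywhere (aeqc).                              *)
From HB Require Import structures.
From mathcomp Require Import all_boot all_order all_algebra.
From mathcomp Require Import complex.
From mathcomp Require Import all_classical all_reals all_analysis.

Set Implicit Arguments.
Unset Strict Implicit.
Unset Printing Implicit Defensive.

Import Order.TTheory GRing.Theory Num.Theory.
Import numFieldNormedType.Exports.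

Local Open Scope classical_set_scope.
Local Open Scope ring_scope.
Local Open Scope complex_scope.

Definition is_cderive (R : realType) (h : R -> R[i]) (x : R) (D : R[i]) : Prop :=
  is_derive x 1 (fun y => complex.Re (h y)) (complex.Re D) /\
  is_derive x 1 (fun y => complex.Im (h y)) (complex.Im D).

Section ComplexL2.
Context (R : realType) (d : measure_display) (T : measurableType d).
Context (mu : {measure set T -> \bar R}) (D : set T).
Implicit Types f g h : T -> R[i].

Definition cmeasurable f : Prop :=
  measurable_fun D (fun x => complex.Re (f x)) /\
  measurable_fun D (fun x => complex.Im (f x)).

Definition cintegral f : R[i] :=
  Rintegral mu D (fun x => complex.Re (f x)) +i*
  Rintegral mu D (fun x => complex.Im (f x)).

Definition sqnormL2 f : \bar R := (\int[mu]_(x in D) (Normc.normc (f x) ^+ 2)%:E)%E.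

Definition inL2 f : Prop := cmeasurable f /\ (sqnormL2 f < +oo)%E.

Definition normL2 f : R := Num.sqrt (fine (sqnormL2 f)).

Definition ipL2 f g : R[i] := cintegral (fun x => f x * (g x)^*).

Definition aeqc f g : Prop := {ae mu, forall x, D x -> f x = g x}.

Definition orthogonal_projection (P : (T -> R[i]) -> T -> R[i]) : Prop :=
  [/\ forall f, inL2 f -> inL2 (P f),
      forall f g, inL2 f -> inL2 g -> aeqc f g -> aeqc (P f) (P g),
      forall (a : R[i]) f g, inL2 f -> inL2 g ->
        aeqc (P (fun x => a * f x + g x)) (fun x => a * P f x + P g x),
      forall f, inL2 f -> aeqc (P (P f)) (P f) &
      forall f g, inL2 f -> inL2 g -> ipL2 (P f) g = ipL2 f (P g)].

Definition resolution_of_identity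
    (E : R -> (T -> R[i]) -> T -> R[i]) : Prop :=
  [/\ forall x, orthogonal_projection (E x),
      forall x y f, x <= y -> inL2 f ->
        aeqc (E x (E y f)) (E x f) /\ aeqc (E y (E x f)) (E x f),
      forall x f, inL2 f ->
        normL2 (fun t => E y f t - E x f t) @[y --> x^'+] --> (0 : R),
      forall f, inL2 f -> normL2 (E y f) @[y --> -oo] --> (0 : R) &
      forall f, inL2 f ->
        normL2 (fun t => E y f t - f t) @[y --> +oo] --> (0 : R)].

(* The operator A is given by its graph: A f h means that f is in the domain  *)
(* of A and that A maps f to h.  The identity A = \int x dE(x) means:         *)
(* dom A is the set of f in L^2 with \int x^2 d(E(x) f, f) < oo, and          *)
(* (A f, f) = \int x d(E(x) f, f) on dom A, which determines A f by           *)
(* polarization since dom A is dense.  F is the distribution function         *)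
(* x |-> (E(x) f, f), bundled so as to have a Stieltjes measure.              *)
Definition spectral_resolution (A : (T -> R[i]) -> (T -> R[i]) -> Prop)
    (E : R -> (T -> R[i]) -> T -> R[i]) : Prop :=
  resolution_of_identity E /\
  forall f, inL2 f -> exists F : cumulative R R,
    [/\ forall x, (F x)%:C = ipL2 (E x f) f,
        (exists h, A f h) <->
          (\int[lebesgue_stieltjes_measure F]_x (x ^+ 2)%:E < +oo)%E &
        forall h, A f h ->
          ipL2 h f =
            (Rintegral (lebesgue_stieltjes_measure F) setT (fun x => x))%:C].

End ComplexL2.

Section Annulus.
Context (R : realType).

Notation leb := (@lebesgue_measure R).

Definition unit_itv : set R := `[0, 1]%classic.

Definition annulus : set (R * R) := unit_itv `*` unit_itv.

(* the circle of length 1, up to a null set *)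
Definition L2circle (g : R -> R[i]) : Prop := inL2 leb unit_itv g.
Definition aeq_circle (g h : R -> R[i]) : Prop := aeqc leb unit_itv g h.

(* points of the annulus are pairs (m, theta) *)
Definition L2annulus (f : R * R -> R[i]) : Prop :=
  inL2 (leb \x leb)%E annulus f.
Definition ip_annulus (f g : R * R -> R[i]) : R[i] :=
  ipL2 (leb \x leb)%E annulus f g.

Definition fiber (f : R * R -> R[i]) (m : R) : R -> R[i] := fun t => f (m, t).

(* smooth functions on the circle, as 1-periodic functions on R *)
Definition circle_test (psi : R -> R) : Prop :=
  (forall t, psi (t + 1) = psi t) /\
  (forall n t, derivable (derive1n n psi) t 1).

(* w is the weak derivative of v on the circle *)
Definition weak_derivative (v w : R -> R[i]) : Prop :=
  forall psi, circle_test psi ->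
    cintegral leb unit_itv (fun t => v t * (derive1 psi t)%:C) =
    - cintegral leb unit_itv (fun t => w t * (psi t)%:C).

(* graph of A = - i phi(m) d/dtheta on its maximal domain in L^2 *)
Definition transport_op (phi : R -> R) (f h : R * R -> R[i]) : Prop :=
  [/\ L2annulus f, L2annulus h &
      {ae leb, forall m, unit_itv m ->
        exists w : R -> R[i],
          [/\ L2circle w, weak_derivative (fiber f m) w &
              aeq_circle (fiber h m) (fun t => (0 -i* phi m) * w t)]}].

Definition fourier (g : R -> R[i]) (k : int) : R[i] :=
  cintegral leb unit_itv
    (fun t => g t * (cos (2 * pi * k%:~R * t) -i* sin (2 * pi * k%:~R * t))).

(* The term k = 0, which is zero, is left out: powR 0 0 is 1. *)
Definition sqnormH (gamma : R) (g : R -> R[i]) : \bar R :=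
  \esum_(k in [set k : int | k != 0])
    (`|k%:~R| `^ (2 * gamma) * Normc.normc (fourier g k) ^+ 2)%:E.

Definition inH (gamma : R) (g : R -> R[i]) : Prop :=
  [/\ L2circle g, fourier g 0 = 0 & (sqnormH gamma g < +oo)%E].

Definition normH (gamma : R) (g : R -> R[i]) : R :=
  Num.sqrt (fine (sqnormH gamma g)).

Definition sqnormHH (s gamma : R) (f : R * R -> R[i]) : \bar R :=
  (\int[leb]_(m in unit_itv) sqnormH gamma (fiber f m) +
   \int[leb]_(m in unit_itv) \int[leb]_(m' in unit_itv)
     (sqnormH gamma (fun t => (fiber f m t - fiber f m' t)%R)
      * ((`|m - m'| `^ (1 + 2 * s))^-1)%:E))%E.

Definition inHH (s gamma : R) (f : R * R -> R[i]) : Prop :=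
  [/\ L2annulus f,
      {ae leb, forall m, unit_itv m -> inH gamma (fiber f m)} &
      (sqnormHH s gamma f < +oo)%E].

Definition normHH (s gamma : R) (f : R * R -> R[i]) : R :=
  Num.sqrt (fine (sqnormHH s gamma f)).

(* u is the representative of m |-> f_m that is continuous on [0, 1] with     *)
(* values in the homogeneous Sobolev space of order gamma                     *)
Definition continuous_representative (gamma : R) (f : R * R -> R[i])
    (u : R -> R -> R[i]) : Prop :=
  [/\ forall m, unit_itv m -> inH gamma (u m),
      forall m0, unit_itv m0 ->
        normH gamma (fun t => u m t - u m0 t)
          @[m --> within unit_itv (nbhs m0)] --> (0 : R) &
      {ae leb, forall m, unit_itv m -> aeq_circle (fiber f m) (u m)}].

(* The fiber at m = 0 is that of the continuous representative, which exists  *)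
(* for s > 1/2.                                                               *)
Definition inHH0 (s gamma : R) (f : R * R -> R[i]) : Prop :=
  inHH s gamma f /\
  exists u, continuous_representative gamma f u /\
            aeq_circle (u 0) (fun=> 0).

End Annulus.

(* Main.v *)
Require Import Defs.
From HB Require Import structures.
From mathcomp Require Import all_boot all_order all_algebra.
From mathcomp Require Import complex.
From mathcomp Require Import all_classical all_reals all_analysis.
From mathcomp Require Import measurable_realfun.
From mathcomp Require Import ring lra.

(** On the Fourier mode of frequency [k] in the angle, [A] is multiplication by
the symbol [2 * pi * k * phi m]. So [(E(lam) f, g)] should be the sum over [k]
of the integrals of the products of the [k]-th Fourier coefficients of the
fibers of [f] and [g] over the radii at which the symbol is at most [lam].
For small [lam > 0] only the modes [k > 0] change with [lam], and each has the
single boundary radius [m = (lam / (2 * pi * c * k)) ^ (1 / alpha)], because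
[phi] is a pure power near 0 and stays away from 0 elsewhere. Differentiating,
the density of states is the sum over [k] of the product of the coefficients
at this radius, times [m / (alpha * lam)]. A function of class [W^(s,2)] that
vanishes at 0 is [O(m ^ (s - 1/2))] there, by a fractional Morrey inequality,
and the regularity in the angle gains [k ^ (- gamma)]: this is [mode_bound].
The [k]-th term is thus bounded by a multiple of
[k ^ (- 2 * (gamma + s / alpha)) * lam ^ (2 * s / alpha - 1)], and the
hypothesis on [gamma + s / alpha] makes these bounds summable. The summability
also justifies the termwise differentiation, in [density_derivative]. Negative
[lam] and [k] are symmetric.

The projections [E(l)] are known only through the distribution functions
[x |-> (E(x) f, f)], so their action on modes has to be derived.
[spectral_cut] shows that [E(l) f] and [f - E(l) f] stay in the domain of [A],
with the form of [A] at most [l] on the first and at least [l] on the second.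
Let [v] be a radial profile supported where the symbol [a] of the [k]-th mode
exceeds [l], let [c] be large and [b = (c - a) / (c - l)]. The modes [g_n] with
profile [v * b ^ n] satisfy [A g_n = c g_n - (c - l) g_(n+1)], which with the
form inequality gives [|E(l) g_n| <= |E(l) g_(n+1)|]. Hence [E(l) g_0] is at
most [|g_n|], which tends to 0. Likewise [E(l)] fixes the modes supported where
the symbol is less than [l]. This determines the Fourier coefficients of almost
every fiber of [E(l) f], in [fourier_proj]. At almost every radius an increment
of [E] between two levels of the same sign keeps finitely many of them, so a
finite Parseval identity [fourier_finite] and dominated convergence
[mode_series_cvg] give the series for the increments of [(E(lam) f, g)]. *)

Set Implicit Arguments.
Unset Strict Implicit.
Unset Printing Implicit Defensive.

Import Order.TTheory GRing.Theory Num.Theory.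
Import numFieldNormedType.Exports.

Local Open Scope classical_set_scope.
Local Open Scope ring_scope.
Local Open Scope complex_scope.

(** * Complex-valued square-integrable functions *)

Section ComplexAlgebra.
Context (R : realType).
Implicit Types z w : R[i].
Lemma sqr_normc z : Normc.normc z ^+ 2 = complex.Re z ^+ 2 + complex.Im z ^+ 2.
Proof. by case: z => a b /=; rewrite sqr_sqrtr// addr_ge0// sqr_ge0. Qed.

Lemma norm_mul2_le (a b c e : R) :
  `|a * c - b * e| <= a ^+ 2 + b ^+ 2 + (c ^+ 2 + e ^+ 2).
Proof.
have h (x y : R) : `|x * y| <= x ^+ 2 + y ^+ 2.
  rewrite ler_norml; apply/andP; split.
    have := sqr_ge0 (x + y); have := sqr_ge0 x; have := sqr_ge0 y; nra.
  have := sqr_ge0 (x - y); have := sqr_ge0 x; have := sqr_ge0 y; nra.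
apply: le_trans (ler_normB _ _) _; have := h a c; have := h b e; lra.
Qed.

Lemma complexP z w :
  complex.Re z = complex.Re w -> complex.Im z = complex.Im w -> z = w.
Proof. by case: z; case: w => ? ? ? ? /= -> ->. Qed.

Lemma ReD z w : complex.Re (z + w) = complex.Re z + complex.Re w.
Proof. by case: z; case: w. Qed.
Lemma ImD z w : complex.Im (z + w) = complex.Im z + complex.Im w.
Proof. by case: z; case: w. Qed.
Lemma ReN z : complex.Re (- z) = - complex.Re z.
Proof. by case: z. Qed.
Lemma ImN z : complex.Im (- z) = - complex.Im z.
Proof. by case: z. Qed.
Lemma ReM z w : complex.Re (z * w) =
  complex.Re z * complex.Re w - complex.Im z * complex.Im w.
Proof. by case: z; case: w. Qed.
Lemma ImM z w : complex.Im (z * w) =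
  complex.Re z * complex.Im w + complex.Im z * complex.Re w.
Proof. by case: z => a b; case: w => x y /=. Qed.
Lemma ReJ z : complex.Re (z^*)%R = complex.Re z.
Proof. by case: z. Qed.
Lemma ImJ z : complex.Im (z^*)%R = - complex.Im z.
Proof. by case: z. Qed.

Lemma conjcDM z w v : ((z * w + v)^* = z^* * w^* + v^*)%R.
Proof. by case: z w v => a b [? ?] [? ?]; apply: complexP => /=; ring. Qed.
Lemma conjcN1 : ((-1 : R[i])^* = -1)%R.
Proof. by apply: complexP; rewrite /= ?oppr0. Qed.

End ComplexAlgebra.

Definition cE := (ReD, ImD, ReN, ImN, ReM, ImM, ReJ, ImJ).

Section AlmostEverywhere.
Context (R : realType) (d : measure_display) (T : measurableType d).
Context (mu : {measure set T -> \bar R}).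
Implicit Types P Q S : T -> Prop.

Lemma aeS P Q : (forall x, P x -> Q x) ->
  {ae mu, forall x, P x} -> {ae mu, forall x, Q x}.
Proof. by move=> PQ; apply: filterS. Qed.

Lemma aeS2 P Q S : (forall x, P x -> Q x -> S x) ->
  {ae mu, forall x, P x} -> {ae mu, forall x, Q x} -> {ae mu, forall x, S x}.
Proof. by move=> PQ; apply: filterS2. Qed.

End AlmostEverywhere.

Section Integrals.
Context (R : realType) (d : measure_display) (T : measurableType d).
Context (mu : {measure set T -> \bar R}) (D : set T) (mD : measurable D).
Implicit Types f g h : T -> R[i].

Notation Re := complex.Re.
Notation Im := complex.Im.

Definition cintegrable f :=
  mu.-integrable D (fun x => (Re (f x))%:E) /\
  mu.-integrable D (fun x => (Im (f x))%:E).

Lemma integrable_cst_fin (c : R) : (mu D < +oo)%E ->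
  mu.-integrable D (EFin \o (fun=> c)).
Proof.
move=> Dy; apply/integrableP; split; first exact: measurable_cst.
rewrite (eq_integral (cst `|c|%:E)) ?integral_cst//.
exact: lte_mul_pinfty.
Qed.

Lemma integrable_lin (a b : R) (u v : T -> R) :
  mu.-integrable D (EFin \o u) -> mu.-integrable D (EFin \o v) ->
  mu.-integrable D (fun x => (a * u x + b * v x)%:E).
Proof.
move=> iu iv.
have := integrableD mD (integrableZl mD a iu) (integrableZl mD b iv).
by apply: eq_integrable => // x _; rewrite /= EFinD !EFinM.
Qed.

Lemma Rintegral_lin (a b : R) (u v : T -> R) :
  mu.-integrable D (EFin \o u) -> mu.-integrable D (EFin \o v) ->
  Rintegral mu D (fun x => a * u x + b * v x) =
  a * Rintegral mu D u + b * Rintegral mu D v.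
Proof.
move=> iu iv; rewrite RintegralD//; first by rewrite !RintegralZl.
- by have := integrableZl mD a iu; apply: eq_integrable => // x _; rewrite /= EFinM.
- by have := integrableZl mD b iv; apply: eq_integrable => // x _; rewrite /= EFinM.
Qed.

(** Applied on small balls: a function with mean zero cannot be close to a
nonzero constant there. *)
Lemma mean0_deviation (u : T -> R) (c M : R) : mu D = M%:E -> 0 <= M ->
  mu.-integrable D (EFin \o u) -> Rintegral mu D u = 0 ->
  ((`|c| * M)%:E <= \int[mu]_(x in D) `|(u x - c)%:E|)%E.
Proof.
move=> DM M0 ui u0.
have ci : mu.-integrable D (EFin \o (fun=> c)).
  by apply: integrable_cst_fin; rewrite DM ltry.
have di : mu.-integrable D (EFin \o (fun x => u x - c)).
  have := integrable_lin 1 (-1) ui ci.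
  by apply: eq_integrable => // x _; rewrite /= mul1r mulN1r.
apply: le_trans (le_abse_integral _ mD (measurable_int _ di)).
rewrite -EFin_normr_Rintegral// RintegralB// u0 Rintegral_cst// DM/=.
by rewrite sub0r normrN normrM (ger0_norm M0).
Qed.

Lemma cintegral_lin a f g : cintegrable f -> cintegrable g ->
  cintegral mu D (fun x => a * f x + g x) =
  a * cintegral mu D f + cintegral mu D g.
Proof.
move=> [f1 f2] [g1 g2]; apply: complexP; rewrite !cE /=.
- have := Rintegral_lin 1 1 (integrable_lin (Re a) (- Im a) f1 f2) g1.
  rewrite (Rintegral_lin _ _ f1 f2) !mul1r mulNr => <-.
  by apply: eq_Rintegral => x _; rewrite !cE; ring.
- have := Rintegral_lin 1 1 (integrable_lin (Im a) (Re a) f1 f2) g2.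
  rewrite (Rintegral_lin _ _ f1 f2) !mul1r => H.
  rewrite [X in X + _]addrC -H.
  by apply: eq_Rintegral => x _; rewrite !cE; ring.
Qed.

Lemma cintegral0 : cintegral mu D (fun=> 0) = 0.
Proof.
by apply: complexP => /=; rewrite /Rintegral integral0.
Qed.

Lemma cintegrable0 : cintegrable (fun=> 0).
Proof. by split; exact: integrable0. Qed.

Lemma cintegralZ a f : cintegrable f ->
  cintegral mu D (fun x => a * f x) = a * cintegral mu D f.
Proof.
move=> fi; have := cintegral_lin a fi cintegrable0.
rewrite cintegral0 addr0 => <-; congr cintegral.
by apply/funext => x; rewrite addr0.
Qed.

Lemma cintegral_conj f : cintegrable f ->
  cintegral mu D (fun x => (f x)^*%R) = (cintegral mu D f)^*%R.
Proof.
move=> [f1 f2]; apply: complexP; rewrite /cintegral /=.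
  by apply: eq_Rintegral => x _; rewrite ReJ.
rewrite (@eq_Rintegral _ _ _ mu D (fun x => -1 * Im (f x))).
  by rewrite RintegralZl// mulN1r.
by move=> x _; rewrite ImJ mulN1r.
Qed.

Lemma eq_cintegral f g : (forall x, D x -> f x = g x) ->
  cintegral mu D f = cintegral mu D g.
Proof.
move=> fg; apply: complexP => /=; apply: eq_Rintegral => x /set_mem Dx;
  by rewrite fg.
Qed.

Lemma ae_eq_cintegral f g : cmeasurable D f -> cmeasurable D g ->
  aeqc mu D f g -> cintegral mu D f = cintegral mu D g.
Proof.
move=> [f1 f2] [g1 g2] fg.
apply: complexP => /=; congr fine; apply: ae_eq_integral => //.
- exact/measurable_EFinP.
- exact/measurable_EFinP.
- by apply: filterS fg => x fgx Dx; rewrite fgx.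
- exact/measurable_EFinP.
- exact/measurable_EFinP.
- by apply: filterS fg => x fgx Dx; rewrite fgx.
Qed.

Lemma cintegrable_cmeasurable f : cintegrable f -> cmeasurable D f.
Proof.
by move=> [/measurable_int/measurable_EFinP f1 /measurable_int/measurable_EFinP f2].
Qed.

Lemma cmeasurableM f g : cmeasurable D f -> cmeasurable D g ->
  cmeasurable D (fun x => f x * g x).
Proof.
move=> [f1 f2] [g1 g2]; split.
- by under eq_fun do rewrite ReM; apply: measurable_funB; apply: measurable_funM.
- by under eq_fun do rewrite ImM; apply: measurable_funD; apply: measurable_funM.
Qed.

Lemma cmeasurableD f g : cmeasurable D f -> cmeasurable D g ->
  cmeasurable D (fun x => f x + g x).
Proof.
move=> [f1 f2] [g1 g2]; split.
- by under eq_fun do rewrite ReD; apply: measurable_funD.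
- by under eq_fun do rewrite ImD; apply: measurable_funD.
Qed.

Lemma cmeasurable_conj f : cmeasurable D f -> cmeasurable D (fun x => (f x)^*%R).
Proof.
move=> [f1 f2]; split; first by under eq_fun do rewrite ReJ.
by under eq_fun do rewrite ImJ; exact: measurableT_comp.
Qed.

Lemma cmeasurable_cst a : cmeasurable D (fun=> a : R[i]).
Proof. by split; exact: measurable_cst. Qed.

Lemma measurable_sqnormc f : cmeasurable D f ->
  measurable_fun D (fun x => Normc.normc (f x) ^+ 2).
Proof.
move=> [f1 f2]; under eq_fun do rewrite sqr_normc.
by apply: measurable_funD; exact: measurable_funX.
Qed.

Lemma inL2P f : inL2 mu D f <->
  cmeasurable D f /\ mu.-integrable D (fun x => (Normc.normc (f x) ^+ 2)%:E).
Proof.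
split=> [] [mf fi]; split => //.
  apply/integrableP; split; first exact/measurable_EFinP/measurable_sqnormc.
  apply: le_lt_trans fi; rewrite /sqnormL2 le_eqVlt; apply/orP; left; apply/eqP.
  by apply: eq_integral => x _; rewrite /= ger0_norm// sqr_ge0.
move/integrableP : fi => [_]; apply: le_lt_trans.
rewrite le_eqVlt; apply/orP; left; apply/eqP.
by apply: eq_integral => x _; rewrite /= ger0_norm// sqr_ge0.
Qed.

Lemma cintegrable_mul_conj f g : inL2 mu D f -> inL2 mu D g ->
  cintegrable (fun x => f x * (g x)^*).
Proof.
move=> /inL2P[mf fi] /inL2P[mg gi].
have := integrable_lin 1 1 fi gi.
have [m1 m2] := cmeasurableM mf (cmeasurable_conj mg).
move=> H; split; apply: (le_integrable mD _ _ H); try exact/measurable_EFinP.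
- move=> x Dx; rewrite /= lee_fin !mul1r [leRHS]ger0_norm ?addr_ge0 ?sqr_ge0//.
  by rewrite !sqr_normc !cE -(sqrrN (Im (g x))) norm_mul2_le.
- move=> x Dx; rewrite /= lee_fin !mul1r [leRHS]ger0_norm ?addr_ge0 ?sqr_ge0//.
  rewrite !sqr_normc !cE.
  have := norm_mul2_le (Re (f x)) (- Im (f x)) (- Im (g x)) (Re (g x)).
  by rewrite !sqrrN mulNr opprK [Im (g x) ^+ 2 + _]addrC.
Qed.

Lemma inL2_lin a f g : inL2 mu D f -> inL2 mu D g ->
  inL2 mu D (fun x => a * f x + g x).
Proof.
move=> /inL2P[mf fi] /inL2P[mg gi]; apply/inL2P.
have mfg : cmeasurable D (fun x => a * f x + g x).
  by apply: cmeasurableD => //; apply: cmeasurableM => //; exact: cmeasurable_cst.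
split => //.
have := integrable_lin (2 * Normc.normc a ^+ 2) 2 fi gi.
apply: le_integrable => //; first exact/measurable_EFinP/measurable_sqnormc.
move=> x Dx; rewrite /= lee_fin.
rewrite [leLHS]ger0_norm ?sqr_ge0// [leRHS]ger0_norm; last first.
  have := sqr_ge0 (Normc.normc a); have := sqr_ge0 (Normc.normc (f x)).
  have := sqr_ge0 (Normc.normc (g x)) => ? ? ?.
  by rewrite addr_ge0// mulr_ge0// mulr_ge0.
rewrite !sqr_normc !cE.
set b := Re a; set c := Im a; set p := Re (f x); set q := Im (f x).
set r := Re (g x); set s := Im (g x).
have := sqr_ge0 (b * p - c * q - r); have := sqr_ge0 (b * q + c * p - s).
nra.
Qed.

Lemma inL2_0 : inL2 mu D (fun=> 0).
Proof.
split; first exact: cmeasurable_cst.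
rewrite /sqnormL2 (eq_integral (cst 0%E)) ?integral0 ?ltry// => x _.
by rewrite /= expr0n addr0 sqrtr0 expr0n.
Qed.

Lemma inL2Z a f : inL2 mu D f -> inL2 mu D (fun x => a * f x).
Proof.
move=> fi; have := inL2_lin a fi inL2_0.
by under eq_fun do rewrite addr0.
Qed.

Lemma inL2D f g : inL2 mu D f -> inL2 mu D g -> inL2 mu D (fun x => f x + g x).
Proof.
move=> fi gi; have := inL2_lin 1 fi gi.
by under eq_fun do rewrite mul1r.
Qed.

Lemma inL2B f g : inL2 mu D f -> inL2 mu D g -> inL2 mu D (fun x => f x - g x).
Proof.
move=> fi gi; have := inL2D fi (inL2Z (-1) gi).
by under eq_fun do rewrite mulN1r.
Qed.

Lemma ipL2_linl a f g h : inL2 mu D f -> inL2 mu D g -> inL2 mu D h ->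
  ipL2 mu D (fun x => a * f x + g x) h = a * ipL2 mu D f h + ipL2 mu D g h.
Proof.
move=> fi gi hi; rewrite /ipL2 -cintegral_lin//; try exact: cintegrable_mul_conj.
by apply: eq_cintegral => x _; rewrite mulrDl mulrA.
Qed.

Lemma ipL2C f g : inL2 mu D f -> inL2 mu D g ->
  ipL2 mu D g f = (ipL2 mu D f g)^*%R.
Proof.
move=> fi gi; rewrite /ipL2 -cintegral_conj; last exact: cintegrable_mul_conj.
by apply: eq_cintegral => x _; rewrite rmorphM /= conjCK mulrC.
Qed.

Lemma ipL2_linr a f g h : inL2 mu D f -> inL2 mu D g -> inL2 mu D h ->
  ipL2 mu D h (fun x => a * f x + g x) = a^* * ipL2 mu D h f + ipL2 mu D h g.
Proof.
move=> fi gi hi; rewrite ipL2C//; last exact: inL2_lin.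
by rewrite ipL2_linl// conjcDM -!ipL2C.
Qed.

Lemma ipL2Dr f g h : inL2 mu D f -> inL2 mu D g -> inL2 mu D h ->
  ipL2 mu D h (fun x => f x + g x) = ipL2 mu D h f + ipL2 mu D h g.
Proof.
move=> fi gi hi; have := ipL2_linr 1 fi gi hi.
rewrite conjC1 mul1r => <-.
by under [in RHS]eq_fun do rewrite mul1r.
Qed.

Lemma ipL2Bl f g h : inL2 mu D f -> inL2 mu D g -> inL2 mu D h ->
  ipL2 mu D (fun x => f x - g x) h = ipL2 mu D f h - ipL2 mu D g h.
Proof.
move=> fi gi hi.
have <- : (-1) * ipL2 mu D g h + ipL2 mu D f h = ipL2 mu D f h - ipL2 mu D g h.
  by rewrite mulN1r addrC.
rewrite -(ipL2_linl _ gi fi hi); congr ipL2; apply/funext => x.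
by rewrite mulN1r addrC.
Qed.

Lemma ipL2Br f g h : inL2 mu D f -> inL2 mu D g -> inL2 mu D h ->
  ipL2 mu D h (fun x => f x - g x) = ipL2 mu D h f - ipL2 mu D h g.
Proof.
move=> fi gi hi.
rewrite ipL2C//; last exact: inL2B.
by rewrite ipL2Bl// [_ - _]addrC -[X in X + _]mulN1r conjcDM -!ipL2C// conjcN1 mulN1r addrC.
Qed.

Lemma aeqc_ipL2 f f' g g' : inL2 mu D f -> inL2 mu D f' ->
  inL2 mu D g -> inL2 mu D g' ->
  aeqc mu D f f' -> aeqc mu D g g' -> ipL2 mu D f g = ipL2 mu D f' g'.
Proof.
move=> fi fi' gi gi' ff' gg'; apply: ae_eq_cintegral.
- exact/cintegrable_cmeasurable/cintegrable_mul_conj.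
- exact/cintegrable_cmeasurable/cintegrable_mul_conj.
by apply: filterS2 ff' gg' => x h1 h2 Dx; rewrite h1// h2.
Qed.

(** The square of the norm; its linear structure is that of the scalar
product. *)
Definition sqL2 f : R := Re (ipL2 mu D f f).

Lemma sqL2E f : inL2 mu D f -> sqL2 f = fine (sqnormL2 mu D f).
Proof.
move=> fi; rewrite /sqL2 /=; congr fine.
by apply: eq_integral => x _; rewrite sqr_normc !cE; congr EFin; ring.
Qed.

Lemma sqL2_ge0 f : 0 <= sqL2 f.
Proof. by apply: Rintegral_ge0 => x _; rewrite !cE mulrN opprK addr_ge0// -expr2 sqr_ge0. Qed.

Lemma normL2_sqr f : inL2 mu D f -> normL2 mu D f ^+ 2 = sqL2 f.
Proof.
by move=> fi; rewrite /normL2 sqr_sqrtr -?sqL2E// sqL2_ge0.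
Qed.

(** Cauchy-Schwarz in the weak form of the arithmetic-geometric mean. *)
Lemma Re_ipL2_le f g : inL2 mu D f -> inL2 mu D g ->
  2 * Re (ipL2 mu D f g) <= sqL2 f + sqL2 g.
Proof.
move=> fi gi; have := sqL2_ge0 (fun x => f x - g x).
rewrite /sqL2 ipL2Br//; last exact: inL2B.
rewrite !ipL2Bl// (ipL2C fi gi) !cE /=; lra.
Qed.

End Integrals.

(** * Spectral distribution functions *)

Section Stieltjes.
Context (R : realType).
Implicit Types F G : cumulative R R.
Notation lsm := (@lebesgue_stieltjes_measure R).

Lemma stieltjes_oc F a b : a <= b -> lsm F `]a, b]%classic = (F b - F a)%:E.
Proof.
move=> ab; rewrite /lebesgue_stieltjes_measure /measure_extension/=.
by rewrite measurable_mu_extE/= ?wlength_itv_bnd//; exact: is_ocitv.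
Qed.

(** A Stieltjes measure is determined by its values on half-open intervals. *)
Lemma stieltjes_restr F G (S : set R) : measurable S ->
  (forall a b, a <= b -> (G b - G a)%:E = lsm F (`]a, b]%classic `&` S)) ->
  forall X, measurable X -> lsm G X = lsm F (X `&` S).
Proof.
move=> mS H X mX.
apply: (@lebesgue_stieltjes_measure_unique _ _ (mrestr (lsm F) mS)) => //.
move=> _ [[a b]]/= _ <-; rewrite /mrestr.
have [ab|ba] := leP a b; last first.
  by rewrite set_itv_ge ?set0I ?measure0// bnd_simp -leNgt ltW.
by rewrite -H// -stieltjes_oc.
Qed.

Lemma stieltjes_restr_le F G (l : R) : (forall x, G x = F (Order.min x l)) ->
  forall X, measurable X -> lsm G X = lsm F (X `&` `]-oo, l]).
Proof.
move=> GF; apply: stieltjes_restr => // a b ab; rewrite !GF.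
rewrite (_ : _ `&` _ = `]Order.min a l, Order.min b l]%classic).
  by rewrite stieltjes_oc// le_min2.
rewrite predeqE => x /=; rewrite !in_itv/= le_min gt_min.
split=> [[/andP[ax ->] ->]|]; rewrite ?ax//.
by case/andP => h /andP[-> xl]; rewrite xl; split => //; rewrite andbT;
  case/orP : h => // /(le_lt_trans xl); rewrite ltxx.
Qed.

Lemma stieltjes_restr_gt F G (l : R) :
  (forall x, G x = F (Order.max x l) - F l) ->
  forall X, measurable X -> lsm G X = lsm F (X `&` `]l, +oo[).
Proof.
move=> GF; apply: stieltjes_restr => // a b ab; rewrite !GF.
rewrite (_ : _ `&` _ = `]Order.max a l, Order.max b l]%classic).
  by rewrite stieltjes_oc ?le_max2//; congr EFin; ring.
rewrite predeqE => x /=; rewrite !in_itv/= andbT le_max gt_max.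
split=> [[/andP[-> ->] ->]//|/andP[/andP[-> lx]]].
by case/orP => [->//|/(lt_le_trans lx)]; rewrite ltxx.
Qed.

Lemma stieltjes_restr_ge0_integral F G (S : set R) (f : R -> \bar R) :
  measurable S ->
  (forall X, measurable X -> lsm G X = lsm F (X `&` S)) ->
  measurable_fun setT f -> (forall x, 0 <= f x)%E ->
  (\int[lsm G]_x f x = \int[lsm F]_(x in S) f x)%E.
Proof.
move=> mS GF mf f0.
have mS' : measurable (~` S) by exact: measurableC.
have G0 : lsm G (~` S) = 0%E by rewrite GF// setICl measure0.
have -> := @ge0_negligible_integral _ _ R (lsm G) setT (~` S) f mS' measurableT
  mf (fun x _ => f0 x) G0.
rewrite setTD setCK; apply: eq_measure_integral => A mA AS.
by have := GF A mA; rewrite setIidl.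
Qed.

Lemma stieltjes_restr_integral F G (S : set R) (f : R -> \bar R) :
  measurable S ->
  (forall X, measurable X -> lsm G X = lsm F (X `&` S)) ->
  (lsm F).-integrable setT f ->
  (lsm G).-integrable setT f /\
  (\int[lsm G]_x f x = \int[lsm F]_(x in S) f x)%E.
Proof.
move=> mS GF fi; have /integrableP[mf fy] := fi.
have Gf : (lsm G).-integrable setT f.
  apply/integrableP; split; first exact: mf.
  rewrite (stieltjes_restr_ge0_integral mS GF)//; last exact: measurableT_comp.
  apply: le_lt_trans fy; apply: ge0_subset_integral => //.
  exact: measurableT_comp.
split; first exact: Gf.
have mS' : measurable (~` S) by exact: measurableC.
have G0 : lsm G (~` S) = 0%E by rewrite GF// setICl measure0.
have -> := @negligible_integral _ _ R (lsm G) setT (~` S) f mS' measurableT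
  Gf G0.
rewrite setTD setCK; apply: eq_measure_integral => A mA AS.
by have := GF A mA; rewrite setIidl.
Qed.

End Stieltjes.

Section Resolution.
Context (R : realType) (d : measure_display) (T : measurableType d).
Context (mu : {measure set T -> \bar R}) (D : set T) (mD : measurable D).
Context (E : R -> (T -> R[i]) -> T -> R[i]).
Hypothesis hE : resolution_of_identity mu D E.

Notation Re := complex.Re.
Notation L2 := (inL2 mu D).
Notation ip := (ipL2 mu D).
Notation sq := (sqL2 mu D).
Notation "f =ae g" := (aeqc mu D f g) (at level 70).

Lemma aeqc_refl (f : T -> R[i]) : f =ae f.
Proof. by apply: aeW. Qed.

Lemma aeqc_sym (f g : T -> R[i]) : f =ae g -> g =ae f.
Proof. by apply: filterS => x fg Dx; rewrite fg. Qed.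

Lemma aeqc_trans (f g h : T -> R[i]) : f =ae g -> g =ae h -> f =ae h.
Proof. by apply: filterS2 => x fg gh Dx; rewrite fg// gh. Qed.

Let EL2 x f : L2 f -> L2 (E x f).
Proof. by have [/(_ x)[+ _ _ _ _] _ _ _ _] := hE; exact. Qed.

Let Eae x f g : L2 f -> L2 g -> f =ae g -> E x f =ae E x g.
Proof. by have [/(_ x)[_ + _ _ _] _ _ _ _] := hE; exact. Qed.

Let Elin x a f g : L2 f -> L2 g ->
  E x (fun t => a * f t + g t) =ae (fun t => a * E x f t + E x g t).
Proof. by have [/(_ x)[_ _ + _ _] _ _ _ _] := hE; exact. Qed.

Let Esym x f g : L2 f -> L2 g -> ip (E x f) g = ip f (E x g).
Proof. by have [/(_ x)[_ _ _ _ +] _ _ _ _] := hE; exact. Qed.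

Let Eidem x f : L2 f -> E x (E x f) =ae E x f.
Proof. by have [/(_ x)[_ _ _ + _] _ _ _ _] := hE; exact. Qed.

Let ipae f f' g g' : L2 f -> L2 f' -> L2 g -> L2 g' ->
  f =ae f' -> g =ae g' -> ip f g = ip f' g'.
Proof. exact: aeqc_ipL2. Qed.

Lemma ip_proj x f g : L2 f -> L2 g -> ip (E x f) (E x g) = ip (E x f) g.
Proof.
move=> fi gi; rewrite -Esym//; last exact: EL2.
by apply: ipae => //; [do 2 apply: EL2|apply: EL2|exact: Eidem|exact: aeqc_refl].
Qed.

Lemma sq_proj x f : L2 f -> sq (E x f) = Re (ip (E x f) f).
Proof. by move=> fi; rewrite /sqL2 ip_proj. Qed.

Lemma sq_proj_le x f : L2 f -> sq (E x f) <= sq f.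
Proof.
move=> fi; have := Re_ipL2_le mD (EL2 x fi) fi; rewrite -sq_proj//; lra.
Qed.

Lemma sq_projC x f : L2 f -> sq (fun t => f t - E x f t) = sq f - sq (E x f).
Proof.
move=> fi; have Ei := EL2 x fi.
rewrite {1}/sqL2 ipL2Br//; last exact: inL2B.
rewrite !ipL2Bl// ip_proj// (ipL2C mD Ei fi) !cE -sq_proj// /sqL2; ring.
Qed.

Lemma ip_projC x f g : L2 f -> L2 g ->
  ip (fun t => f t - E x f t) (fun t => g t - E x g t) =
  ip (fun t => f t - E x f t) g.
Proof.
move=> fi gi; have Ei := EL2 x fi; have Gi := EL2 x gi.
rewrite ipL2Br//; last exact: inL2B.
by rewrite [X in _ - X]ipL2Bl// ip_proj// -Esym// subrr subr0.
Qed.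

Lemma projK x l f : L2 f -> E l (E x (E l f)) =ae E x (E l f).
Proof.
move=> fi; have [_ H _ _ _] := hE; have [xl|/ltW lx] := leP x l.
  by have [_] := H _ _ _ xl (EL2 l fi).
have h : E x (E l f) =ae E l f by have [_] := H _ _ _ lx fi.
have e : E l (E x (E l f)) =ae E l (E l f).
  by apply: Eae => //; do ?apply: EL2.
apply: aeqc_trans e _; apply: aeqc_trans (aeqc_sym h); exact: Eidem.
Qed.

Lemma ip_proj_projC x l f : L2 f ->
  ip (E x (E l f)) (fun t => f t - E l f t) = 0.
Proof.
move=> fi; have Ei := EL2 l fi; have EEi := EL2 x Ei.
rewrite ipL2Br// -Esym// (@ipae (E l (E x (E l f))) (E x (E l f)) f f) ?subrr//.
- exact: EL2.
- exact: projK.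
- exact: aeqc_refl.
Qed.

Lemma ip_proj_min x l f : L2 f ->
  ip (E x (E l f)) (E l f) = ip (E (Order.min x l) f) f.
Proof.
move=> fi; have Ei := EL2 l fi; have EEi := EL2 x Ei.
have [_ H _ _ _] := hE.
rewrite -Esym//.
apply: ipae => //; [exact: EL2|exact: EL2| |exact: aeqc_refl].
apply: aeqc_trans (projK _ _ fi) _.
have [xl|/ltW lx] := leP x l; first by have [] := H _ _ _ xl fi.
by have [_] := H _ _ _ lx fi.
Qed.

(** The two parts into which [E l] splits [f] stay orthogonal under every
[E x]; so for [z] of modulus 1 the combination has the same spectral
distribution as [f]. *)
Lemma ip_proj_comb x l z f : L2 f ->
  let p := E l f in let q := (fun t => f t - E l f t) in
  ip (E x (fun t => z * q t + p t)) (fun t => z * q t + p t) =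
  z * z^* * ip (E x q) q + ip (E x p) p.
Proof.
move=> fi p q; have Ei : L2 p := EL2 l fi; have qi : L2 q := inL2B mD fi Ei.
have Exp := EL2 x Ei; have Exq := EL2 x qi.
have zqp : L2 (fun t => z * q t + p t) by exact: inL2_lin.
rewrite (@ipae _ (fun t => z * E x q t + E x p t) _ (fun t => z * q t + p t))//;
  [|exact: EL2|exact: inL2_lin|exact: Elin|exact: aeqc_refl].
rewrite ipL2_linl// !ipL2_linr//.
have -> : ip (E x p) q = 0 by exact: ip_proj_projC.
have -> : ip (E x q) p = 0.
  by rewrite Esym// (ipL2C mD Exp qi) ip_proj_projC// rmorph0.
by rewrite mulr0 addr0 add0r mulrA.
Qed.

Lemma ip_proj_max x l f : L2 f ->
  let q := (fun t => f t - E l f t) in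
  ip (E x q) q = ip (E (Order.max x l) f) f - ip (E l f) f.
Proof.
move=> fi q; have := @ip_proj_comb x l 1 f fi.
rewrite /= conjC1 mulr1 mul1r ip_proj_min// -/q.
have -> : (fun t => 1 * q t + E l f t) = f.
  by apply/funext => t; rewrite mul1r /q subrK.
move=> h; have [xl|lx] := leP x l.
  move: h; rewrite min_l// -{1}[ip (E x f) f]add0r => /addIr <-.
  by rewrite subrr.
move: h; rewrite min_r 1?ltW// => ->.
by rewrite addrK.
Qed.

Lemma proj_cvg_Ny f : L2 f -> sq (E y f) @[y --> -oo] --> 0.
Proof.
have [_ _ _ H _] := hE => fi.
have h : normL2 mu D (E y f) * normL2 mu D (E y f) @[y --> -oo] --> (0 * 0 : R).
  by apply: cvgM; exact: H.
rewrite mulr0 in h; apply: (cvg_trans _ h).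
apply: near_eq_cvg; near=> y; rewrite /= -expr2 normL2_sqr//; exact: EL2.
Unshelve. all: by end_near. Qed.

Lemma proj_cvg_y f : L2 f -> sq (E y f) @[y --> +oo] --> sq f.
Proof.
have [_ _ _ _ H] := hE => fi.
pose n y := normL2 mu D (fun t => E y f t - f t).
have h : sq f - n y * n y @[y --> +oo] --> (sq f - 0 * 0 : R).
  by apply: cvgB; [exact: cvg_cst|apply: cvgM; exact: H].
rewrite mulr0 subr0 in h; apply: (cvg_trans _ h).
apply: near_eq_cvg; near=> y; rewrite /= /n.
have Ei := EL2 y fi.
rewrite -expr2 normL2_sqr//; last exact: inL2B.
have -> : sq (fun t => E y f t - f t) = sq (fun t => f t - E y f t).
  rewrite /sqL2 !ipL2Br ?ipL2Bl//; try exact: inL2B.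
  by rewrite !cE; ring.
by rewrite sq_projC//; ring.
Unshelve. all: by end_near. Qed.

End Resolution.

(** * Cutting a function by a spectral projection *)

Section SpectralCut.
Context (R : realType) (d : measure_display) (T : measurableType d).
Context (mu : {measure set T -> \bar R}) (D : set T) (mD : measurable D).
Context (A : (T -> R[i]) -> (T -> R[i]) -> Prop).
Context (E : R -> (T -> R[i]) -> T -> R[i]).
Hypothesis hE : spectral_resolution mu D A E.
Hypothesis AL2 : forall f h, A f h -> inL2 mu D f /\ inL2 mu D h.
Hypothesis Alin : forall z f f' h h', A f h -> A f' h' ->
  A (fun t => z * f t + f' t) (fun t => z * h t + h' t).

Notation Re := complex.Re.
Notation L2 := (inL2 mu D).
Notation ip := (ipL2 mu D).
Notation sq := (sqL2 mu D).
Notation lsm := (@lebesgue_stieltjes_measure R).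

Let hR : resolution_of_identity mu D E. Proof. by case: hE. Qed.

Let EL2 x f : L2 f -> L2 (E x f).
Proof. by have [/(_ x)[+ _ _ _ _] _ _ _ _] := hR; exact. Qed.

(** The projections tend to 0 at minus infinity and to the identity at plus
infinity. *)
Lemma stieltjes_mass (F : cumulative R R) f : L2 f ->
  (forall x, F x = sq (E x f)) -> lsm F setT = (sq f)%:E.
Proof.
move=> fi FE.
have h1 : lsm F `]- n%:R, n%:R]%classic @[n --> \oo] --> (sq f)%:E.
  suff : (F n%:R - F (- n%:R))%:E @[n --> \oo] --> (sq f - 0)%:E.
    rewrite subr0 => h; apply: (cvg_trans _ h); apply: near_eq_cvg; near=> n.
    by rewrite stieltjes_oc// ge0_cp//.
  apply: cvg_EFin; first by near=> n.
  apply: cvgB.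
    have h := proj_cvg_y mD hR fi.
    have := cvg_comp _ _ (@cvgr_idn R) h.
    by apply: cvg_trans; apply: near_eq_cvg; near=> n; rewrite /= FE.
  have h := proj_cvg_Ny hR fi.
  have hN : (- n%:R : R) @[n --> \oo] --> -oo.
    by apply/cvgNrNy; exact: cvgr_idn.
  have := cvg_comp _ _ hN h.
  by apply: cvg_trans; apply: near_eq_cvg; near=> n; rewrite /= FE.
have h2 : lsm F `]- n%:R, n%:R]%classic @[n --> \oo] --> lsm F setT.
  have -> : setT = \bigcup_n `]- n%:R, n%:R]%classic :> set R.
    apply/esym; rewrite -subTset => /= x _ /=.
    exists (Num.bound `|x|) => //=; rewrite in_itv/=.
    by have := archi_boundP (normr_ge0 x); rewrite ltr_norml => /andP[-> /ltW].
  apply: nondecreasing_cvg_mu => //; first exact: bigcup_measurable.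
  move=> m n mn; apply/subsetPset/subset_itv; rewrite bnd_simp ?lerN2 ler_nat//.
exact: cvg_unique h2 h1.
Unshelve. all: by end_near. Qed.

Lemma integrable_id_stieltjes (F : cumulative R R) :
  (lsm F setT < +oo)%E -> (\int[lsm F]_x (x ^+ 2)%:E < +oo)%E ->
  (lsm F).-integrable setT (EFin \o idfun).
Proof.
move=> F1 F2.
have m2 : measurable_fun setT (fun x : R => x ^+ 2) by exact: measurable_funX.
have i2 : (lsm F).-integrable setT (EFin \o (fun x : R => x ^+ 2)).
  apply/integrableP; split; first exact/measurable_EFinP.
  apply: le_lt_trans F2; rewrite le_eqVlt; apply/orP; left; apply/eqP.
  by apply: eq_integral => x _; rewrite /= ger0_norm// sqr_ge0.
have i1 : (lsm F).-integrable setT (EFin \o (fun=> 1 : R)).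
  apply/integrableP; split; first exact: measurable_cst.
  rewrite (eq_integral (cst 1%E)); first by rewrite integral_cst// mul1e.
  by move=> x _; rewrite /= normr1.
have := integrable_lin measurableT 1 1 i1 i2.
apply: le_integrable => //; first by apply/measurable_EFinP; exact: measurable_id.
move=> x _; rewrite /= lee_fin !mul1r [leRHS]ger0_norm; last first.
  by rewrite addr_ge0 ?sqr_ge0.
have := sqr_ge0 x; have := sqr_ge0 (x - 1); have := sqr_ge0 (x + 1).
by rewrite ler_norml => ? ? ?; apply/andP; split; nra.
Qed.

(** The spectral measures of [p] and [q] are the restrictions of that of [f] to
the two sides of [l]. So both functions lie in the domain of [A], whose form
is at most [l] on the first and at least [l] on the second. The mixed terms
vanish because all [z * q + p] with [z] of modulus 1 have the spectral measure
of [f], hence the same value of the form; [z = 1] and [z = 'i] separate the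
two terms. *)
Lemma spectral_cut f h l : A f h ->
  let p := E l f in let q := (fun t => f t - E l f t) in
  exists hp hq, [/\ A p hp, A q hq, ip hp q = 0 & ip hq p = 0] /\
    Re (ip hp p) <= l * sq p /\ l * sq q <= Re (ip hq q).
Proof.
move=> Afh p q; have [fi hi] := AL2 Afh.
have pi : L2 p := EL2 l fi; have qi : L2 q := inL2B mD fi pi.
have [_ dE] := hE.
have [F [FE /iffLR/(_ (ex_intro _ h Afh)) Foo FA]] := dE f fi.
have [Fp [FpE dp Ap]] := dE p pi.
have [Fq [FqE dq Aq]] := dE q qi.
have FpF x : Fp x = F (Order.min x l).
  have := FpE x; rewrite (ip_proj_min mD hR)// -FE => -[].
  exact.
have FqF x : Fq x = F (Order.max x l) - F l.
  have := FqE x; rewrite (ip_proj_max mD hR)// -!FE => /(congr1 (@complex.Re R)) /=.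
  exact.
have Fsq x : F x = sq (E x f) by rewrite (sq_proj mD hR)// -FE.
have Fpsq x : Fp x = sq (E x p) by rewrite (sq_proj mD hR)// -FpE.
have Fqsq x : Fq x = sq (E x q) by rewrite (sq_proj mD hR)// -FqE.
have FT := stieltjes_mass fi Fsq.
have FpT := stieltjes_mass pi Fpsq.
have FqT := stieltjes_mass qi Fqsq.
have Rp := stieltjes_restr_le FpF.
have Rq := stieltjes_restr_gt FqF.
have m2 : measurable_fun setT (fun x : R => (x ^+ 2)%:E).
  by apply/measurable_EFinP; exact: measurable_funX.
have sq0 (x : R) : (0 <= (x ^+ 2)%:E)%E by rewrite lee_fin sqr_ge0.
have [hp Ahp] : exists hp, A p hp.
  apply/dp; apply: le_lt_trans Foo.
  rewrite (stieltjes_restr_ge0_integral _ Rp m2)//.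
  exact: ge0_subset_integral.
have [hq Ahq] : exists hq, A q hq.
  apply/dq; apply: le_lt_trans Foo.
  rewrite (stieltjes_restr_ge0_integral _ Rq m2)//.
  exact: ge0_subset_integral.
have [_ hpi] := AL2 Ahp; have [_ hqi] := AL2 Ahq.
have Fi : (lsm F).-integrable setT (EFin \o idfun).
  by apply: integrable_id_stieltjes; [rewrite FT ltry|exact: Foo].
set S := `]-oo, l]%classic in Rp; set S' := `]l, +oo[%classic in Rq.
have mS : measurable S by exact: measurable_itv.
have mS' : measurable S' by exact: measurable_itv.
have ep : ip hp p = (Rintegral (lsm F) S idfun)%:C.
  by rewrite (Ap _ Ahp) /Rintegral; have [_ ->] := stieltjes_restr_integral mS Rp Fi.
have eq : ip hq q = (Rintegral (lsm F) S' idfun)%:C.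
  by rewrite (Aq _ Ahq) /Rintegral; have [_ ->] := stieltjes_restr_integral mS' Rq Fi.
have SS' : setT = S `|` S' by rewrite /S' -setCitvl setUv.
have Fsum : Rintegral (lsm F) setT idfun =
    Rintegral (lsm F) S idfun + Rintegral (lsm F) S' idfun.
  rewrite SS' Rintegral_setU//; first by rewrite -SS'.
  by apply/disj_setPS => x; rewrite /S/S'/= !in_itv/= andbT => -[]; case: ltP.
have cross z : z * z^* = 1 -> z * ip hq p + z^* * ip hp q = 0.
  move=> zz; pose w t := z * q t + p t.
  have Aw : A w (fun t => z * hq t + hp t) by exact: Alin.
  have [wi hwi] := AL2 Aw.
  have [Fw [FwE _ FwA]] := dE w wi.
  have FwF x : Fw x = F x.
    have h1 := ip_proj_comb mD hR x l z fi.
    have h2 := ip_proj_comb mD hR x l 1 fi.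
    have := FwE x; rewrite h1 zz; move: h2; rewrite /= conjC1 mulr1 => <-.
    have -> : (fun t => 1 * (f t - E l f t) + E l f t) = f.
      by apply/funext => t; rewrite mul1r subrK.
    by rewrite -FE => -[].
  have RwF X : measurable X -> lsm Fw X = lsm F (X `&` setT).
    by apply: stieltjes_restr => // a b ab; rewrite !FwF setIT stieltjes_oc.
  have ew : ip (fun t => z * hq t + hp t) w = (Rintegral (lsm F) setT idfun)%:C.
    by rewrite (FwA _ Aw) /Rintegral; have [_ ->] := stieltjes_restr_integral measurableT RwF Fi.
  move: ew; rewrite /w ipL2_linl// !ipL2_linr// Fsum ep eq.
  rewrite mulrDr mulrA zz mul1r => h0.
  have -> : z * ip hq p + z^* * ip hp q =
    (Rintegral (lsm F) S' idfun)%:C + z * ip hq p + (z^* * ip hp q + (Rintegral (lsm F) S idfun)%:C) - ((Rintegral (lsm F) S idfun)%:C + (Rintegral (lsm F) S' idfun)%:C) by ring.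
  by rewrite h0 rmorphD /= subrr.
have c1 : ip hq p + ip hp q = 0.
  by have := @cross 1; rewrite conjC1 mulr1 !mul1r; exact.
have c2 : ip hq p - ip hp q = 0.
  have ii : ('i : R[i]) * ('i)^* = 1 by rewrite conjCi mulrN -expr2 sqrCi opprK.
  have := @cross 'i ii; rewrite conjCi mulNr -mulrBr => /eqP.
  by rewrite mulf_eq0 (negPf (neq0Ci _)) /= => /eqP.
have e1 : ip hq p = 0.
  have : 2 * ip hq p = 0 by rewrite -[RHS]addr0 -{1}c1 -c2; ring.
  by move/eqP; rewrite mulf_eq0 pnatr_eq0/= => /eqP.
have e2 : ip hp q = 0 by move: c1; rewrite e1 add0r.
exists hp, hq; split => //; rewrite ep eq /=.
have le_lsm (B : set R) : measurable B -> (lsm F B \is a fin_num).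
  move=> mB; rewrite ge0_fin_numE ?measure_ge0//.
  apply: (@le_lt_trans _ _ (lsm F setT)); last by rewrite FT ltry.
  by apply: le_measure; rewrite ?inE//; exact: measurableT.
have cst_i (B : set R) : measurable B -> (lsm F).-integrable B (EFin \o (fun=> l)).
  move=> mB; apply: integrable_cst_fin => //; have := le_lsm _ mB.
  by rewrite fin_numElt => /andP[].
have FS : lsm F S = (sq p)%:E by rewrite -FpT Rp// setTI.
have FS' : lsm F S' = (sq q)%:E by rewrite -FqT Rq// setTI.
split.
  apply: (@le_trans _ _ (Rintegral (lsm F) S (fun=> l))).
    apply: le_Rintegral => //.
    - exact: integrableS Fi.
    - exact: cst_i.
  by rewrite Rintegral_cst// -[sq p]/(fine (sq p)%:E) -FS lexx.
apply: (@le_trans _ _ (Rintegral (lsm F) S' (fun=> l))).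
  by rewrite Rintegral_cst// -[sq q]/(fine (sq q)%:E) -FS' lexx.
apply: le_Rintegral => //.
- exact: cst_i.
- exact: integrableS Fi.
by move=> x; rewrite /S'/= in_itv/= andbT => /ltW.
Qed.

Section Symmetric.
Context (g k : T -> R[i]).
Hypothesis Agk : A g k.
Hypothesis sym : forall f h, A f h -> ip h g = ip f k.

(** Since [A] is symmetric against [g], the form of [A] at [E l g] can be
computed by letting [A] act on [g] only. *)
Lemma proj_form_le l : Re (ip (E l g) k) <= l * sq (E l g).
Proof.
have [gi ki] := AL2 Agk.
have [hp [hq [[Ap Aq cpq cqp] [le1 le2]]]] := spectral_cut l Agk.
have [pi hpi] := AL2 Ap; have [qi hqi] := AL2 Aq.
apply: le_trans le1; rewrite -(sym Ap).
have -> : ip hp g = ip hp (fun t => g t - E l g t) + ip hp (E l g).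
  by rewrite -ipL2Dr//; congr ipL2; apply/funext => t; rewrite subrK.
by rewrite cpq add0r.
Qed.

Lemma proj_form_ge l :
  let q := fun t => g t - E l g t in l * sq q <= Re (ip q k).
Proof.
have [gi ki] := AL2 Agk.
have [hp [hq [[Ap Aq cpq cqp] [le1 le2]]]] := spectral_cut l Agk.
have [pi hpi] := AL2 Ap; have [qi hqi] := AL2 Aq.
apply: le_trans le2 _; rewrite -(sym Aq).
have -> : ip hq g = ip hq (fun t => g t - E l g t) + ip hq (E l g).
  by rewrite -ipL2Dr//; congr ipL2; apply/funext => t; rewrite subrK.
by rewrite cqp addr0.
Qed.
End Symmetric.

Let iter_step_le (c l s u v : R) : l < c ->
  c * s - (c - l) * u <= l * s -> 2 * u <= s + v -> s <= v.
Proof.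
move=> lc h1 h2; have lc0 : 0 < c - l by rewrite subr_gt0.
by have : (c - l) * s <= (c - l) * u; [lra|rewrite ler_pM2l//; lra].
Qed.

Let iter_step_ge (c l s u v : R) : c < l ->
  l * s <= c * s - (c - l) * u -> 2 * u <= s + v -> s <= v.
Proof.
move=> lc h1 h2; have lc0 : 0 < l - c by rewrite subr_gt0.
by have : (l - c) * s <= (l - c) * u; [lra|rewrite ler_pM2l//; lra].
Qed.

Section Iteration.
Context (c l : R) (g : nat -> T -> R[i]).
Let k n t := c%:C * g n t - (c - l)%:C * g n.+1 t.
Hypothesis Agk : forall n, A (g n) (k n).
Hypothesis sym : forall n f h, A f h -> ip h (g n) = ip f (k n).

Let gi n : L2 (g n). Proof. by have [] := AL2 (Agk n). Qed.

Let ip_k f n : L2 f ->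
  Re (ip f (k n)) = c * Re (ip f (g n)) - (c - l) * Re (ip f (g n.+1)).
Proof.
move=> fi.
have -> : k n = fun t => (- (c - l)%:C) * g n.+1 t + c%:C * g n t.
  by apply/funext => t; rewrite /k addrC mulNr.
rewrite ipL2_linr//; last exact: inL2Z.
have -> : ip f (fun t => c%:C * g n t) = c%:C * ip f (g n).
  have := ipL2_linr mD c%:C (gi n) (@inL2_0 _ _ _ mu D) fi.
  under eq_fun do rewrite addr0.
  move=> ->; have -> : ip f (fun=> 0) = 0.
    by rewrite /ipL2 -[RHS](cintegral0 mu D); apply: eq_cintegral => t _; rewrite conjC0 mulr0.
  by rewrite addr0; congr (_ * _); apply: complexP; rewrite /= ?oppr0.
by rewrite !cE /=; ring.
Qed.

(** As [A (g n) = c * g n - (c - l) * g n.+1], the bound of [proj_form_le] for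
[g n] says that the square of the norm of [E l (g n)] is at most the real part
of its scalar product with [E l (g n.+1)]. So these norms do not decrease. *)
Lemma proj_iter n : l < c -> sq (E l (g 0)) <= sq (g n).
Proof.
move=> lc; apply: (@le_trans _ _ (sq (E l (g n)))); last exact: (sq_proj_le mD hR).
elim: n => // n; move/le_trans; apply.
have Ei m := EL2 l (gi m).
have h : Re (ip (E l (g n)) (k n)) <= l * sq (E l (g n)).
  exact: proj_form_le (Agk n) (@sym n) l.
rewrite ip_k// -(sq_proj mD hR)// -(ip_proj mD hR)// in h.
exact: iter_step_le lc h (Re_ipL2_le mD (Ei n) (Ei n.+1)).
Qed.

Lemma projC_iter n : c < l -> sq (fun t => g 0 t - E l (g 0) t) <= sq (g n).
Proof.
move=> cl; pose q m := fun t => g m t - E l (g m) t.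
apply: (@le_trans _ _ (sq (q n))); last first.
  by rewrite /q (sq_projC mD hR)// gerBl sqL2_ge0.
elim: n => // n; move/le_trans; apply.
have Ei m := EL2 l (gi m).
have qi m : L2 (q m) by exact: inL2B.
have h : l * sq (q n) <= Re (ip (q n) (k n)).
  exact: proj_form_ge (Agk n) (@sym n) l.
rewrite ip_k// -(ip_projC mD hR l (gi n) (gi n)) -(ip_projC mD hR l (gi n) (gi n.+1)) in h.
exact: iter_step_ge cl h (Re_ipL2_le mD (qi n) (qi n.+1)).
Qed.

End Iteration.

End SpectralCut.

(** * Uniqueness of Fourier coefficients *)

Section Cutoff.
Context (R : realType).
Implicit Types x y : R.

Lemma bernoulli_le y n : 0 <= y <= 1 -> 1 - n%:R * y <= (1 - y) ^+ n.
Proof.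
move=> /andP[y0 y1]; elim: n => [|n IH]; first by rewrite mul0r subr0 expr0.
have := ler_wpM2l (_ : 0 <= 1 - y) IH; rewrite subr_ge0 y1 => /(_ isT) h.
rewrite exprS; apply: le_trans h; rewrite -natr1.
have : 0 <= n%:R * y * y by rewrite !mulr_ge0.
by lra.
Qed.

Lemma bernoulli_ge y n : 0 <= y <= 1 -> (1 - y) ^+ n * (1 + n%:R * y) <= 1.
Proof.
move=> /andP[y0 y1]; elim: n => [|n IH]; first by rewrite mul0r addr0 expr0 mulr1.
apply: le_trans IH; rewrite exprSr -mulrA.
apply: ler_wpM2l; first by rewrite exprn_ge0// subr_ge0.
rewrite -natr1; have h : 0 <= n%:R * y * y by rewrite !mulr_ge0.
by have := mulr_ge0 y0 y0; lra.
Qed.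

(** Polynomials that tend to the indicator of the numbers below 1/2, at the
points of the unit interval other than 1/2: by the inequalities of Bernoulli
they lie between [1 - (2 * x) ^+ n] and [(2 * x) ^- n]. *)
Definition cutoff n x : R := (1 - x ^+ n) ^+ (2 ^ n)%N.

Lemma cutoff_itv n x : 0 <= x <= 1 -> 0 <= cutoff n x <= 1.
Proof.
move=> /andP[x0 x1]; have /andP[h0 h1] : 0 <= 1 - x ^+ n <= 1.
  by rewrite subr_ge0 exprn_ile1//= gerBl exprn_ge0.
by rewrite /cutoff exprn_ge0//= exprn_ile1.
Qed.

Lemma cutoff_cvg1 x : 0 <= x -> x < 1 / 2 -> cutoff n x @[n --> \oo] --> (1 : R).
Proof.
move=> x0 x12.
have x1 : x <= 1 by lra.
have x01 : 0 <= x <= 1 by rewrite x0.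
have h : 1 - (2 * x) ^+ n @[n --> \oo] --> (1 - 0 : R).
  apply: cvgB; first exact: cvg_cst.
  by apply: cvg_expr; rewrite ger0_norm; [lra|rewrite mulr_ge0].
rewrite subr0 in h; apply: (@squeeze_cvgr _ _ _ _ (fun n => 1 - (2 * x) ^+ n) (fun=> 1));
  [near=> n|exact: h|exact: cvg_cst].
 have /andP[_ ->] := cutoff_itv n x01.
rewrite andbT exprMn; have := @bernoulli_le (x ^+ n) (2 ^ n)%N.
by rewrite natrX exprn_ge0// exprn_ile1// => /(_ isT).
Unshelve. all: by end_near. Qed.

Lemma cutoff_cvg0 x : x <= 1 -> 1 / 2 < x -> cutoff n x @[n --> \oo] --> (0 : R).
Proof.
move=> x1 x12; have x0 : 0 < x by lra.
have x01 : 0 <= x <= 1 by rewrite ltW.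
have h : ((2 * x)^-1) ^+ n @[n --> \oo] --> (0 : R).
  apply: cvg_expr; rewrite ger0_norm ?invr_ge0; last by lra.
  by rewrite invf_lt1; lra.
apply: (@squeeze_cvgr _ _ _ _ (fun=> 0) (fun n => ((2 * x)^-1) ^+ n));
  [near=> n|exact: cvg_cst|exact: h].
have /andP[-> _] := cutoff_itv n x01.
rewrite /= exprVn -[_^-1]mul1r ler_pdivlMr; last by rewrite exprn_gt0// mulr_gt0.
have xn : 0 <= x ^+ n <= 1 by rewrite exprn_ge0 ?exprn_ile1// ltW.
apply: le_trans (bernoulli_ge (2 ^ n)%N xn).
have /andP[c0 _] := cutoff_itv n x01.
by apply: ler_wpM2l => //; rewrite exprMn natrX lerDr.
Unshelve. all: by end_near. Qed.

End Cutoff.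

Section FourierUniqueness.
Context (R : realType).
Notation leb := (@lebesgue_measure R).
Notation I := (@unit_itv R).
Implicit Types g h : R -> R.

Definition freq (k : int) (t : R) : R := 2 * pi * k%:~R * t.

Lemma measurable_unit_itv : @measurable _ (measurableTypeR R) (@unit_itv R).
Proof. exact: measurable_itv. Qed.

#[local] Hint Resolve measurable_unit_itv : core.

Lemma lebesgue_unit_itv : leb I = 1%E.
Proof. by rewrite /unit_itv lebesgue_measure_itv/= lte01 oppr0 adde0. Qed.

Lemma lebesgue_unit_itv_lty : (leb I < +oo)%E.
Proof. by rewrite lebesgue_unit_itv ltry. Qed.

Lemma integrable_bounded_mul (d : measure_display) (T : measurableType d)
    (mu : {measure set T -> \bar R}) (D : set T) (g h : T -> R) (M : R) :
  measurable D ->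
  mu.-integrable D (EFin \o g) -> measurable_fun D h ->
  (forall t, D t -> `|h t| <= M) ->
  mu.-integrable D (EFin \o (fun t => g t * h t)).
Proof.
move=> mD gi mh hM; have := integrableZl mD M (integrable_abse gi).
have mg := measurable_int _ gi.
apply: le_integrable => //.
  by apply/measurable_EFinP/measurable_funM => //; exact/measurable_EFinP.
move=> t Dt; rewrite /= lee_fin !normrM normr_id mulrC.
by apply: ler_wpM2r => //; apply: le_trans (hM _ Dt) (ler_norm _).
Qed.

Lemma continuous_freq_cos k : continuous (fun t => cos (freq k t)).
Proof.
move=> t; apply: continuous_comp; last exact: continuous_cos.
by apply: cvgM; [exact: cvg_cst|exact: cvg_id].
Qed.

Lemma continuous_freq_sin k : continuous (fun t => sin (freq k t)).
Proof.
move=> t; apply: continuous_comp; last exact: continuous_sin.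
by apply: cvgM; [exact: cvg_cst|exact: cvg_id].
Qed.

Lemma measurable_freq_cos k D : measurable_fun D (fun t => cos (freq k t)).
Proof.
by apply: measurable_funTS; apply: continuous_measurable_fun; exact: continuous_freq_cos.
Qed.

Lemma measurable_freq_sin k D : measurable_fun D (fun t => sin (freq k t)).
Proof.
by apply: measurable_funTS; apply: continuous_measurable_fun; exact: continuous_freq_sin.
Qed.

Lemma integrable_mul_cos g k : leb.-integrable I (EFin \o g) ->
  leb.-integrable I (EFin \o (fun t => g t * cos (freq k t))).
Proof.
move=> gi; apply: (@integrable_bounded_mul _ _ _ _ _ _ 1) => //.
- exact: measurable_freq_cos.
- by move=> t _; exact: cos_max.
Qed.

Lemma integrable_mul_sin g k : leb.-integrable I (EFin \o g) ->
  leb.-integrable I (EFin \o (fun t => g t * sin (freq k t))).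
Proof.
move=> gi; apply: (@integrable_bounded_mul _ _ _ _ _ _ 1) => //.
- exact: measurable_freq_sin.
- by move=> t _; exact: sin_max.
Qed.

Definition fourier_null g : Prop :=
  leb.-integrable I (EFin \o g) /\
  forall k, Rintegral leb I (fun t => g t * cos (freq k t)) = 0 /\
            Rintegral leb I (fun t => g t * sin (freq k t)) = 0.

Lemma fourier_null_lin (a b : R) g h : fourier_null g -> fourier_null h ->
  fourier_null (fun t => a * g t + b * h t).
Proof.
move=> [gi g0] [hi h0]; split; first exact: integrable_lin.
move=> k; have [gc gs] := g0 k; have [hc hs] := h0 k; split.
- transitivity (Rintegral leb I (fun t =>
      a * (g t * cos (freq k t)) + b * (h t * cos (freq k t)))).
    by apply: eq_Rintegral => t _; ring.
  by rewrite Rintegral_lin ?gc ?hc ?mulr0 ?addr0//; exact: integrable_mul_cos.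
- transitivity (Rintegral leb I (fun t =>
      a * (g t * sin (freq k t)) + b * (h t * sin (freq k t)))).
    by apply: eq_Rintegral => t _; ring.
  by rewrite Rintegral_lin ?gs ?hs ?mulr0 ?addr0//; exact: integrable_mul_sin.
Qed.

Lemma freqD k t : freq (k + 1) t = freq k t + freq 1 t.
Proof. by rewrite /freq intrD; ring. Qed.

Lemma freqB k t : freq (k - 1) t = freq k t - freq 1 t.
Proof. by rewrite /freq intrB; ring. Qed.

Lemma fourier_null_cos g : fourier_null g ->
  fourier_null (fun t => g t * cos (freq 1 t)).
Proof.
move=> [gi g0]; split; first exact: integrable_mul_cos.
move=> k; have [c1 s1] := g0 (k + 1); have [c2 s2] := g0 (k - 1); split.
- transitivity (Rintegral leb I (fun t => 2^-1 * (g t * cos (freq (k + 1) t))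
      + 2^-1 * (g t * cos (freq (k - 1) t)))).
    by apply: eq_Rintegral => t _; rewrite freqD freqB cosD cosB; field.
  by rewrite Rintegral_lin ?c1 ?c2 ?mulr0 ?addr0//; exact: integrable_mul_cos.
- transitivity (Rintegral leb I (fun t => 2^-1 * (g t * sin (freq (k + 1) t))
      + 2^-1 * (g t * sin (freq (k - 1) t)))).
    by apply: eq_Rintegral => t _; rewrite freqD freqB sinD sinB; field.
  by rewrite Rintegral_lin ?s1 ?s2 ?mulr0 ?addr0//; exact: integrable_mul_sin.
Qed.

Lemma fourier_null_sin g : fourier_null g ->
  fourier_null (fun t => g t * sin (freq 1 t)).
Proof.
move=> [gi g0]; split; first exact: integrable_mul_sin.
move=> k; have [c1 s1] := g0 (k + 1); have [c2 s2] := g0 (k - 1); split.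
- transitivity (Rintegral leb I (fun t => 2^-1 * (g t * sin (freq (k + 1) t))
      + (- 2^-1) * (g t * sin (freq (k - 1) t)))).
    by apply: eq_Rintegral => t _; rewrite freqD freqB sinD sinB; field.
  by rewrite Rintegral_lin ?s1 ?s2 ?mulr0 ?addr0//; exact: integrable_mul_sin.
- transitivity (Rintegral leb I (fun t => (- 2^-1) * (g t * cos (freq (k + 1) t))
      + 2^-1 * (g t * cos (freq (k - 1) t)))).
    by apply: eq_Rintegral => t _; rewrite freqD freqB cosD cosB; field.
  by rewrite Rintegral_lin ?c1 ?c2 ?mulr0 ?addr0//; exact: integrable_mul_cos.
Qed.

Section Bump.
Context (x0 y : R).

(** An affine function of [cos (2 * pi * (t - x0))], scaled so as to be at most 1/2
exactly where that cosine is at least [y]. *)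
Definition bump (t : R) : R := 1 / 2 - (cos (2 * pi * (t - x0)) - y) / 4.

Lemma bumpE t : bump t = (1 / 2 + y / 4) - cos (2 * pi * x0) / 4 * cos (freq 1 t)
  - sin (2 * pi * x0) / 4 * sin (freq 1 t).
Proof.
have -> : freq 1 t = 2 * pi * t by rewrite /freq -[1%:~R]/(1 : R) mulr1.
by rewrite /bump mulrBr cosB; field.
Qed.

Lemma fourier_null_bump g : fourier_null g -> fourier_null (fun t => g t * bump t).
Proof.
move=> g0; have gc := fourier_null_cos g0; have gs := fourier_null_sin g0.
have := fourier_null_lin 1 (- (sin (2 * pi * x0) / 4))
  (fourier_null_lin (1 / 2 + y / 4) (- (cos (2 * pi * x0) / 4)) g0 gc) gs.
by congr fourier_null; apply/funext => t; rewrite bumpE; ring.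
Qed.

Lemma fourier_null_bumpX g n : fourier_null g ->
  fourier_null (fun t => g t * bump t ^+ n).
Proof.
move=> g0; elim: n => [|n IH]; first by under eq_fun do rewrite expr0 mulr1.
have := fourier_null_bump IH.
by congr fourier_null; apply/funext => t; rewrite exprSr mulrA.
Qed.

Lemma fourier_null_cutoff g n : fourier_null g ->
  fourier_null (fun t => g t * cutoff n (bump t)).
Proof.
move=> g0; rewrite /cutoff; elim: (2 ^ n)%N => [|N IH].
  by under eq_fun do rewrite expr0 mulr1.
have := fourier_null_lin 1 (-1) IH (fourier_null_bumpX n IH).
by congr fourier_null; apply/funext => t; rewrite exprSr; ring.
Qed.

End Bump.

Lemma fourier_null_int g : fourier_null g -> Rintegral leb I g = 0.
Proof.
move=> [_ /(_ 0)[e _]]; rewrite -[RHS]e; apply: eq_Rintegral => t _.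
by rewrite /freq -[0%:~R]/(0 : R) mulr0 mul0r cos0 mulr1.
Qed.

(** The cosine decreases with the distance up to 1/2, and distances beyond 1/2 are
reflected at 1/2; they stay less than [1 - r]. *)
Lemma cos_ball (x0 r t : R) : 0 < r -> r < x0 -> x0 < 1 - r -> 0 <= t <= 1 ->
  (`|t - x0| < r -> cos (2 * pi * r) < cos (2 * pi * (t - x0))) /\
  (r < `|t - x0| -> cos (2 * pi * (t - x0)) < cos (2 * pi * r)).
Proof.
move=> r0 rx xr /andP[t0 t1].
have pi0 := pi_gt0 R.
have -> : cos (2 * pi * (t - x0)) = cos (2 * pi * `|t - x0|).
  by rewrite -cos_norm normrM ger0_norm// mulr_ge0// ltW.
set s := `|t - x0|.
have s0 : 0 <= s by exact: normr_ge0.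
have s1 : s < 1 - r by rewrite /s ltr_norml; apply/andP; split; lra.
have mono (a b : R) : 0 <= a -> a < b -> b <= 1 / 2 ->
    cos (2 * pi * b) < cos (2 * pi * a).
  move=> a0 ab b12; have b0 : 0 <= b by rewrite ltW// (le_lt_trans a0).
  have bp : 2 * pi * b <= pi.
    by rewrite -[leRHS]mul1r -mulrA [pi * _]mulrC mulrA ler_pM2r//; lra.
  rewrite ltr_cos ?in_itv/= ?bp ?mulr_ge0 ?(ltW pi0)//=.
    by rewrite ltr_pM2l// mulr_gt0.
  by apply: le_trans bp; rewrite ler_pM2l ?mulr_gt0// ltW.
have refl (a : R) : cos (2 * pi * a) = cos (2 * pi * (1 - a)).
  rewrite mulrBr mulr1 -[RHS]cosN opprB.
  have -> : 2 * pi * a - 2 * pi = 2 * pi * a + (- (pi *+ 2)) by rewrite mulr2n; ring.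
  by rewrite -(cosD2pi (_ - _)) subrK.
split=> sr; first by apply: mono => //; lra.
have [s12|s12] := leP s (1 / 2); first by apply: mono => //; lra.
by rewrite (refl s); apply: mono; lra.
Qed.

(** The functions [cutoff n (bump x0 y t)] are trigonometric polynomials in [t]
and tend boundedly to the indicator of the ball. *)
Lemma fourier_null_ball g (x0 r : R) : fourier_null g ->
  0 < r -> r < x0 -> x0 < 1 - r ->
  Rintegral leb I (fun t => g t * \1_(ball x0 r) t) = 0.
Proof.
move=> g0 r0 rx xr; have [gi _] := g0.
pose y := cos (2 * pi * r).
pose G n t := g t * cutoff n (bump x0 y t).
have mI := measurable_unit_itv.
have Gi n := (fourier_null_cutoff x0 y n g0).1.
have bump01 t : 0 <= bump x0 y t <= 1.
  rewrite /bump; have := cos_max (2 * pi * (t - x0)); have := cos_max (2 * pi * r).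
  by rewrite -/y !ler_norml; lra.
have lim t : I t -> `|t - x0| != r ->
    cutoff n (bump x0 y t) @[n --> \oo] --> (\1_(ball x0 r) t : R).
  rewrite /unit_itv/= in_itv/= => t01 tr; have /andP[b0 b1] := bump01 t.
  have [h1 h2] := cos_ball r0 rx xr t01.
  rewrite indicE; have [lt|ge] := ltP `|t - x0| r.
    have -> : t \in (ball x0 r : set R) by rewrite inE -ball_normE/= distrC.
    apply: cutoff_cvg1 => //; have := h1 lt; rewrite /bump -/y; lra.
  have -> : (t \in (ball x0 r : set R)) = false.
    by apply/negbTE/negP; rewrite inE -ball_normE/= distrC ltNge ge.
  apply: cutoff_cvg0 => //; have := h2; rewrite lt_neqAle eq_sym tr ge => /(_ isT).
  by rewrite /bump -/y; lra.
have mball : measurable (ball x0 r) by exact: measurable_ball.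
have := @dominated_convergence _ _ R leb I mI (fun n => EFin \o G n)
  (EFin \o (fun t => g t * \1_(ball x0 r) t)) (abse \o (EFin \o g)).
case.
- by move=> n; exact: measurable_int (Gi n).
- apply/measurable_EFinP; apply: measurable_funM.
    by apply/measurable_EFinP; exact: measurable_int gi.
  exact: measurable_indic.
- have H : {ae leb, forall t, t != x0 - r /\ t != x0 + r}.
    exists ([set x0 - r] `|` [set x0 + r]); split.
    + exact: measurableU.
    + apply/eqP; rewrite -measure_le0 (le_trans (measureU2 _ _ _))//=.
      by rewrite !lebesgue_measure_set1 adde0.
    + move=> t /=; case: (eqVneq t (x0 - r)) => [|_]; first by left.
      by case: (eqVneq t (x0 + r)) => [|_ H]; [right|exfalso; exact: H].
  apply: aeS H => t [n1 n2] It; apply: cvg_EFin; first exact: nearW.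
  apply: cvgM; first exact: cvg_cst.
  apply: lim => //; apply/negP => /eqP; case: (ger0P (t - x0)) => h e.
    by move/eqP: n2; apply; rewrite -e; ring.
  by move/eqP: n1; apply; rewrite -e; ring.
- exact: integrable_abse.
- apply: aeW => t n It; rewrite /= lee_fin /G normrM ler_piMr//.
  by have /andP[c0 c1] := cutoff_itv n (bump01 t); rewrite ger0_norm.
- move=> _ _ h.
  have : (fun n => \int[leb]_(x in I) (EFin \o G n) x)%E @ \oo --> (0 : \bar R)%E.
    have -> : (fun n => \int[leb]_(x in I) (EFin \o G n) x)%E = cst 0%E.
      apply/funext => n; have /fourier_null_int := fourier_null_cutoff x0 y n g0.
      have f : (\int[leb]_(x in I) (EFin \o G n) x)%E \is a fin_num.
        by apply: integrable_fin_num; [exact: mI|exact: Gi].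
      by move=> e; rewrite -(fineK f) [fine _]e.
    exact: cvg_cst.
  by move=> /(cvg_unique _ h) e; rewrite /Rintegral e.
Qed.

(** By the Lebesgue differentiation theorem, since the integrals over all balls
inside the interval vanish. *)
Lemma fourier_null_ae0 g : fourier_null g -> {ae leb, forall t, I t -> g t = 0}.
Proof.
move=> g0; have [gi _] := g0; have mI := measurable_unit_itv.
have LD := lebesgue_differentiation (integrable_locally_restrict mI gi).
have ends : {ae leb, forall t, t != 0 /\ t != (1 : R)}.
  exists ([set 0] `|` [set 1]); split.
  - exact: measurableU.
  - apply/eqP; rewrite -measure_le0 (le_trans (measureU2 _ _ _))//=.
    by rewrite !lebesgue_measure_set1 adde0.
  - move=> t /=; case: (eqVneq t 0) => [|_]; first by left.
    by case: (eqVneq t 1) => [|_ H]; [right|exfalso; exact: H].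
apply: aeS2 ends LD => x [x0 x1] lx Ix.
have {Ix} : 0 < x < 1.
  by move: Ix; rewrite /unit_itv/= in_itv/= !le_eqVlt eq_sym (negbTE x0) (negbTE x1).
move=> {x0 x1}/andP[x0 x1].
pose f := g \_ I.
have fi : leb.-integrable setT (EFin \o f).
  by rewrite -restrict_EFin; apply/integrable_restrict => //; rewrite setTI.
have key : \forall r \near (0:R)^'+, (`|f x|%:E <= davg f x r)%E.
  near=> r.
  have r0 : 0 < r by near: r; exact: nbhs_right_gt.
  have rx : r < x by near: r; exact: nbhs_right_lt.
  have xr : x < 1 - r.
    by rewrite ltrBrDl -ltrBrDr; near: r; apply: nbhs_right_lt; rewrite subr_gt0.
  have mB : measurable (ball x r) by exact: measurable_ball.
  have z : Rintegral leb (ball x r) f = 0.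
    rewrite -(fourier_null_ball g0 r0 rx xr) Rintegral_mkcond [RHS]Rintegral_mkcond.
    apply: eq_Rintegral => t _; rewrite /f !patchE indicE.
    by case: (t \in (ball x r : set R)); case: (t \in I); rewrite ?mulr1 ?mulr0.
  have fB : leb.-integrable (ball x r) (EFin \o f) by exact: integrableS fi.
  have lB : leb (ball x r) = (r *+ 2)%:E by rewrite lebesgue_measure_ball// ltW.
  have r20 : 0 <= r *+ 2 by rewrite mulrn_wge0// ltW.
  have e3 : ((`|f x| * (r *+ 2))%:E <=
      \int[leb]_(y in ball x r) `|(f y - f x)%:E|)%E.
    by apply: mean0_deviation; [exact: mB|exact: lB|exact: r20|exact: fB|exact: z].
  rewrite /davg /iavg lB.
  rewrite (_ : (r *+ 2)%:E^-1 = ((r *+ 2)^-1)%:E)%E; last first.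
    by rewrite inver mulrn_eq0/= gt_eqF.
  by rewrite lee_pdivlMl ?mulrn_wgt0// -EFinM mulrC.
have : (`|f x|%:E <= 0)%E.
  exact: cvge_to_ge lx key.
rewrite lee_fin normr_le0 => /eqP; rewrite /f patchE.
by rewrite mem_set// /unit_itv/= in_itv/= !ltW.
Unshelve. all: by end_near. Qed.

End FourierUniqueness.

(** * The Fourier basis of the circle *)

Section FourierBasis.
Context (R : realType).
Notation leb := (@lebesgue_measure R).
Notation I := (@unit_itv R).
Implicit Types g h : R -> R[i].

#[local] Hint Resolve measurable_unit_itv : core.

Definition expi (k : int) (t : R) : R[i] := cos (freq k t) +i* sin (freq k t).

Lemma sqr_normc_expi k t : Normc.normc (expi k t) ^+ 2 = 1.
Proof. by rewrite sqr_normc /= cos2Dsin2. Qed.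

Lemma fourierE g k : fourier g k = ipL2 leb I g (expi k).
Proof. by []. Qed.

Lemma freq0 k : freq k 0 = 0 :> R.
Proof. by rewrite /freq mulr0. Qed.

Lemma sin_freq1 k : sin (freq k 1) = 0 :> R.
Proof.
have h (n : nat) : sin (2 * pi * n%:R) = 0 :> R.
  have := periodicn (@sinD2pi R) n 0.
  rewrite sin0 add0r => e; rewrite -[RHS]e; congr sin.
  by rewrite -[RHS]mulr_natr -[pi *+ 2]mulr_natl.
rewrite /freq mulr1; case: k => n; first exact: h.
by rewrite NegzE intrN mulrN sinN h oppr0.
Qed.

Lemma cos_freq1 k : cos (freq k 1) = 1 :> R.
Proof.
have h (n : nat) : cos (2 * pi * n%:R) = 1 :> R.
  have := periodicn (@cosD2pi R) n 0.
  rewrite cos0 add0r => e; rewrite -[RHS]e; congr cos.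
  by rewrite -[RHS]mulr_natr -[pi *+ 2]mulr_natl.
rewrite /freq mulr1; case: k => n; first exact: h.
by rewrite NegzE intrN mulrN cosN h.
Qed.

Lemma is_derive_mull (a b t : R) (F : R -> R) : is_derive t 1 F b ->
  is_derive t 1 (fun t => a * F t) (a * b).
Proof. by move=> h; exact: (@is_deriveZ _ _ _ F a t 1 b h). Qed.

Lemma is_derive_freq k (t : R) : is_derive t 1 (@freq R k) (2 * pi * k%:~R : R).
Proof.
by have := is_derive_mull (2 * pi * k%:~R) (is_derive_id t 1); rewrite mulr1.
Qed.

Lemma is_derive_sin_freq k (t : R) :
  is_derive t 1 (fun t => sin (freq k t)) (2 * pi * k%:~R * cos (freq k t)).
Proof.
have := is_derive_freq k t => h.
by have := is_derive1_comp (is_derive_sin (freq k t)) h; rewrite mulrC.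
Qed.

Lemma is_derive_cos_freq k (t : R) :
  is_derive t 1 (fun t => cos (freq k t)) (- (2 * pi * k%:~R) * sin (freq k t)).
Proof.
have := is_derive_freq k t => h.
have := is_derive1_comp (is_derive_cos (freq k t)) h.
by rewrite mulNr mulrC -mulNr.
Qed.

Lemma cmeasurable_expi k D : cmeasurable D (expi k).
Proof. by split; [exact: measurable_freq_cos|exact: measurable_freq_sin]. Qed.

Lemma inL2_expi k : inL2 leb I (expi k).
Proof.
apply/inL2P; split; first exact: cmeasurable_expi.
under eq_fun do rewrite sqr_normc_expi.
apply: integrable_cst_fin; [exact: measurable_unit_itv|].
exact: lebesgue_unit_itv_lty.
Qed.

Lemma Rintegral_FTC (F f : R -> R) :
  (forall t : R, is_derive t 1 F (f t)) -> continuous f ->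
  Rintegral leb I f = F 1 - F 0.
Proof.
move=> dF cf.
have cF : continuous F.
  move=> t; apply: differentiable_continuous.
  by apply/derivable1_diffP; exact: ex_derive.
rewrite /Rintegral /unit_itv (@continuous_FTC2 _ f F 0 1)//.
- exact: continuous_subspaceT.
- split => //.
  + by apply: cvg_at_right_filter; exact: cF.
  + by apply: cvg_at_left_filter; exact: cF.
- by move=> t _; rewrite derive1E; exact: derive_val.
Qed.

Lemma Rintegral_cos k : k != 0 -> Rintegral leb I (fun t => cos (freq k t)) = 0.
Proof.
move=> k0; have pk : 2 * pi * k%:~R != 0 :> R.
  by rewrite mulf_neq0 ?intr_eq0// gt_eqF// mulr_gt0// pi_gt0.
have dF (t : R) : is_derive t 1 (fun t => (2 * pi * k%:~R)^-1 * sin (freq k t))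
    (cos (freq k t)).
  have := is_derive_mull (2 * pi * k%:~R)^-1 (is_derive_sin_freq k t).
  by rewrite mulKf.
have -> := Rintegral_FTC dF (@continuous_freq_cos R k).
by rewrite sin_freq1 freq0 sin0 !mulr0 subrr.
Qed.

Lemma Rintegral_sin k : Rintegral leb I (fun t => sin (freq k t)) = 0.
Proof.
have [->|k0] := eqVneq k 0.
  rewrite (@eq_Rintegral _ _ R leb I (fun=> 0)); first by rewrite /Rintegral integral0.
  by move=> t _; rewrite /freq mulr0 mul0r sin0.
have pk : 2 * pi * k%:~R != 0 :> R.
  by rewrite mulf_neq0 ?intr_eq0// gt_eqF// mulr_gt0// pi_gt0.
have dF (t : R) : is_derive t 1 (fun t => (- (2 * pi * k%:~R)^-1) * cos (freq k t))
    (sin (freq k t)).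
  have := is_derive_mull (- (2 * pi * k%:~R)^-1) (is_derive_cos_freq k t).
  by rewrite mulrA mulrNN mulVf// mul1r.
have -> := Rintegral_FTC dF (@continuous_freq_sin R k).
by rewrite cos_freq1 freq0 cos0 subrr.
Qed.

Lemma fourier_expi k j : fourier (expi k) j = (k == j)%:R.
Proof.
have e t : expi k t * (expi j t)^* = expi (k - j) t.
  have fE : freq (k - j) t = freq k t - freq j t by rewrite /freq intrB; ring.
  by apply: complexP; rewrite !cE /= fE ?cosB ?sinB; ring.
have -> : fourier (expi k) j = cintegral leb I (expi (k - j)).
  by apply: eq_cintegral => t _; exact: e.
have [->|kj] := eqVneq k j; last first.
  by apply: complexP => /=; rewrite ?Rintegral_cos ?Rintegral_sin ?subr_eq0.
apply: complexP => /=; last exact: Rintegral_sin.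
rewrite subrr (@eq_Rintegral _ _ R leb I (fun=> 1)).
  rewrite Rintegral_cst; last exact: measurable_unit_itv.
  rewrite mul1r; exact: (congr1 fine (lebesgue_unit_itv R)).
by move=> t _; rewrite /freq mulr0 mul0r cos0.
Qed.

(** Combining the frequencies [k] and [- k] separates the real and the imaginary
part of [g]. *)
Lemma fourier_eq0 g : inL2 leb I g -> (forall k, fourier g k = 0) ->
  aeqc leb I g (fun=> 0).
Proof.
move=> gi g0.
have c1 : cintegrable leb I g.
  have := cintegrable_mul_conj (@measurable_unit_itv R) gi (inL2_expi 0).
  congr cintegrable; apply/funext => t.
  have e : (expi 0 t)^*%R = 1.
    by apply: complexP; rewrite /= /freq mulr0 mul0r ?cos0 ?sin0 ?oppr0.
  by rewrite e mulr1.
have [ri ii] := c1.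
have eqs k : Rintegral leb I (fun t => complex.Re (g t) * cos (freq k t)) +
             Rintegral leb I (fun t => complex.Im (g t) * sin (freq k t)) = 0 /\
             Rintegral leb I (fun t => complex.Im (g t) * cos (freq k t)) -
             Rintegral leb I (fun t => complex.Re (g t) * sin (freq k t)) = 0.
  have := g0 k; rewrite /fourier /cintegral => /(f_equal (fun z => (complex.Re z, complex.Im z))) /= [e1 e2].
  split.
    rewrite -[RHS]e1 -RintegralD; [|exact: measurable_unit_itv|
      exact: integrable_mul_cos|exact: integrable_mul_sin].
    by apply: eq_Rintegral => t _; rewrite !cE /= mulrN opprK.
  rewrite -[RHS]e2 -RintegralB; [|exact: measurable_unit_itv|
    exact: integrable_mul_cos|exact: integrable_mul_sin].
  by apply: eq_Rintegral => t _; rewrite !cE /= mulrN addrC.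
have cN k (u : R -> R) : Rintegral leb I (fun t => u t * cos (freq (- k) t)) =
    Rintegral leb I (fun t => u t * cos (freq k t)).
  by apply: eq_Rintegral => t _; rewrite /freq intrN mulrN mulNr cosN.
have sN k (u : R -> R) : leb.-integrable I (EFin \o u) ->
    Rintegral leb I (fun t => u t * sin (freq (- k) t)) =
    - Rintegral leb I (fun t => u t * sin (freq k t)).
  move=> ui; rewrite -[RHS]mulN1r -RintegralZl; [|exact: measurable_unit_itv|
    exact: integrable_mul_sin].
  by apply: eq_Rintegral => t _; rewrite /freq intrN mulrN mulNr sinN mulrN mulN1r.
have rn : fourier_null (fun t => complex.Re (g t)).
  split => // k; have [e1 e2] := eqs k; have [e3 e4] := eqs (- k).
  by move: e3 e4; rewrite !cN !sN// => e3 e4; split; lra.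
have in_ : fourier_null (fun t => complex.Im (g t)).
  split => // k; have [e1 e2] := eqs k; have [e3 e4] := eqs (- k).
  by move: e3 e4; rewrite !cN !sN// => e3 e4; split; lra.
apply: aeS2 (fourier_null_ae0 rn) (fourier_null_ae0 in_) => t h1 h2 It.
by apply: complexP; rewrite /= ?h1 ?h2.
Qed.

Lemma fourierB g h k : inL2 leb I g -> inL2 leb I h ->
  fourier (fun t => g t - h t) k = fourier g k - fourier h k.
Proof.
move=> gi hi; rewrite !fourierE ipL2Bl//; exact: inL2_expi.
Qed.

Lemma ipL2_sum (s : seq nat) (a : nat -> R[i]) (f : nat -> R -> R[i]) h :
  (forall n, inL2 leb I (f n)) -> inL2 leb I h ->
  inL2 leb I (fun t => \sum_(n <- s) a n * f n t) /\
  ipL2 leb I (fun t => \sum_(n <- s) a n * f n t) h =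
  \sum_(n <- s) a n * ipL2 leb I (f n) h.
Proof.
move=> fi hi; elim: s => [|n s [IH1 IH2]].
  under eq_fun do rewrite big_nil; rewrite big_nil; split; first exact: inL2_0.
  rewrite /ipL2 -[RHS](cintegral0 leb I); apply: eq_cintegral => t _.
  by rewrite mul0r.
under eq_fun do rewrite big_cons; rewrite big_cons -IH2.
by split; [exact: inL2_lin|exact: ipL2_linl].
Qed.

(** The finite case of the Parseval identity: [g] agrees with the sum of its
modes, their difference having no Fourier coefficient. *)
Lemma fourier_finite g h (kappa : nat -> int) N :
  inL2 leb I g -> inL2 leb I h -> injective kappa ->
  (forall k, fourier g k != 0 -> exists2 n, (n < N)%N & k = kappa n) ->
  ipL2 leb I g h =
  \sum_(0 <= n < N) fourier g (kappa n) * (fourier h (kappa n))^*.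
Proof.
move=> gi hi inj supp.
pose a n := fourier g (kappa n).
pose S t := \sum_(0 <= n < N) a n * expi (kappa n) t.
have Si : inL2 leb I S.
  by have [] := ipL2_sum (index_iota 0 N) a (fun n => inL2_expi (kappa n)) hi.
have gS : aeqc leb I (fun t => g t - S t) (fun=> 0).
  apply: fourier_eq0 => [|k]; first exact: inL2B.
  rewrite fourierB//.
  have [_] := ipL2_sum (index_iota 0 N) a (fun n => inL2_expi (kappa n)) (inL2_expi k).
  rewrite -/S -fourierE => ->.
  under eq_bigr do rewrite -fourierE fourier_expi.
  have [gk|gk] := eqVneq (fourier g k) 0.
    rewrite gk sub0r big1 ?oppr0// => n _.
    by case: eqVneq => [e|_]; rewrite ?mulr0// /a e gk mul0r.
  have [n nN ->] := supp k gk.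
  rewrite (bigD1_seq n) ?mem_index_iota ?iota_uniq//= eqxx mulr1 big1 ?addr0 ?subrr//.
  by move=> m mn; rewrite (inj_eq inj) (negbTE mn) mulr0.
transitivity (ipL2 leb I S h).
  apply: aeqc_ipL2 => //; last exact: aeW.
  by apply: aeS gS => t e It; apply/eqP; rewrite -subr_eq0 e.
have [_ ->] := ipL2_sum (index_iota 0 N) a (fun n => inL2_expi (kappa n)) hi.
apply: eq_bigr => n _; congr (_ * _).
by rewrite fourierE -ipL2C//; exact: inL2_expi.
Qed.

End FourierBasis.

(** * Fubini theorem on rectangles *)

Section FubiniRectangle.
Context (R : realType) (d1 d2 : measure_display).
Context (T1 : measurableType d1) (T2 : measurableType d2).
Context (m1 : {sigma_finite_measure set T1 -> \bar R}).
Context (m2 : {sigma_finite_measure set T2 -> \bar R}).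
Context (D1 : set T1) (D2 : set T2).
Hypothesis (mD1 : measurable D1) (mD2 : measurable D2).
Notation mu := (m1 \x m2)%E.
Notation D := (D1 `*` D2).
Implicit Types f : T1 * T2 -> R.
Implicit Types F G : T1 * T2 -> R[i].

Let mD : measurable D. Proof. exact: measurableX. Qed.

Let patch_section (f : T1 * T2 -> \bar R) x : D1 x ->
  (fun y => (f \_ D) (x, y)) = (fun y => f (x, y)) \_ D2.
Proof.
move=> D1x; apply/funext => y; rewrite !patchE; congr (if _ then _ else _).
by apply/idP/idP => /set_mem h; apply/mem_set; [case: h|split].
Qed.

Let patch_section0 (f : T1 * T2 -> \bar R) x : ~ D1 x ->
  (fun y => (f \_ D) (x, y)) = fun=> 0%E.
Proof.
move=> D1x; apply/funext => y; rewrite patchE.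
by rewrite memNset// => -[].
Qed.

Lemma measurable_section f x : D1 x -> measurable_fun D f ->
  measurable_fun D2 (fun y => f (x, y)).
Proof.
move=> D1x /(measurable_restrictT f mD) mf.
apply/(measurable_restrictT _ mD2).
rewrite (_ : _ \_ _ = fun y => (f \_ D) (x, y)).
  exact: (measurableT_comp mf (pair1_measurable x)).
apply/funext => y; rewrite !patchE; congr (if _ then _ else _).
by apply/idP/idP => /set_mem h; apply/mem_set; [split|case: h].
Qed.

Lemma ae_integrable_section f : mu.-integrable D (EFin \o f) ->
  {ae m1, forall x, D1 x -> m2.-integrable D2 (fun y => (f (x, y))%:E)}.
Proof.
move=> /(integrable_mkcond _ mD) /ae_integrable1; apply: aeS => x + D1x.
by rewrite patch_section//; move=> /(integrable_mkcond _ mD2).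
Qed.

Let FubE (g : T1 * T2 -> \bar R) : fubini_F m2 (g \_ D) =
  (fun x => \int[m2]_(y in D2) g (x, y))%E \_ D1.
Proof.
apply/funext => x; rewrite /fubini_F [RHS]patchE.
case: ifPn => [/set_mem D1x|/negP].
  by rewrite (patch_section g D1x) [RHS]integral_mkcond.
by rewrite inE => D1x; rewrite (patch_section0 g D1x) integral0.
Qed.

Lemma tonelli_rectangle (g : T1 * T2 -> \bar R) : measurable_fun D g ->
  (forall p, D p -> (0 <= g p)%E) ->
  measurable_fun D1 (fun x => \int[m2]_(y in D2) g (x, y))%E /\
  (\int[mu]_(p in D) g p = \int[m1]_(x in D1) \int[m2]_(y in D2) g (x, y))%E.
Proof.
move=> mg g0; have mg' := (measurable_restrictT g mD).1 mg.
have g0' p : (0 <= (g \_ D) p)%E.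
  by rewrite patchE; case: ifPn => // /set_mem; exact: g0.
split.
  by apply/(measurable_restrictT _ mD1); rewrite -FubE; exact: measurable_fun_fubini_tonelli_F.
rewrite integral_mkcond fubini_tonelli1; [|exact: mg'|exact: g0'].
by rewrite FubE -integral_mkcond.
Qed.

Lemma integrable_section f : mu.-integrable D (EFin \o f) ->
  m1.-integrable D1 (fun x => \int[m2]_(y in D2) (f (x, y))%:E)%E.
Proof.
move=> /(integrable_mkcond _ mD) /integrable_fubini_F; rewrite FubE.
by move/(integrable_mkcond _ mD1).
Qed.

Let ae_fin f : mu.-integrable D (EFin \o f) ->
  ae_eq m1 D1 (fun x => \int[m2]_(y in D2) (f (x, y))%:E)%E
    (EFin \o (fun x => Rintegral m2 D2 (fun y => f (x, y)))).
Proof.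
move=> /ae_integrable_section; apply: aeS => x h D1x.
rewrite /= fineK//; apply: integrable_fin_num => //; exact: h.
Qed.

Lemma measurable_Rintegral_section f : mu.-integrable D (EFin \o f) ->
  measurable_fun D1 (fun x => Rintegral m2 D2 (fun y => f (x, y))).
Proof.
move=> /integrable_section/measurable_int h.
by apply: (measurableT_comp (fine_measurable measurableT) h).
Qed.

Lemma integrable_Rintegral_section f : mu.-integrable D (EFin \o f) ->
  m1.-integrable D1 (EFin \o (fun x => Rintegral m2 D2 (fun y => f (x, y)))).
Proof.
move=> fi; have /integrableP[ms ifoo] := integrable_section fi.
have m : measurable_fun D1 (EFin \o (fun x => Rintegral m2 D2 (fun y => f (x, y)))).
  exact/measurable_EFinP/measurable_Rintegral_section.
apply/integrableP; split => //; apply: le_lt_trans ifoo.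
rewrite le_eqVlt; apply/orP; left; apply/eqP; apply: ge0_ae_eq_integral => //.
- exact: measurableT_comp.
- exact: measurableT_comp.
- by apply: aeS (ae_fin fi) => x h D1x; rewrite h.
Qed.

Lemma Rintegral_rectangle f : mu.-integrable D (EFin \o f) ->
  Rintegral mu D f = Rintegral m1 D1 (fun x => Rintegral m2 D2 (fun y => f (x, y))).
Proof.
move=> fi; rewrite /Rintegral integral_mkcond -integral12_prod_meas1; last first.
  exact/(integrable_mkcond _ mD).
rewrite FubE -integral_mkcond; congr fine; apply: ae_eq_integral => //.
- exact: measurable_int (integrable_section fi).
- exact: measurable_int (integrable_Rintegral_section fi).
- exact: ae_fin.
Qed.

Lemma cintegrable_rectangle F : cintegrable mu D F ->
  {ae m1, forall x, D1 x -> cintegrable m2 D2 (fun y => F (x, y))} /\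
  cintegrable m1 D1 (fun x => cintegral m2 D2 (fun y => F (x, y))).
Proof.
move=> [F1 F2]; split; last first.
  by split; [exact: integrable_Rintegral_section F1|
             exact: integrable_Rintegral_section F2].
apply: aeS2 (ae_integrable_section F1) (ae_integrable_section F2) => x h1 h2 Dx.
by split; [exact: h1|exact: h2].
Qed.

Lemma cintegral_rectangle F : cintegrable mu D F ->
  cintegral mu D F = cintegral m1 D1 (fun x => cintegral m2 D2 (fun y => F (x, y))).
Proof.
move=> [F1 F2]; apply: complexP => /=.
- exact: (Rintegral_rectangle F1).
- exact: (Rintegral_rectangle F2).
Qed.

Lemma cmeasurable_section F x : D1 x -> cmeasurable D F ->
  cmeasurable D2 (fun y => F (x, y)).
Proof.
move=> D1x [h1 h2]; split.
- exact: (measurable_section D1x h1).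
- exact: (measurable_section D1x h2).
Qed.

Lemma ae_inL2_section F : inL2 mu D F ->
  {ae m1, forall x, D1 x -> inL2 m2 D2 (fun y => F (x, y))}.
Proof.
move=> /inL2P[mF Fi]; apply: aeS (ae_integrable_section Fi) => x h D1x.
by apply/inL2P; split; [exact: cmeasurable_section|exact: h].
Qed.

Lemma ipL2_rectangle F G : inL2 mu D F -> inL2 mu D G ->
  cintegrable m1 D1 (fun x => ipL2 m2 D2 (fun y => F (x, y)) (fun y => G (x, y))) /\
  ipL2 mu D F G =
  cintegral m1 D1 (fun x => ipL2 m2 D2 (fun y => F (x, y)) (fun y => G (x, y))).
Proof.
move=> Fi Gi; have FG := cintegrable_mul_conj mD Fi Gi; split.
  by have [_] := cintegrable_rectangle FG.
exact: cintegral_rectangle.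
Qed.

End FubiniRectangle.

(** * Fourier modes on the annulus *)

Section SeparatedModes.
Context (R : realType).
Notation leb := (@lebesgue_measure R).
Notation I := (@unit_itv R).
Notation Re := complex.Re.
Notation Im := complex.Im.
Notation leb2 := (leb \x leb)%E.
Notation annulus := (@annulus R).
Implicit Types (v : R -> R) (f g h : R * R -> R[i]).

Let mI : @measurable _ (measurableTypeR R) I := @measurable_unit_itv R.

Lemma measurable_annulus :
  @measurable _ (measurableTypeR R * measurableTypeR R)%type annulus.
Proof. exact: measurableX. Qed.

Lemma annulus_lty : (leb2 annulus < +oo)%E.
Proof.
have -> : leb2 annulus = (1 * 1)%E; last by rewrite mule1 ltry.
etransitivity; first exact: product_measure1E.
by congr (_ * _)%E; exact: lebesgue_unit_itv.
Qed.

Definition bmeas v : Prop :=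
  @measurable_fun _ _ (measurableTypeR R) R I v /\
  exists M, forall m, I m -> `|v m| <= M.

Lemma bmeasM v v' : bmeas v -> bmeas v' -> bmeas (fun m => v m * v' m).
Proof.
move=> [mv [M vM]] [mv' [M' vM']]; split; first exact: measurable_funM.
exists (M * M') => m Im; rewrite normrM.
by apply: ler_pM => //; [exact: vM|exact: vM'].
Qed.

Lemma bmeasD v v' : bmeas v -> bmeas v' -> bmeas (fun m => v m + v' m).
Proof.
move=> [mv [M vM]] [mv' [M' vM']]; split; first exact: measurable_funD.
exists (M + M') => m Im; apply: le_trans (ler_normD _ _) _.
by apply: lerD; [exact: vM|exact: vM'].
Qed.

Lemma bmeas_cst (c : R) : bmeas (fun=> c).
Proof. by split; [exact: measurable_cst|exists `|c|]. Qed.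

Lemma bmeasX v n : bmeas v -> bmeas (fun m => v m ^+ n).
Proof.
move=> bv; elim: n => [|n IH]; first by under eq_fun do rewrite expr0; exact: bmeas_cst.
by under eq_fun do rewrite exprS; exact: bmeasM.
Qed.

Lemma bmeas_indic (A : set R) : @measurable _ (measurableTypeR R) A ->
  bmeas (fun m => \1_A m).
Proof.
move=> mA; split; first exact: measurable_indic.
by exists 1 => m _; rewrite indicE; case: (_ \in _); rewrite ?normr1 ?normr0.
Qed.

(** The Fourier mode of frequency [k] with radial profile [v]. *)
Definition sep v (k : int) (p : R * R) : R[i] := (v p.1)%:C * expi k p.2.

Lemma cmeasurable_sep v k : bmeas v ->
  @cmeasurable R _ (measurableTypeR R * measurableTypeR R)%type annulus (sep v k).
Proof.
move=> [mv _]; apply: cmeasurableM; split => /=.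
- apply: (@measurable_funS _ _ _ _ (I `*` setT)).
  - exact: measurableX.
  - by move=> [m t] [].
  apply: (@measurable_comp _ _ _ _ _ _ I) => //.
    by move=> _ [p [Ip _] <-].
  by apply: measurable_funTS; exact: measurable_fst.
- exact: measurable_cst.
- apply: (@measurableT_comp _ _ _ _ (measurableTypeR R) _
    (fun t => cos (freq k t)) _ snd); first exact: measurable_freq_cos.
  by apply: measurable_funTS; exact: measurable_snd.
- apply: (@measurableT_comp _ _ _ _ (measurableTypeR R) _
    (fun t => sin (freq k t)) _ snd); first exact: measurable_freq_sin.
  by apply: measurable_funTS; exact: measurable_snd.
Qed.

Lemma sqr_normc_sep v k p : Normc.normc (sep v k p) ^+ 2 = v p.1 ^+ 2.
Proof.
rewrite sqr_normc !cE /= !mul0r subr0 addr0 !exprMn -mulrDr.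
by rewrite cos2Dsin2 mulr1.
Qed.

Lemma inL2_sep v k : bmeas v -> L2annulus (sep v k).
Proof.
move=> bv; have ms := cmeasurable_sep k bv; apply/inL2P.
split => //; have [_ [M vM]] := bv.
have := integrable_cst_fin measurable_annulus (M ^+ 2) annulus_lty.
apply: le_integrable; first exact: measurable_annulus.
  apply/measurable_EFinP; exact: measurable_sqnormc.
move=> [m t] [Im _]; rewrite sqr_normc_sep /= lee_fin !ger0_norm ?sqr_ge0//=.
have := vM m Im; rewrite ler_norml => /andP[h1 h2].
have := @mulr_ge0 R (v m + M) (M - v m); rewrite subr_ge0 h2 => /(_ _ isT) h.
have : 0 <= (v m + M) * (M - v m) by apply: h; lra.
by lra.
Qed.

Lemma conjc_real (a : R) : (a%:C)^*%R = a%:C.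
Proof. by apply: complexP; rewrite /= ?oppr0. Qed.

Lemma ae_L2circle_fiber f : L2annulus f ->
  {ae leb, forall m, I m -> L2circle (fiber f m)}.
Proof. exact: (ae_inL2_section mI mI). Qed.

Lemma ip_annulusE f g : L2annulus f -> L2annulus g ->
  cintegrable leb I (fun m => ipL2 leb I (fiber f m) (fiber g m)) /\
  ip_annulus f g = cintegral leb I (fun m => ipL2 leb I (fiber f m) (fiber g m)).
Proof. exact: (ipL2_rectangle mI mI). Qed.

Lemma fourierZ (z : R[i]) (u : R -> R[i]) k : L2circle u ->
  fourier (fun t => z * u t) k = z * fourier u k.
Proof.
move=> ui; rewrite !fourierE /ipL2 -cintegralZ//.
  by apply: eq_cintegral => t _; rewrite mulrA.
by apply: (cintegrable_mul_conj mI) => //; exact: inL2_expi.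
Qed.

Lemma ip_fiber_sep (u : R -> R[i]) v k m : L2circle u ->
  ipL2 leb I u (fiber (sep v k) m) = (v m)%:C * fourier u k.
Proof.
move=> ui; rewrite -fourierZ// fourierE.
by apply: eq_cintegral => t _; rewrite /fiber /sep /= rmorphM /= conjc_real; ring.
Qed.

(** Testing against a separated mode reads off a Fourier coefficient of the
fibers. *)
Lemma ip_sep f v k : L2annulus f -> bmeas v ->
  cintegrable leb I (fun m => ipL2 leb I (fiber f m) (fiber (sep v k) m)) /\
  {ae leb, forall m, I m -> ipL2 leb I (fiber f m) (fiber (sep v k) m) =
     (v m)%:C * fourier (fiber f m) k} /\
  ip_annulus f (sep v k) =
    cintegral leb I (fun m => ipL2 leb I (fiber f m) (fiber (sep v k) m)).
Proof.
move=> fi bv; have [h1 h2] := ip_annulusE fi (inL2_sep k bv).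
split => //; split => //.
apply: aeS (ae_L2circle_fiber fi) => m hm Im; exact/ip_fiber_sep/hm.
Qed.

End SeparatedModes.

(** * Weak derivatives on the circle *)

Section WeakDerivative.
Context (R : realType).
Notation leb := (@lebesgue_measure R).
Notation I := (@unit_itv R).
Notation Re := complex.Re.
Notation Im := complex.Im.
Implicit Types (k : int) (v w : R -> R[i]).

Let mI : @measurable _ (measurableTypeR R) I := @measurable_unit_itv R.

Lemma derivable_continuous (u : R -> R) :
  (forall t, derivable u t 1) -> continuous u.
Proof.
by move=> du t; apply: differentiable_continuous; exact/derivable1_diffP.
Qed.

Lemma continuous_bounded_unit (u : R -> R) : continuous u -> bmeas u.
Proof.
move=> cu; split.
  by apply: measurable_funTS; exact: continuous_measurable_fun.
have cn : {within `[0, 1], continuous (fun t => `|u t|)}.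
  apply: continuous_subspaceT => t; apply: continuous_comp; first exact: cu.
  exact: norm_continuous.
have [c Ic cmax] := EVT_max ler01 cn.
by exists `|u c| => t It; apply: cmax.
Qed.

Lemma inL2_bmeas (u : R -> R) : bmeas u -> L2circle (fun t => (u t)%:C).
Proof.
move=> [mu [M uM]]; apply/inL2P; split.
  by split; [exact: mu|exact: measurable_cst].
have := @integrable_cst_fin R _ _ leb I mI (M ^+ 2) (lebesgue_unit_itv_lty R).
apply: le_integrable => //.
  apply/measurable_EFinP; apply: measurable_sqnormc.
  by split; [exact: mu|exact: measurable_cst].
move=> t It; rewrite sqr_normc /= lee_fin expr0n addr0.
rewrite !ger0_norm ?sqr_ge0//.
have := uM t It; rewrite ler_norml => /andP[h1 h2].
have := @mulr_ge0 R (u t + M) (M - u t); rewrite subr_ge0 h2 => /(_ _ isT) h.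
have : 0 <= (u t + M) * (M - u t) by apply: h; lra.
by lra.
Qed.

Lemma cintegrable_mul_bmeas v (u : R -> R) : L2circle v -> bmeas u ->
  cintegrable leb I (fun t => v t * (u t)%:C).
Proof.
move=> vi bu; have := cintegrable_mul_conj mI vi (inL2_bmeas bu).
by under eq_fun do rewrite conjc_real.
Qed.

Lemma circle_test_bmeas (psi : R -> R) : circle_test psi -> bmeas psi /\ bmeas (derive1 psi).
Proof.
move=> [_ dpsi]; split; apply: continuous_bounded_unit; apply: derivable_continuous => t.
  by have := dpsi 0%N t; rewrite derive1n0.
by have := dpsi 1%N t; rewrite derive1n1.
Qed.

Lemma weak_derivative_lin z v w v' w' :
  L2circle v -> L2circle w -> L2circle v' -> L2circle w' ->
  weak_derivative v w -> weak_derivative v' w' ->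
  weak_derivative (fun t => z * v t + v' t) (fun t => z * w t + w' t).
Proof.
move=> vi wi vi' wi' vw vw' psi tpsi; have [b0 b1] := circle_test_bmeas tpsi.
transitivity (z * cintegral leb I (fun t => v t * (derive1 psi t)%:C) +
    cintegral leb I (fun t => v' t * (derive1 psi t)%:C)).
  rewrite -(cintegral_lin mI); try exact: cintegrable_mul_bmeas.
  by apply: eq_cintegral => t _; ring.
rewrite (vw _ tpsi) (vw' _ tpsi) mulrN -opprD; congr (- _).
rewrite -(cintegral_lin mI); try exact: cintegrable_mul_bmeas.
by apply: eq_cintegral => t _; ring.
Qed.

Lemma weak_derivativeZ z v w : L2circle v -> L2circle w ->
  weak_derivative v w -> weak_derivative (fun t => z * v t) (fun t => z * w t).
Proof.
move=> vi wi vw psi tpsi; have [b0 b1] := circle_test_bmeas tpsi.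
transitivity (z * cintegral leb I (fun t => v t * (derive1 psi t)%:C)).
  rewrite -(cintegralZ mI); last exact: cintegrable_mul_bmeas.
  by apply: eq_cintegral => t _; rewrite mulrA.
rewrite (vw _ tpsi) mulrN; congr (- _).
rewrite -(cintegralZ mI); last exact: cintegrable_mul_bmeas.
by apply: eq_cintegral => t _; rewrite mulrA.
Qed.

Lemma by_parts_circle (u u' psi : R -> R) :
  (forall t : R, is_derive t 1 u (u' t)) -> continuous u' -> u 1 = u 0 ->
  circle_test psi ->
  Rintegral leb I (fun t => u t * derive1 psi t) =
  - Rintegral leb I (fun t => u' t * psi t).
Proof.
move=> du cu' u10 tpsi; have [per dpsi] := tpsi.
have d0 t : derivable psi t 1 by have := dpsi 0%N t; rewrite derive1n0.
have d1 t : derivable (derive1 psi) t 1 by have := dpsi 1%N t; rewrite derive1n1.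
have cpsi := derivable_continuous d0; have cpsi' := derivable_continuous d1.
have cu : continuous u by apply: derivable_continuous => t; exact: ex_derive.
have cont_int (f : R -> R) : continuous f -> leb.-integrable I (EFin \o f).
  move=> cf; apply: continuous_compact_integrable.
    exact: segment_compact.
  exact: continuous_subspaceT.
have dF (t : R) : is_derive t 1 (fun t => u t * psi t) (u t * derive1 psi t + u' t * psi t).
  have dpsit : is_derive t 1 psi (derive1 psi t).
    by split; [exact: d0|rewrite derive1E].
  have h := @is_deriveM _ _ u psi t 1 _ _ (du t) dpsit.
  by apply: (is_derive_eq h); congr (_ + _); rewrite [RHS]mulrC.
have c1 : continuous (fun t => u t * derive1 psi t).
  by move=> t; apply: cvgM; [exact: cu|exact: cpsi'].
have c2 : continuous (fun t => u' t * psi t).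
  by move=> t; apply: cvgM; [exact: cu'|exact: cpsi].
have cc : continuous (fun t => u t * derive1 psi t + u' t * psi t).
  by move=> t; apply: cvgD; [exact: c1|exact: c2].
have := Rintegral_FTC dF cc.
have -> : psi 1 = psi 0 by have := per 0; rewrite add0r.
rewrite u10 subrr RintegralD; [|exact: mI|exact: cont_int|exact: cont_int].
by move/eqP; rewrite addr_eq0 => /eqP.
Qed.

Lemma weak_derivative_expi k :
  @weak_derivative R (expi k) (fun t => (0 +i* (2 * pi * k%:~R)) * expi k t).
Proof.
move=> psi tpsi; apply: complexP; rewrite cE /=.
- transitivity (Rintegral leb I (fun t => cos (freq k t) * derive1 psi t)).
    by apply: eq_Rintegral => t _; rewrite ?cE /=; ring.
  rewrite (by_parts_circle (is_derive_cos_freq k)) //.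
  + congr (- _); apply: eq_Rintegral => t _; rewrite ?cE /=; ring.
  + move=> t; apply: cvgM; [exact: cvg_cst|exact: continuous_freq_sin].
  + by rewrite cos_freq1 freq0 cos0.
- transitivity (Rintegral leb I (fun t => sin (freq k t) * derive1 psi t)).
    by apply: eq_Rintegral => t _; rewrite ?cE /=; ring.
  rewrite (by_parts_circle (is_derive_sin_freq k)) //.
  + congr (- _); apply: eq_Rintegral => t _; rewrite ?cE /=; ring.
  + move=> t; apply: cvgM; [exact: cvg_cst|exact: continuous_freq_cos].
  + by rewrite sin_freq1 freq0 sin0.
Qed.

Lemma derive1_trig k (a b : R) :
  derive1 (fun t => a * cos (freq k t) + b * sin (freq k t)) =
  fun t => (2 * pi * k%:~R * b) * cos (freq k t) + (- (2 * pi * k%:~R * a)) * sin (freq k t).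
Proof.
apply/funext => t; rewrite derive1E.
have h1 := is_derive_mull a (is_derive_cos_freq k t).
have h2 := is_derive_mull b (is_derive_sin_freq k t).
have := @is_deriveD _ _ _ (fun t => a * cos (freq k t)) (fun t => b * sin (freq k t)) t 1 _ _ h1 h2.
move=> /@derive_val ->; ring.
Qed.

Lemma circle_test_trig k (a b : R) :
  circle_test (fun t => a * cos (freq k t) + b * sin (freq k t)).
Proof.
split=> [t|n].
  have fE : freq k (t + 1) = freq k t + freq k 1 by rewrite /freq; ring.
  by rewrite fE cosD sinD cos_freq1 sin_freq1; ring.
elim: n a b => [|n IH] a b t.
  rewrite derive1n0.
  have h1 := is_derive_mull a (is_derive_cos_freq k t).
  have h2 := is_derive_mull b (is_derive_sin_freq k t).
  have := @is_deriveD _ _ _ (fun t => a * cos (freq k t)) (fun t => b * sin (freq k t)) t 1 _ _ h1 h2.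
  by move=> /@ex_derive.
by rewrite derive1Sn derive1_trig; exact: IH.
Qed.

(** The cosine and the sine of frequency [k] are admissible test functions. *)
Lemma fourier_weak_derivative v w k : L2circle v -> L2circle w ->
  weak_derivative v w -> fourier w k = (0 +i* (2 * pi * k%:~R)) * fourier v k.
Proof.
move=> vi wi vw.
pose C u := cintegral leb I (fun t => u t * (cos (freq k t))%:C).
pose S u := cintegral leb I (fun t => u t * (sin (freq k t))%:C).
have bc : bmeas (fun t => cos (@freq R k t)).
  by apply: continuous_bounded_unit; exact: continuous_freq_cos.
have bs : bmeas (fun t => sin (@freq R k t)).
  by apply: continuous_bounded_unit; exact: continuous_freq_sin.
have FE u : L2circle u -> fourier u k = C u + (0 -i* 1) * S u.
  move=> ui; rewrite fourierE.
  have := cintegral_lin mI (0 -i* 1) (cintegrable_mul_bmeas ui bs) (cintegrable_mul_bmeas ui bc).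
  rewrite [RHS]addrC => <-; apply: eq_cintegral => t _.
  by apply: complexP; rewrite !cE /=; ring.
have e1 : C w = (2 * pi * k%:~R)%:C * S v.
  have := vw _ (circle_test_trig k 1 0); rewrite derive1_trig.
  under eq_fun do rewrite mulr0 mul0r add0r mulr1 rmorphM rmorphN /=.
  have -> : (fun t => v t * (- (2 * pi * k%:~R)%:C * (sin (freq k t))%:C)) =
      (fun t => (- (2 * pi * k%:~R)%:C) * (v t * (sin (freq k t))%:C)).
    by apply/funext => t; ring.
  rewrite (cintegralZ mI); last exact: cintegrable_mul_bmeas.
  rewrite mulNr => /oppr_inj ->; apply: eq_cintegral => t _.
  by rewrite mul1r mul0r addr0.
have e2 : S w = - ((2 * pi * k%:~R)%:C * C v).
  have := vw _ (circle_test_trig k 0 1); rewrite derive1_trig.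
  under eq_fun do rewrite mulr0 oppr0 mul0r addr0 mulr1 rmorphM /=.
  have -> : (fun t => v t * ((2 * pi * k%:~R)%:C * (cos (freq k t))%:C)) =
      (fun t => (2 * pi * k%:~R)%:C * (v t * (cos (freq k t))%:C)).
    by apply/funext => t; ring.
  rewrite (cintegralZ mI); last exact: cintegrable_mul_bmeas.
  move=> ->; rewrite opprK; apply: eq_cintegral => t _.
  by rewrite mul1r mul0r add0r.
rewrite !FE// e1 e2; move: (C v) (S v) => x y.
by apply: complexP; rewrite !cE /=; ring.
Qed.

End WeakDerivative.

(** * The operator on Fourier modes *)

Section NullVector.
Context (R : realType) (d : measure_display) (T : measurableType d).
Context (mu : {measure set T -> \bar R}) (D : set T) (mD : measurable D).
Notation L2 := (inL2 mu D).
Notation ip := (ipL2 mu D).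
Notation sq := (sqL2 mu D).

Lemma sqL2_eq0 (u : T -> R[i]) : L2 u -> sq u = 0 -> aeqc mu D u (fun=> 0).
Proof.
move=> ui u0; have [mu_ ufin] := ui.
have m : measurable_fun D (fun x => (Normc.normc (u x) ^+ 2)%:E).
  exact/measurable_EFinP/measurable_sqnormc.
have : (\int[mu]_(x in D) `|(Normc.normc (u x) ^+ 2)%:E| = 0)%E.
  transitivity (sqnormL2 mu D u).
    by apply: eq_integral => x _; rewrite /= ger0_norm// sqr_ge0.
  rewrite -[LHS]fineK -?sqL2E ?u0//.
  by rewrite ge0_fin_numE//; apply: integral_ge0 => x _; rewrite lee_fin sqr_ge0.
move/(ae_eq_integral_abs mu mD m); apply: aeS => x h Dx.
have := h Dx; rewrite /= => -[] /eqP; rewrite sqrf_eq0 => /eqP.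
by move=> /Normc.eq0_normc.
Qed.

Lemma ipL2_0r (f : T -> R[i]) : ip f (fun=> 0) = 0.
Proof.
rewrite /ipL2 -[RHS](cintegral0 mu D); apply: eq_cintegral => x _.
by rewrite conjC0 mulr0.
Qed.

Lemma ipL2_ae0r (f u : T -> R[i]) : L2 f -> L2 u -> aeqc mu D u (fun=> 0) ->
  ip f u = 0.
Proof.
move=> fi ui u0; rewrite -[RHS](ipL2_0r f); apply: aeqc_ipL2 => //.
- exact: inL2_0.
- exact: aeW.
Qed.

End NullVector.

Section TransportOperator.
Context (R : realType) (phi : R -> R).
Notation leb := (@lebesgue_measure R).
Notation I := (@unit_itv R).
Notation leb2 := (leb \x leb)%E.
Notation annulus := (@annulus R).
Hypothesis bphi : bmeas phi.
Implicit Types (v : R -> R) (f g h : R * R -> R[i]).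

Let mI : @measurable _ (measurableTypeR R) I := @measurable_unit_itv R.
Let mA := @measurable_annulus R.

(** The operator acts on the [k]-th Fourier mode as multiplication by this
function. *)
Definition symbol (k : int) (m : R) : R := 2 * pi * k%:~R * phi m.

Lemma bmeas_symbol k : bmeas (symbol k).
Proof. by apply: bmeasM => //; exact: bmeas_cst. Qed.

Lemma transport_L2 f h : transport_op phi f h -> L2annulus f /\ L2annulus h.
Proof. by case. Qed.

Lemma transport_lin (z : R[i]) f f' h h' :
  transport_op phi f h -> transport_op phi f' h' ->
  transport_op phi (fun t => z * f t + f' t) (fun t => z * h t + h' t).
Proof.
move=> [fi hi fh] [fi' hi' fh']; split; try exact: inL2_lin.
have ff := ae_L2circle_fiber fi; have ff' := ae_L2circle_fiber fi'.
apply: aeS2 (aeS2 (fun m => @conj _ _) fh fh') (aeS2 (fun m => @conj _ _) ff ff').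
move=> m [h1 h2] [L1 L2] Im; have [w [wi vw hw]] := h1 Im.
have [w' [wi' vw' hw']] := h2 Im; exists (fun t => z * w t + w' t); split.
- exact: inL2_lin.
- by apply: weak_derivative_lin => //; [exact: L1|exact: L2].
- apply: aeS2 hw hw' => t e1 e2 It.
  by rewrite /fiber in e1 e2 *; rewrite e1// e2//; ring.
Qed.

Lemma transport_sep v k : bmeas v ->
  transport_op phi (sep v k) (sep (fun m => symbol k m * v m) k).
Proof.
move=> bv; have bs := bmeas_symbol k; split.
- exact: inL2_sep.
- by apply: inL2_sep; exact: bmeasM.
apply: aeW => m Im; exists (fun t => (v m)%:C * ((0 +i* (2 * pi * k%:~R)) * expi k t)).
split.
- by apply: (inL2Z mI); apply: (inL2Z mI); exact: inL2_expi.
- have ei := inL2_expi R k.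
  apply: (@weak_derivativeZ R (v m)%:C (expi k) (fun t => (0 +i* (2 * pi * k%:~R)) * expi k t)) => //; first exact: inL2Z.
  exact: weak_derivative_expi.
- apply: aeW => t It; rewrite /fiber /sep /symbol /=.
  by apply: complexP; rewrite !cE /=; ring.
Qed.

Lemma transport_fourier f h : transport_op phi f h ->
  {ae leb, forall m, I m -> forall k,
     fourier (fiber h m) k = (symbol k m)%:C * fourier (fiber f m) k}.
Proof.
move=> [fi hi fh].
have ff := ae_L2circle_fiber fi; have hh := ae_L2circle_fiber hi.
apply: aeS2 fh (aeS2 (fun m => @conj _ _) ff hh) => m H [fm hm] Im k.
have [w [wi vw hw]] := H Im.
transitivity (fourier (fun t => (0 -i* phi m) * w t) k).
  rewrite !fourierE; apply: aeqc_ipL2 => //; [exact: hm|exact: inL2Z| | |].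
  - exact: inL2_expi.
  - exact: inL2_expi.
  - exact: aeW.
rewrite fourierZ// (fourier_weak_derivative k (fm Im) wi vw) mulrA /symbol.
by congr (_ * _); apply: complexP => /=; ring.
Qed.

(** Both sides are integrals over the radius of the same multiple of the [k]-th
Fourier coefficients of the fibers of [f]. *)
Lemma transport_sym f h v k : transport_op phi f h -> bmeas v ->
  ip_annulus h (sep v k) = ip_annulus f (sep (fun m => symbol k m * v m) k).
Proof.
move=> fh bv; have [fi hi _] := fh.
have bsv : bmeas (fun m => symbol k m * v m) by exact: bmeasM (bmeas_symbol k) bv.
have [c1 [a1 ->]] := ip_sep k hi bv.
have [c2 [a2 ->]] := ip_sep k fi bsv.
apply: (ae_eq_cintegral mI); [exact: (cintegrable_cmeasurable c1)|exact: (cintegrable_cmeasurable c2)|].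
have tf := transport_fourier fh.
apply: aeS2 tf (aeS2 (fun m => @conj _ _) a1 a2) => m t1 [e1 e2] Im.
rewrite e1// e2// t1// mulrA; congr (_ * _).
by rewrite mulrC; apply: complexP; rewrite !cE /=; ring.
Qed.

End TransportOperator.

(** * The spectral projections on Fourier modes *)

Section Localization.
Context (R : realType) (d : measure_display) (T : measurableType d).
Context (mu : {measure set T -> \bar R}) (D : set T) (mD : measurable D).
Implicit Types P Q : T -> R[i].

Lemma cintegral_indic (A : set T) P : A `<=` D ->
  cintegral mu A P = cintegral mu D (fun x => (\1_A x)%:C * P x).
Proof.
move=> AD.
have key (u : T -> R) : Rintegral mu A u = Rintegral mu D (fun x => \1_A x * u x).
  rewrite Rintegral_mkcond [RHS]Rintegral_mkcond; apply: eq_Rintegral => x _.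
  rewrite !patchE indicE; have [xA|xA] := boolP (x \in A).
    by rewrite (mem_set (AD _ (set_mem xA))) mul1r.
  by rewrite mul0r; case: ifP.
apply: complexP => /=; rewrite key; apply: eq_Rintegral => x _; rewrite !cE /=; ring.
Qed.

Lemma cintegral_ae_eq P Q : cintegrable mu D P -> cintegrable mu D Q ->
  (forall A, measurable A -> A `<=` D -> cintegral mu A P = cintegral mu A Q) ->
  aeqc mu D P Q.
Proof.
move=> [P1 P2] [Q1 Q2] PQ.
have fin (A : set T) (u : T -> R) : measurable A -> A `<=` D ->
    mu.-integrable D (EFin \o u) ->
    (\int[mu]_(x in A) (u x)%:E = (Rintegral mu A u)%:E)%E.
  move=> mA AD ui; rewrite /Rintegral fineK//; apply: integrable_fin_num => //.
  exact: integrableS ui.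
have h1 : ae_eq mu D (EFin \o (fun x => complex.Re (P x))) (EFin \o (fun x => complex.Re (Q x))).
  apply: integral_ae_eq => //; first exact: measurable_int Q1.
  move=> A AD mA; rewrite !fin//; congr EFin.
  by have := PQ A mA AD => /(f_equal (@complex.Re R)).
have h2 : ae_eq mu D (EFin \o (fun x => complex.Im (P x))) (EFin \o (fun x => complex.Im (Q x))).
  apply: integral_ae_eq => //; first exact: measurable_int Q2.
  move=> A AD mA; rewrite !fin//; congr EFin.
  by have := PQ A mA AD => /(f_equal (@complex.Im R)).
apply: aeS2 h1 h2 => x e1 e2 Dx; apply: complexP.
- by case: (e1 Dx).
- by case: (e2 Dx).
Qed.

End Localization.

Section ModeProjection.
Context (R : realType) (phi : R -> R).
Context (E : R -> (R * R -> R[i]) -> R * R -> R[i]).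
Notation leb := (@lebesgue_measure R).
Notation I := (@unit_itv R).
Notation leb2 := (leb \x leb)%E.
Notation annulus := (@annulus R).
Notation symbol := (symbol phi).
Notation sq := (sqL2 leb2 annulus).
Hypothesis bphi : bmeas phi.
Hypothesis hE : spectral_resolution leb2 annulus (transport_op phi) E.
Implicit Types (v : R -> R) (f g h : R * R -> R[i]).

Let mI : @measurable _ (measurableTypeR R) I := @measurable_unit_itv R.
Let mA := @measurable_annulus R.

Let hR : resolution_of_identity leb2 annulus E. Proof. by case: hE. Qed.

Let EL2 x f : L2annulus f -> L2annulus (E x f).
Proof. by have [/(_ x)[+ _ _ _ _] _ _ _ _] := hR; exact. Qed.

Let Esym x f g : L2annulus f -> L2annulus g ->
  ip_annulus (E x f) g = ip_annulus f (E x g).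
Proof. by have [/(_ x)[_ _ _ _ +] _ _ _ _] := hR; exact. Qed.

Lemma sq_sep v k : bmeas v ->
  leb2.-integrable annulus (fun p => (v p.1 ^+ 2)%:E) /\
  sq (sep v k) = Rintegral leb2 annulus (fun p => v p.1 ^+ 2).
Proof.
move=> bv; have si := inL2_sep k bv; split.
  have /inL2P[_] := si; apply: eq_integrable => // p _.
  by rewrite sqr_normc_sep.
rewrite sqL2E//; congr fine; apply: eq_integral => p _.
by rewrite sqr_normc_sep.
Qed.

Lemma mode_decay v b k : bmeas v -> bmeas b ->
  (forall m, I m -> v m != 0 -> 0 <= b m < 1) ->
  sq (sep (fun m => v m * b m ^+ n) k) @[n --> \oo] --> (0 : R).
Proof.
move=> bv bb vb; pose w n m := v m * b m ^+ n.
have bw n : bmeas (w n) by apply: bmeasM => //; exact: bmeasX.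
have [vi _] := sq_sep k bv.
have := @dominated_convergence _ _ R leb2 annulus mA
  (fun n p => (w n p.1 ^+ 2)%:E) (cst 0%E) (fun p => (v p.1 ^+ 2)%:E).
case.
- by move=> n; have [wi _] := sq_sep k (bw n); exact: measurable_int wi.
- exact: measurable_cst.
- apply: aeW => -[m t] [Im _].
  suff h : w n m ^+ 2 @[n --> \oo] --> (0 : R).
    by apply: cvg_EFin; [exact: nearW|exact: h].
  have -> : (0 : R) = (v m * 0) ^+ 2 by rewrite mulr0 expr0n.
  have [v0|v0] := eqVneq (v m) 0.
    have -> : (fun n => w n m ^+ 2) = cst ((v m * 0) ^+ 2).
      by apply/funext => n; rewrite /w v0 !mul0r.
    exact: cvg_cst.
  have /andP[b0 b1] := vb m Im v0.
  have h : w n m @[n --> \oo] --> v m * 0.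
    by apply: cvgM; [exact: cvg_cst|apply: cvg_expr; rewrite ger0_norm].
  exact: (cvgM h h).
- exact: vi.
- apply: aeW => -[m t] n [Im _] /=; rewrite lee_fin ger0_norm ?sqr_ge0//.
  rewrite /w; have [->|v0] := eqVneq (v m) 0; first by rewrite mul0r.
  have /andP[b0 b1] := vb m Im v0.
  by rewrite exprMn ler_piMr ?sqr_ge0// -exprM exprn_ile1// ltW.
- move=> _ _ h.
  have z : (\int[leb2]_(p in annulus) (cst 0%E : R * R -> \bar R) p = 0%:E)%E by exact: integral0.
  have h0 : (fun n => \int[leb2]_(p in annulus) (w n p.1 ^+ 2)%:E)%E @ \oo --> 0%:E.
    by rewrite -z; exact: h.
  have e n : sq (sep (w n) k) = fine (\int[leb2]_(p in annulus) (w n p.1 ^+ 2)%:E)%E.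
    by have [_ ->] := sq_sep k (bw n).
  by under eq_fun do rewrite e; exact: fine_cvg h0.
Qed.

Section Iterate.
Context (k : int) (l c : R) (v : R -> R).
Hypothesis bv : bmeas v.
Hypothesis cl : c != l.
(* solves [symbol k m = c - (c - l) * b m], the recursion behind [proj_iter] *)
Let b m := (c - symbol k m) / (c - l).
Hypothesis vb : forall m, I m -> v m != 0 -> 0 <= b m < 1.

Let cl0 : c - l != 0. Proof. by rewrite subr_eq0. Qed.

Let bb : bmeas b.
Proof.
have -> : b = fun m => (c / (c - l)) + (- (c - l)^-1) * symbol k m.
  by apply/funext => m; rewrite /b; field.
apply: bmeasD; first exact: bmeas_cst.
by apply: bmeasM; [exact: bmeas_cst|exact: bmeas_symbol].
Qed.

Let g n := sep (fun m => v m * b m ^+ n) k.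

Let bw n : bmeas (fun m => v m * b m ^+ n).
Proof. by apply: bmeasM => //; exact: bmeasX. Qed.

Let stepE n : (fun p => c%:C * g n p - (c - l)%:C * g n.+1 p) =
  sep (fun m => symbol k m * (v m * b m ^+ n)) k.
Proof.
apply/funext => -[m t]; rewrite /g /sep /= mulrA [X in _ - X]mulrA -mulrBl.
congr (_ * _); rewrite -!rmorphM -rmorphB /=; congr (_%:C).
by rewrite exprS /b; field.
Qed.

Let Ag n : transport_op phi (g n) (fun p => c%:C * g n p - (c - l)%:C * g n.+1 p).
Proof. by rewrite stepE; exact: transport_sep. Qed.

Let sg n f h : transport_op phi f h ->
  ipL2 leb2 annulus h (g n) =
  ipL2 leb2 annulus f (fun p => c%:C * g n p - (c - l)%:C * g n.+1 p).
Proof. by move=> fh; rewrite stepE; exact: transport_sym. Qed.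

Let decay : sq (g n) @[n --> \oo] --> (0 : R).
Proof. exact: mode_decay. Qed.

Let le0 x : (forall n, x <= sq (g n)) -> x <= 0.
Proof. by move=> h; apply: (cvgr_to_ge decay); exact: nearW. Qed.

Let g0 : g 0 = sep v k.
Proof. by rewrite /g; congr sep; apply/funext => m; rewrite expr0 mulr1. Qed.

(** By [proj_iter] the norm of [E l (g 0)] is at most that of every [g n], and
these tend to 0 since [b] is less than 1 on the support of [v]. *)
Lemma proj_mode_null : l < c -> sq (E l (sep v k)) = 0.
Proof.
move=> lc; apply/eqP; rewrite eq_le sqL2_ge0 andbT; apply: le0 => n.
rewrite -g0; apply: (proj_iter mA hE _ _ Ag sg) => //.
- by move=> f h; exact: transport_L2.
- by move=> z f f' h h'; exact: transport_lin.
Qed.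

Lemma projC_mode_null : c < l -> sq (fun p => sep v k p - E l (sep v k) p) = 0.
Proof.
move=> lc; apply/eqP; rewrite eq_le sqL2_ge0 andbT; apply: le0 => n.
rewrite -g0; apply: (projC_iter mA hE _ _ Ag sg) => //.
- by move=> f h; exact: transport_L2.
- by move=> z f f' h h'; exact: transport_lin.
Qed.

End Iterate.

Lemma ip_proj_mode_gt k l v f : bmeas v -> L2annulus f ->
  (forall m, I m -> v m != 0 -> l < symbol k m) ->
  ip_annulus (E l f) (sep v k) = 0.
Proof.
move=> bv fi vl; have [_ [M sM]] := bmeas_symbol bphi k.
have si := inL2_sep k bv; rewrite Esym//.
apply: (ipL2_ae0r mA fi (EL2 l si)); apply: (sqL2_eq0 mA (EL2 l si)).
(* beyond the values of the symbol, so that [b] is nonnegative *)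
pose c := `|M| + `|l| + 1.
have lc : l < c by rewrite /c; have := ler_norm l; have := normr_ge0 M; lra.
apply: (@proj_mode_null k l c) => //; first by rewrite gt_eqF.
move=> m Im v0; have := vl m Im v0; have := sM m Im.
have := ler_norm M; have := ler_norm (symbol k m); have := normr_ge0 l => h1 h2 h3 h4 h5.
have c0 : 0 < c - l by rewrite subr_gt0.
rewrite ltr_pdivrMr// mul1r; apply/andP; split; last by lra.
by apply: divr_ge0; [rewrite /c; lra|exact: ltW].
Qed.

Lemma ip_proj_mode_lt k l v f : bmeas v -> L2annulus f ->
  (forall m, I m -> v m != 0 -> symbol k m < l) ->
  ip_annulus (E l f) (sep v k) = ip_annulus f (sep v k).
Proof.
move=> bv fi vl; have [_ [M sM]] := bmeas_symbol bphi k.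
have si := inL2_sep k bv; rewrite Esym//; apply/eqP; rewrite eq_sym -subr_eq0.
rewrite /ip_annulus -(ipL2Br mA si (EL2 l si) fi); apply/eqP.
have qi := inL2B mA si (EL2 l si).
apply: (ipL2_ae0r mA fi qi); apply: (sqL2_eq0 mA qi).
pose c := - (`|M| + `|l| + 1).
have lc : c < l by rewrite /c; have := ler_norm (- l); rewrite normrN; have := normr_ge0 M; lra.
apply: (@projC_mode_null k l c) => //; first by rewrite lt_eqF.
move=> m Im v0; have := vl m Im v0; have := sM m Im.
have := ler_norm M; have := ler_norm (- symbol k m); rewrite normrN.
have := normr_ge0 l => h1 h2 h3 h4 h5.
have c0 : 0 < l - c by rewrite subr_gt0.
rewrite -mulrNN -invrN !opprB ltr_pdivrMr// mul1r; apply/andP; split; last by lra.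
by apply: divr_ge0; [rewrite /c; lra|exact: ltW].
Qed.

Definition below (k : int) (l : R) : set R := [set m | I m /\ symbol k m < l].

Let measurable_symbol_set (k : int) (l : R) (P : set R) :
  @measurable _ (measurableTypeR R) P ->
  @measurable _ (measurableTypeR R) (I `&` symbol k @^-1` P).
Proof. by have [ms _] := bmeas_symbol bphi k => mP; exact: ms. Qed.

Lemma measurable_below k l : @measurable _ (measurableTypeR R) (below k l).
Proof.
have -> : below k l = I `&` symbol k @^-1` `]-oo, l[.
  by apply/seteqP; split => m /=; rewrite in_itv.
apply: measurable_symbol_set => //; exact: measurable_itv.
Qed.

(** The profile is split according to the sign of [symbol k m - l]. The
projection fixes one part and annihilates another, by [projC_mode_null] and
[proj_mode_null], and the third part lives on a null set. *)
Lemma ip_proj_mode k l v f : bmeas v -> L2annulus f ->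
  {ae leb, forall m, I m -> symbol k m != l} ->
  ip_annulus (E l f) (sep v k) = ip_annulus f (sep (fun m => \1_(below k l) m * v m) k).
Proof.
move=> bv fi nul.
pose S0 := I `&` symbol k @^-1` [set l]; pose S1 := I `&` symbol k @^-1` `]l, +oo[.
have mS0 : @measurable _ (measurableTypeR R) S0.
  apply: measurable_symbol_set => //; exact: measurable_set1.
have mS1 : @measurable _ (measurableTypeR R) S1.
  apply: measurable_symbol_set => //; exact: measurable_itv.
have mS := measurable_below k l.
pose cut (S : set R) m := \1_S m * v m.
have bcut S : @measurable _ (measurableTypeR R) S -> bmeas (cut S).
  by move=> mS'; apply: bmeasM => //; exact: bmeas_indic.
have supp S m : cut S m != 0 -> S m.
  rewrite /cut indicE; have [/set_mem//|] := boolP (m \in S).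
  by rewrite mul0r eqxx.
have L2cut S : @measurable _ (measurableTypeR R) S -> L2annulus (sep (cut S) k).
  by move=> mS'; apply: inL2_sep; exact: bcut.
have Ei := EL2 l fi.
have split3 : ip_annulus (E l f) (sep v k) = ip_annulus (E l f) (sep (cut (below k l)) k) +
   (ip_annulus (E l f) (sep (cut S1) k) + ip_annulus (E l f) (sep (cut S0) k)).
  have L1 := L2cut _ mS1; have L0 := L2cut _ mS0; have Ls := L2cut _ mS.
  rewrite /ip_annulus -(ipL2Dr mA L1 L0 Ei) -(ipL2Dr mA Ls (inL2D mA L1 L0) Ei).
  rewrite /ipL2; apply: eq_cintegral => -[m t] [Im _]; congr (_ * _^*)%R.
  rewrite /sep /cut /= -!mulrDl; congr (_ * _); rewrite -!rmorphD /=; congr (_%:C).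
  rewrite -!mulrDl -[LHS]mul1r; congr (_ * _); rewrite !indicE.
  case: (ltgtP (symbol k m) l) => sl.
  - rewrite mem_set//; rewrite (memNset _) ?(memNset _) ?addr0//.
    + by move=> [_ /= e]; rewrite e ltxx in sl.
    + by move=> [_ /=]; rewrite in_itv/= andbT ltNge ltW.
  - rewrite (memNset _); last by move=> [_]; rewrite ltNge ltW.
    rewrite mem_set; last by split => //=; rewrite in_itv/= andbT.
    by rewrite memNset ?addr0 ?add0r// => -[_ /= e]; rewrite e ltxx in sl.
  - rewrite (memNset _); last by move=> [_]; rewrite sl ltxx.
    rewrite (memNset _); last by move=> [_ /=]; rewrite in_itv/= andbT sl ltxx.
    by rewrite mem_set ?add0r.
rewrite split3 (ip_proj_mode_lt (bcut _ mS) fi); last first.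
  by move=> m Im /supp[].
rewrite (ip_proj_mode_gt (bcut _ mS1) fi) ?add0r; last first.
  by move=> m Im /supp[_ /=]; rewrite in_itv/= andbT.
rewrite [X in _ + X](_ : _ = 0) ?addr0//.
have [c1 [a1 ->]] := ip_sep k Ei (bcut _ mS0).
rewrite -[RHS](cintegral0 leb I); apply: (ae_eq_cintegral mI).
- exact: (cintegrable_cmeasurable c1).
- exact: cmeasurable_cst.
apply: aeS2 a1 nul => m e1 ne Im; rewrite e1//.
rewrite /cut indicE memNset ?mul0r// => -[_ /= e].
by have := ne Im; rewrite e eqxx.
Qed.

(** Modes with arbitrary profiles determine the Fourier coefficients of almost
every fiber. *)
Lemma fourier_proj k l f : L2annulus f ->
  {ae leb, forall m, I m -> symbol k m != l} ->
  {ae leb, forall m, I m -> fourier (fiber (E l f) m) k =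
     (\1_(below k l) m)%:C * fourier (fiber f m) k}.
Proof.
move=> fi nul; have Ei := EL2 l fi.
have bS : bmeas (fun m => \1_(below k l) m : R).
  by apply: bmeas_indic; exact: measurable_below.
have [c1 [a1 _]] := ip_sep k Ei (bmeas_cst 1).
have [c2 [a2 _]] := ip_sep k fi bS.
set P := (fun m => ipL2 leb I (fiber (E l f) m) _) in c1 a1.
set Q := (fun m => ipL2 leb I (fiber f m) _) in c2 a2.
suff PQ : aeqc leb I P Q.
  apply: aeS2 PQ (aeS2 (fun m => @conj _ _) a1 a2) => m e [e1 e2] Im.
  by have := e Im; rewrite /P /Q e1// e2// mul1r.
apply: (cintegral_ae_eq mI c1 c2) => A mAs AI.
have b1 : bmeas (fun m => \1_A m : R) by exact: bmeas_indic.
have b2 : bmeas (fun m => \1_(below k l) m * \1_A m) by exact: bmeasM.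
rewrite !(cintegral_indic _ _ AI).
have [c3 [a3 e3]] := ip_sep k Ei b1.
have [c4 [a4 e4]] := ip_sep k fi b2.
have := ip_proj_mode b1 fi nul; rewrite e3 e4 => e34.
have m1 u : cintegrable leb I u -> cmeasurable I (fun x => (\1_A x)%:C * u x).
  move=> /cintegrable_cmeasurable mu.
  have mA' : @cmeasurable R _ (measurableTypeR R) I (fun x => (\1_A x)%:C).
    by split; [exact: b1.1|exact: measurable_cst].
  exact: (cmeasurableM mA' mu).
transitivity (cintegral leb I
    (fun m => ipL2 leb I (fiber (E l f) m) (fiber (sep (fun m => \1_A m) k) m))).
  apply: (ae_eq_cintegral mI); [exact: (m1 _ c1)|exact: (cintegrable_cmeasurable c3)|].
  by apply: aeS2 a1 a3 => m h1 h3 Im; rewrite /P (h1 Im) (h3 Im) mul1r.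
rewrite e34; apply: (ae_eq_cintegral mI); [exact: (cintegrable_cmeasurable c4)|exact: (m1 _ c2)|].
by apply: aeS2 a2 a4 => m h2 h4 Im; rewrite /Q (h2 Im) (h4 Im) rmorphM /= mulrA [_%:C * (\1_A m)%:C]mulrC.
Qed.

End ModeProjection.

(** * A fractional Morrey inequality *)

Section BoundedIntegrable.
Context (R : realType) (d : measure_display) (T : measurableType d).
Context (mu : {measure set T -> \bar R}) (D : set T) (mD : measurable D).

Lemma bounded_integrable (f : T -> R) (M : R) : (mu D < +oo)%E ->
  measurable_fun D f -> (forall x, D x -> `|f x| <= M) ->
  mu.-integrable D (EFin \o f).
Proof.
move=> Dy mf fM; apply: (le_integrable mD _ _ (integrable_cst_fin mD M Dy)).
  exact/measurable_EFinP.
by move=> x Dx; rewrite /= lee_fin (le_trans (fM x Dx))// ler_norm.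
Qed.

End BoundedIntegrable.

Section FractionalMorrey.
Context (R : realType).
Notation leb := (@lebesgue_measure R).
Notation I := (@unit_itv R).
Notation leb2 := (leb \x leb)%E.
Notation annulus := (@annulus R).
Notation mR := (measurableTypeR R).
Implicit Types (u : R -> R).

(** The integrand of the square of the Gagliardo seminorm of order [s]. *)
Definition gagliardo (s : R) u (p : R * R) : R :=
  (u p.1 - u p.2) ^+ 2 * (`|p.1 - p.2| `^ (1 + 2 * s))^-1.

Lemma gagliardo_ge0 s u p : 0 <= gagliardo s u p.
Proof. by rewrite mulr_ge0 ?sqr_ge0// invr_ge0 powR_ge0. Qed.

Lemma measurable_diff u : continuous u ->
  @measurable_fun _ _ (mR * mR)%type R setT (fun p => u p.1 - u p.2).
Proof.
move=> cu; apply: measurable_funB.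
- apply: (@measurableT_comp _ _ _ _ mR _ u _ fst); last exact: measurable_fst.
  exact: continuous_measurable_fun.
- apply: (@measurableT_comp _ _ _ _ mR _ u _ snd); last exact: measurable_snd.
  exact: continuous_measurable_fun.
Qed.

Lemma measurable_gagliardo s u : continuous u ->
  @measurable_fun _ _ (mR * mR)%type R setT (gagliardo s u).
Proof.
move=> cu; apply: measurable_funM.
  by apply: measurable_funX; exact: measurable_diff.
under eq_fun do rewrite -powRN.
apply: (measurableT_comp (measurable_powR _)).
apply: (measurableT_comp (@normr_measurable R setT)).
by apply: (@measurable_diff id) => x; exact: cvg_id.
Qed.

Definition average (a b : R) u : R := Rintegral leb `[a, b] u / (b - a).

Section Step.
Context (s K : R) (u : R -> R).
Hypothesis cu : continuous u.
Hypothesis s0 : 0 < s.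
Hypothesis K0 : 0 < K.
Hypothesis energy : (\int[leb2]_(p in annulus) (gagliardo s u p)%:E <= (K ^+ 2)%:E)%E.

Let mitv (a b : R) : @measurable _ mR (`[a, b]%classic : set R).
Proof. exact: measurable_itv. Qed.

Let leb_itv (a b : R) : a < b -> leb `[a, b]%classic = (b - a)%:E.
Proof. by move=> ab; rewrite lebesgue_measure_itv/= lte_fin ab. Qed.

Let leb_itv_lty (a b : R) : a < b -> (leb `[a, b]%classic < +oo)%E.
Proof. by move=> ab; rewrite leb_itv// ltry. Qed.

Let u_bound : exists M, forall t, 0 <= t <= 1 -> `|u t| <= M.
Proof.
by have [_ [M uM]] := continuous_bounded_unit cu; exists M => t t01; apply: uM;
  rewrite /unit_itv/= in_itv.
Qed.

Let integrable_u (a b : R) : 0 <= a -> a < b -> b <= 1 ->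
  leb.-integrable `[a, b]%classic (EFin \o u).
Proof.
move=> a0 ab b1; have [M uM] := u_bound.
apply: (bounded_integrable (mitv a b) (leb_itv_lty ab) (M := M)).
  by apply: measurable_funTS; exact: continuous_measurable_fun.
move=> t; rewrite /= in_itv/= => /andP[ta tb]; apply: uM.
by rewrite (le_trans a0 ta) (le_trans tb b1).
Qed.

(** The difference of the two averages is the average of [u y - u z] over a
rectangle, which the energy controls by the arithmetic-geometric mean with
weight [tau]. *)
Lemma average_step a b a' b' : 0 <= a -> b <= 1 -> a <= a' -> b' <= b -> a < b ->
  b' - a' = (b - a) / 2 ->
  `|average a b u - average a' b' u| <= 3 / 2 * ((b - a) `^ (s - 1 / 2) * K).
Proof.
move=> a0 b1 aa' bb' ab half.
have l0 : 0 < b - a by rewrite subr_gt0.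
have ab' : a' < b' by rewrite -subr_gt0 half; lra.
have l0' : 0 < b' - a' by rewrite subr_gt0.
set l := b - a in half l0 *; set J := `[a, b]%classic; set J' := `[a', b']%classic.
pose tau := l `^ (s - 1 / 2) * K.
have tau0 : 0 < tau by rewrite mulr_gt0// powR_gt0.
pose D := J `*` J'.
have mD : @measurable _ (mR * mR)%type D by apply: measurableX; exact: mitv.
have DA : D `<=` annulus.
  move=> [y z] [] /=; rewrite /J /J' /= !in_itv/= => /andP[y1 y2] /andP[z1 z2].
  rewrite /annulus /unit_itv; split; rewrite /= in_itv/=; apply/andP; split; lra.
have muD : leb2 D = (l * (b' - a'))%:E.
  etransitivity; first exact: (product_measure1E _ _ (mitv a b) (mitv a' b')).
  by rewrite EFinM; congr (_ * _)%E; exact: leb_itv.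
have muDy : (leb2 D < +oo)%E by rewrite muD ltry.
pose q (p : R * R) := u p.1 - u p.2.
have mq : @measurable_fun _ _ (mR * mR)%type R D q.
  by apply: measurable_funTS; exact: measurable_diff.
have [M uM] := u_bound.
have qM p : D p -> `|q p| <= M + M.
  move=> /DA[]; rewrite /unit_itv/= !in_itv/= => h1 h2.
  by apply: le_trans (ler_normB _ _) _; apply: lerD; exact: uM.
have iq : leb2.-integrable D (EFin \o q) := bounded_integrable mD muDy mq qM.
have iq2 : leb2.-integrable D (EFin \o (fun p => q p ^+ 2)).
  apply: (bounded_integrable mD muDy (M := (M + M) ^+ 2)); first exact: measurable_funX.
  by move=> p Dp; rewrite normrX; apply: lerXn2r; rewrite ?nnegrE//; [exact: le_trans (qM p Dp)|exact: qM].
have ic (c : R) : leb2.-integrable D (EFin \o (fun=> c)) := integrable_cst_fin mD c muDy.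
have Eq : Rintegral leb2 D q = l * (b' - a') * (average a b u - average a' b' u).
  etransitivity; first exact: (Rintegral_rectangle (mitv a b) (mitv a' b') iq).
  have iu : leb.-integrable J (EFin \o u) by apply: integrable_u.
  have iu' : leb.-integrable J' (EFin \o u) by apply: integrable_u; lra.
  have inner y : Rintegral leb J' (fun z => q (y, z)) =
      (b' - a') * u y + (- 1) * Rintegral leb J' u.
    rewrite /q /=; rewrite RintegralB; [|exact: mitv|
      exact: (integrable_cst_fin (mitv a' b') (u y) (leb_itv_lty ab'))|exact: iu'].
    rewrite mulN1r Rintegral_cst; last exact: mitv.
    by congr (_ - _); rewrite mulrC; congr (_ * _); exact: (congr1 fine (leb_itv ab')).
  transitivity (Rintegral leb J (fun y => (b' - a') * u y + (- 1) * Rintegral leb J' u)).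
    by apply: eq_Rintegral => y _; exact: inner.
  have -> := @Rintegral_lin R _ _ leb J (mitv a b) (b' - a') (-1) u (fun=> Rintegral leb J' u)
    iu (integrable_cst_fin (mitv a b) _ (leb_itv_lty ab)).
  rewrite (@Rintegral_cst _ _ _ leb J (mitv a b)).
  have -> : fine (leb J) = l by exact: (congr1 fine (leb_itv ab)).
  by rewrite /average -/J -/J' -/l; field; rewrite !gt_eqF.
have Eq2 : Rintegral leb2 D (fun p => q p ^+ 2) <= l `^ (1 + 2 * s) * K ^+ 2.
  have mg : @measurable_fun _ _ (mR * mR)%type _ D (fun p => (gagliardo s u p)%:E).
    by apply/measurable_EFinP; apply: measurable_funTS; exact: measurable_gagliardo.
  have : (\int[leb2]_(p in D) (q p ^+ 2)%:E <= (l `^ (1 + 2 * s))%:E * (K ^+ 2)%:E)%E.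
    apply: (@le_trans _ _ (\int[leb2]_(p in D) ((l `^ (1 + 2 * s))%:E * (gagliardo s u p)%:E))%E).
      apply: ge0_le_integral => //.
      - by move=> p _; rewrite lee_fin sqr_ge0.
      - exact/measurable_EFinP/measurable_funX.
      - exact: measurable_funeM.
      move=> [y z] [] /=; rewrite /J /J' /= !in_itv/= => /andP[y1 y2] /andP[z1 z2].
      rewrite -EFinM lee_fin /gagliardo /q /=.
      have [->|yz] := eqVneq y z; first by rewrite !subrr normr0 expr0n !mul0r mulr0.
      have n0 : 0 < `|y - z| by rewrite normr_gt0 subr_eq0.
      rewrite mulrCA ler_peMr ?sqr_ge0// ler_pdivlMr ?powR_gt0// mul1r.
      have e0 : 0 <= 1 + 2 * s by have := s0; lra.
      have ln : l \is Num.nneg by rewrite nnegrE ltW.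
      have yn : `|y - z| \is Num.nneg by rewrite nnegrE ltW.
      apply: (ge0_ler_powR e0 yn ln).
      by rewrite ler_norml /l; apply/andP; split; lra.
    rewrite ge0_integralZl_EFin ?powR_ge0//; last by move=> p _; rewrite lee_fin gagliardo_ge0.
    apply: lee_wpmul2l; first by rewrite lee_fin powR_ge0.
    apply: le_trans energy; apply: ge0_subset_integral => //.
    - exact: measurable_annulus.
    - by apply/measurable_EFinP; apply: measurable_funTS; exact: measurable_gagliardo.
    - by move=> p _; rewrite lee_fin gagliardo_ge0.
  rewrite -EFinM -(fineK (integrable_fin_num _ iq2)) //; exact.
have bound : `|Rintegral leb2 D q| <= tau / 2 * (l * (b' - a')) +
    (2 * tau)^-1 * (l `^ (1 + 2 * s) * K ^+ 2).
  apply: le_trans (le_normr_Rintegral mD iq) _.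
  have ia := integrable_norm iq.
  apply: (@le_trans _ _ (Rintegral leb2 D (fun p => 1 * (tau / 2) + (2 * tau)^-1 * q p ^+ 2))).
    apply: le_Rintegral => //.
    - exact: (integrable_lin mD 1 _ (ic _) iq2).
    move=> p _; rewrite mul1r -subr_ge0.
    have -> : tau / 2 + (2 * tau)^-1 * q p ^+ 2 - `|q p| = (2 * tau)^-1 * (`|q p| - tau) ^+ 2.
      by rewrite -(real_normK (num_real (q p))); field; rewrite gt_eqF.
    by rewrite mulr_ge0 ?sqr_ge0// invr_ge0 mulr_ge0// ltW.
  rewrite (Rintegral_lin mD _ _ (ic _) iq2) mul1r.
  apply: lerD; last by apply: ler_wpM2l => //; rewrite invr_ge0 mulr_ge0// ltW.
  rewrite Rintegral_cst//; have -> : fine (leb2 D) = l * (b' - a').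
    by exact: (congr1 fine muD).
  by [].
move: bound; rewrite Eq half normrM (ger0_norm (_ : 0 <= l * (l / 2))); last first.
  by rewrite mulr_ge0 ?divr_ge0// ltW.
set X := `|_ - _|; move=> h.
have tau2 : l `^ (1 + 2 * s) * K ^+ 2 = tau ^+ 2 * l ^+ 2.
  rewrite /tau exprMn mulrAC; congr (_ * _).
  rewrite -powR_mulrn ?powR_ge0// -powRrM -(powR_mulrn 2 (ltW l0)) -powRD; last first.
    by rewrite (gt_eqF l0) implybT.
  by congr (_ `^ _); lra.
rewrite tau2 in h.
have : l * (l / 2) * X <= l * (l / 2) * (3 / 2 * tau).
  apply: le_trans h _; rewrite le_eqVlt; apply/orP; left; apply/eqP.
  by field; rewrite gt_eqF.
by rewrite ler_pM2l// mulr_gt0// divr_gt0.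
Qed.

Lemma average_near a b c eps : 0 <= a -> a < b -> b <= 1 ->
  (forall t, a <= t <= b -> `|u t - c| <= eps) -> `|average a b u - c| <= eps.
Proof.
move=> a0 ab b1 ue; have l0 : 0 < b - a by rewrite subr_gt0.
have iu := integrable_u a0 ab b1.
have ic (r : R) := integrable_cst_fin (mitv a b) r (leb_itv_lty ab).
have mJ := mitv a b; have lJ := congr1 fine (leb_itv ab).
have id : leb.-integrable `[a, b]%classic (EFin \o (fun t => u t - c)).
  have := integrable_lin mJ 1 (-1) iu (ic c).
  by apply: eq_integrable => // t _; rewrite /= mul1r mulN1r.
have e : Rintegral leb `[a, b]%classic (fun t => u t - c) = (average a b u - c) * (b - a).
  rewrite RintegralB; [|exact: mJ|exact: iu|exact: ic].
  rewrite Rintegral_cst; last exact: mJ.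
  by rewrite [fine _]lJ /average mulrBl mulfVK// gt_eqF.
have := le_normr_Rintegral mJ id; rewrite e normrM (ger0_norm (ltW l0)) => h.
rewrite -(ler_pM2r l0); apply: le_trans h _.
apply: (@le_trans _ _ (Rintegral leb `[a, b]%classic (fun=> eps))).
  apply: le_Rintegral; [exact: mJ|exact: integrable_norm|exact: ic|].
  by move=> t; rewrite /= in_itv/=; exact: ue.
by rewrite Rintegral_cst; [rewrite [fine _]lJ|exact: mJ].
Qed.

Hypothesis s12 : 1 / 2 < s.

Let q : R := 2^-1 `^ (s - 1 / 2).

Let q_lt1 : q < 1.
Proof.
have s12' : 0 < s - 1 / 2 by rewrite subr_gt0.
have -> : (1 : R) = 1 `^ (s - 1 / 2) by rewrite powR1.
rewrite gt0_ltr_powR// ?nnegrE//; lra.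
Qed.

(** The sum of the geometric series of the bounds of [average_step]. *)
Definition morrey_const : R := 3 / 2 / (1 - q).

Lemma morrey_const_ge0 : 0 <= morrey_const.
Proof. by rewrite divr_ge0// subr_ge0 ltW. Qed.

(** Averages over nested intervals whose lengths halve form a Cauchy sequence
with geometric increments. *)
Lemma average_telescope (x p : R) (a b : nat -> R) : 0 < x ->
  (forall n, [/\ 0 <= a n, b n <= 1, a n <= a n.+1, b n.+1 <= b n &
                b n - a n = x / 2 ^+ n]) ->
  (forall n, a n <= p <= b n) ->
  `|average (a 0%N) (b 0%N) u - u p| <= morrey_const * (x `^ (s - 1 / 2) * K).
Proof.
move=> x0 ab pab; set B := x `^ (s - 1 / 2) * K.
have B0 : 0 <= B by rewrite mulr_ge0 ?powR_ge0// ltW.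
have pow n : (x / 2 ^+ n) `^ (s - 1 / 2) = x `^ (s - 1 / 2) * q ^+ n.
  rewrite powRM ?invr_ge0 ?exprn_ge0 ?(ltW x0)//; congr (_ * _).
  have h2 : (0 : R) <= 2^-1 by rewrite invr_ge0.
  by rewrite -exprVn -(powR_mulrn n h2) powRAC powR_mulrn// powR_ge0.
have len n : 0 < x / 2 ^+ n by rewrite divr_gt0// exprn_gt0.
have inc n : `|average (a n) (b n) u - average (a n.+1) (b n.+1) u| <= 3 / 2 * (B * q ^+ n).
  have [a0 b1 aa bb l] := ab n; have [_ _ _ _ l'] := ab n.+1.
  have abn : a n < b n by rewrite -subr_gt0 l.
  have half : b n.+1 - a n.+1 = (b n - a n) / 2.
    by rewrite l l' exprS invfM [2^-1 * _]mulrC mulrA.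
  by have := average_step a0 b1 aa bb abn half; rewrite l pow [_ * q ^+ n * K]mulrAC.
have partial n : `|average (a 0%N) (b 0%N) u - average (a n) (b n) u| <=
    morrey_const * B * (1 - q ^+ n).
  elim: n => [|n IH]; first by rewrite !subrr normr0 mulr0.
  rewrite -[X in `|X|](subrKA (average (a n) (b n) u)).
  apply: le_trans (ler_normD _ _) _; apply: le_trans (lerD IH (inc n)) _.
  rewrite le_eqVlt; apply/orP; left; apply/eqP.
  rewrite /morrey_const exprS; field; rewrite subr_eq0 eq_sym lt_eqF//.
apply/ler_addgt0Pr => eps eps0.
have [d d0 ud] : exists2 d : R, 0 < d & forall t, `|t - p| <= d -> `|u t - u p| <= eps.
  have /cvgrPdist_le/(_ _ eps0) := cu (x := p).
  rewrite -nbhs_nbhs_norm => -[r /= r0 H]; exists (r / 2); first by rewrite divr_gt0.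
  move=> t tp; rewrite distrC; apply: H; rewrite /= distrC.
  by apply: le_lt_trans tp _; lra.
have [n nd] : exists n, x / 2 ^+ n <= d.
  have h : x * 2^-1 ^+ n @[n --> \oo] --> x * 0.
    by apply: cvgM; [exact: cvg_cst|apply: cvg_expr; rewrite ger0_norm; lra].
  rewrite mulr0 in h; have /cvgrPdist_le/(_ _ d0)[N _ H] := h.
  exists N; have := H N (leqnn N); rewrite /= sub0r normrN exprVn.
  exact: le_trans (ler_norm _).
have [a0 b1 _ _ l] := ab n.
have near_n : `|average (a n) (b n) u - u p| <= eps.
  apply: average_near => //; first by rewrite -subr_gt0 l.
  move=> t /andP[ta tb]; apply: ud; have /andP[pa pb] := pab n.
  by apply: le_trans nd; rewrite -l ler_norml; apply/andP; split; lra.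
rewrite -[X in `|X|](subrKA (average (a n) (b n) u)).
apply: le_trans (ler_normD _ _) _; apply: lerD near_n.
apply: le_trans (partial n) _; rewrite -mulrA; apply: (ler_wpM2l morrey_const_ge0).
by apply: ler_piMr => //; rewrite gerBl exprn_ge0// powR_ge0.
Qed.

(** Both [u x] and [u 0] are limits of averages over intervals that shrink from
the interval between [0] and [x]. *)
Lemma fractional_morrey (x : R) : 0 < x <= 1 ->
  `|u x - u 0| <= 2 * morrey_const * (x `^ (s - 1 / 2) * K).
Proof.
move=> /andP[x0 x1].
have xn n : 0 < x / 2 ^+ n by rewrite divr_gt0// exprn_gt0.
have xS n : x / 2 ^+ n.+1 <= x / 2 ^+ n.
  rewrite ler_pM2l// lef_pV2 ?posrE ?exprn_gt0// exprS.
  by rewrite ler_peMl ?exprn_ge0//; lra.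
have xx n : x / 2 ^+ n <= x.
  by rewrite ler_pdivrMr ?exprn_gt0// ler_peMr ?(ltW x0)// exprn_ege1//; lra.
have h0 := @average_telescope x 0 (fun=> 0) (fun n => x / 2 ^+ n) x0.
have hx := @average_telescope x x (fun n => x - x / 2 ^+ n) (fun=> x) x0.
rewrite expr0 divr1 in h0; rewrite expr0 divr1 subrr in hx.
have {}h0 : `|average 0 x u - u 0| <= morrey_const * (x `^ (s - 1 / 2) * K).
  apply: h0 => n; last by rewrite lexx ltW.
  by split => //; [exact: le_trans (xx n) x1|rewrite subr0].
have {}hx : `|average 0 x u - u x| <= morrey_const * (x `^ (s - 1 / 2) * K).
  apply: hx => n; last by rewrite lexx andbT gerBl ltW.
  by split => //; [rewrite subr_ge0|rewrite lerB|ring].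
have -> : u x - u 0 = (average 0 x u - u 0) - (average 0 x u - u x) by ring.
apply: le_trans (ler_normB _ _) _; apply: le_trans (lerD h0 hx) _.
move: (_ * K) => B; lra.
Qed.

End Step.
End FractionalMorrey.

(** * Termwise differentiation *)

Section PowerSeries.
Context (R : realType).

Definition zeta_term (b : R) (n : nat) : R := n.+1%:R `^ (- b).

Lemma zeta_term_ge0 b n : 0 <= zeta_term b n.
Proof. exact: powR_ge0. Qed.

(** By the mean value theorem for [x `^ (1 - b)]; the right-hand side telescopes. *)
Lemma zeta_term_le b n : 1 < b ->
  zeta_term b n.+1 <= (b - 1)^-1 * (n.+1%:R `^ (1 - b) - n.+2%:R `^ (1 - b)).
Proof.
move=> b1; have n0 : 0 < n.+1%:R :> R by [].
have n12 : (n.+1%:R : R) < n.+2%:R by rewrite ltr_nat.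
have dp (x : R) : x \in `]n.+1%:R, n.+2%:R[ ->
    is_derive x 1 (fun x : R => x `^ (1 - b)) ((1 - b) * x `^ ((1 - b) - 1)).
  rewrite in_itv/= => /andP[nx _]; apply: is_derive1_powR.
  exact: lt_trans n0 nx.
have cp : {within `[n.+1%:R, n.+2%:R], continuous (fun x : R => x `^ (1 - b))}.
  apply: derivable_within_continuous => x; rewrite in_itv/= => /andP[nx _].
  by apply: derivable_powR; rewrite in_itv/= andbT (lt_le_trans n0 nx).
have [c] := MVT n12 dp cp.
  rewrite in_itv/= => /andP[nc cn] e.
  have c0 : 0 < c by exact: lt_trans n0 nc.
  have -> : n.+1%:R `^ (1 - b) - n.+2%:R `^ (1 - b) = (b - 1) * c `^ (- b) :> R.
    have d : n.+2%:R - n.+1%:R = 1 :> R by rewrite -natrB// subSnn.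
    rewrite -[LHS]opprB e d mulr1 -mulNr opprB; congr (_ * _ `^ _); ring.
  rewrite mulKf ?gt_eqF ?subr_gt0// /zeta_term !powRN lef_pV2 ?posrE ?powR_gt0//.
  have b0 : 0 <= b by lra.
  by apply: (ge0_ler_powR b0); rewrite ?nnegrE; [exact: ltW|exact: ler0n|exact: ltW].
Qed.

Lemma zeta_sum_le b N : 1 < b ->
  \sum_(0 <= n < N) zeta_term b n <= 1 + (b - 1)^-1.
Proof.
move=> b1; have b10 : 0 <= (b - 1)^-1 by rewrite invr_ge0 subr_ge0 ltW.
case: N => [|N]; first by rewrite big_geq// addr_ge0.
suff : \sum_(0 <= n < N.+1) zeta_term b n <=
    1 + (b - 1)^-1 * (1 - N.+1%:R `^ (1 - b)).
  move=> /le_trans; apply.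
  by have := mulr_ge0 b10 (powR_ge0 (N.+1%:R : R) (1 - b)); lra.
elim: N => [|N IH].
  by rewrite big_nat1 /zeta_term !powR1 subrr mulr0 addr0.
rewrite big_nat_recr//=; apply: le_trans (lerD IH (zeta_term_le N b1)) _.
by rewrite -addrA -mulrDr; apply: lerD => //; apply: ler_wpM2l => //; rewrite addrA subrK.
Qed.

Lemma zeta_cvg b : 1 < b -> cvgn (series (zeta_term b)).
Proof.
move=> b1; apply: nondecreasing_is_cvgn.
  by apply/nondecreasing_series => n _ _; exact: zeta_term_ge0.
exists (1 + (b - 1)^-1) => _ [N _ <-]; rewrite /series /=; exact: zeta_sum_le.
Qed.

End PowerSeries.

Section TermwiseDerivative.
Context (R : realType).
Context (V dV : nat -> R -> R) (H : R -> R) (M : nat -> R) (t0 r : R).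
Hypothesis r0 : 0 < r.
Hypothesis dVP : forall n t, `|t - t0| < r -> is_derive t 1 (V n) (dV n t).
Hypothesis dVM : forall n t, `|t - t0| < r -> `|dV n t| <= M n.
Hypothesis cM : cvgn (series M).
Hypothesis HV : forall t, `|t - t0| < r ->
  \sum_(0 <= n < N) (V n t - V n t0) @[N --> \oo] --> H t - H t0.

Let t0r : `|t0 - t0| < r. Proof. by rewrite subrr normr0. Qed.

Let M0 n : 0 <= M n. Proof. exact: le_trans (dVM n t0r). Qed.

Let D : R := limn (series (dV ^~ t0)).

Let cD : series (dV ^~ t0) @ \oo --> D.
Proof.
apply: normed_cvg.
apply: (@series_le_cvg _ (fun n => `|dV n t0|) M _ M0 _ cM) => n; first exact: normr_ge0.
exact: dVM t0r.
Qed.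

Let incr n t : `|t - t0| < r -> `|V n t - V n t0| <= M n * `|t - t0|.
Proof.
have MVT' (a b : R) : a <= b -> `|a - t0| < r -> `|b - t0| < r ->
    `|V n b - V n a| <= M n * (b - a).
  move=> ab ar br.
  have inr x : a <= x <= b -> `|x - t0| < r.
    by move=> /andP[ax xb]; move: ar br; rewrite !ltr_norml; lra.
  have dp (x : R) : x \in `]a, b[ -> is_derive x 1 (V n) (dV n x).
    rewrite in_itv/= => /andP[ax xb]; apply: dVP; apply: inr.
    by rewrite !ltW.
  have cp : {within `[a, b], continuous (V n)}.
    apply: derivable_within_continuous => x; rewrite in_itv/= => /inr xr.
    by have := dVP n xr => h; exact: ex_derive.
  have [c] := MVT_segment ab dp cp.
    rewrite in_itv/= => /inr cr ->; rewrite normrM (ger0_norm (_ : 0 <= b - a)) ?subr_ge0//.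
    by apply: ler_wpM2r; [rewrite subr_ge0|exact: dVM].
move=> tr; have [tt|/ltW tt] := leP t0 t.
  by rewrite (ger0_norm (_ : 0 <= t - t0)) ?subr_ge0//; exact: MVT'.
by rewrite distrC (distrC t) (ger0_norm (_ : 0 <= t0 - t)) ?subr_ge0//; exact: MVT'.
Qed.

Let tot : R := limn (series M).

Let tail_ge0 N m : (N <= m)%N -> series M m - series M N <= tot - series M N.
Proof.
move=> Nm; rewrite lerB//; apply: nondecreasing_cvgn_le => //.
by apply/nondecreasing_series => n _ _; exact: M0.
Qed.

Let tail_cvg : tot - series M N @[N --> \oo] --> (0 : R).
Proof. by rewrite -(subrr tot); apply: cvgB => //; exact: cvg_cst. Qed.

Let tail_bound (w : nat -> R) (l c : R) N : 0 <= c ->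
  (forall n, `|w n| <= M n * c) -> series w @ \oo --> l ->
  `|l - series w N| <= (tot - series M N) * c.
Proof.
move=> c0 wM wl.
have h : `|series w m - series w N| @[m --> \oo] --> `|l - series w N|.
  by apply: cvg_norm; apply: cvgB => //; exact: cvg_cst.
apply: (cvgr_to_le h); near=> m.
have Nm : (N <= m)%N by near: m; exact: nbhs_infty_ge.
apply: (@le_trans _ _ ((series M m - series M N) * c)); last first.
  by apply: ler_wpM2r => //; exact: tail_ge0.
rewrite !sub_series_geq// mulr_suml; apply: le_trans (ler_norm_sum _ _ _) _.
by apply: ler_sum => n _; exact: wM.
Unshelve. all: by end_near. Qed.

(** By the mean value theorem the tails of the series of increments are at most
the tails of [series M] times the increment of the argument, so that the
difference quotients converge uniformly. *)
Lemma termwise_derivative : is_derive t0 1 H D /\ series (dV ^~ t0) @ \oo --> D.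
Proof.
split; last exact: cD.
pose S N t := \sum_(0 <= n < N) V n t.
pose dS N := series (dV ^~ t0) N.
have dSP N : is_derive t0 1 (S N) (dS N).
  elim: N => [|N IH].
    have -> : S 0%N = cst 0 by apply/funext => t; rewrite /S big_geq.
    by rewrite /dS /series /= (big_geq (leqnn 0)); exact: is_derive_cst.
  have -> : S N.+1 = (S N + V N)%R by apply/funext => t; rewrite /S big_nat_recr.
  rewrite /dS /series /= (big_nat_recr _ _ _ (leq0n N)); apply: is_deriveD.
  exact: dVP.
pose Q (f : R -> R) h := h^-1 *: ((f \o shift t0) (h *: (1 : R)) - f t0).
have QS N : Q (S N) h @[h --> 0^'] --> dS N.
  by have [dv <-] := dSP N; exact: dv.
suff QH : Q H h @[h --> 0^'] --> D.
  apply: DeriveDef; first by apply/cvg_ex; exists D.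
  exact: (cvg_lim _ QH).
apply/cvgrPdist_le => eps eps0.
have e3 : 0 < eps / 3 by rewrite divr_gt0.
have [N _ HN] : \forall N \near \oo, `|0 - (tot - series M N)| <= eps / 3.
  by move/cvgrPdist_le : tail_cvg => /(_ _ e3).
have {}HN : tot - series M N <= eps / 3.
  by have := HN N (leqnn N); rewrite /= sub0r normrN; apply: le_trans; exact: ler_norm.
have dN : `|D - dS N| <= eps / 3.
  have := @tail_bound (dV ^~ t0) D 1 N ler01 _ cD; rewrite mulr1.
  by move=> /(_ _)/le_trans; apply => // n; rewrite mulr1; exact: dVM.
have := QS N; move/cvgrPdist_le => /(_ _ e3) QN.
near=> h.
have h0 : h != 0 by near: h; exact: nbhs_dnbhs_neq.
have hr : `|h| < r.
  near: h; apply: dnbhs0_lt; exact: r0.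
have tr : `|h + t0 - t0| < r by rewrite addrK.
have key : `|Q H h - Q (S N) h| <= eps / 3.
  rewrite /Q -scalerBr normrZ normfV ler_pdivrMl ?normr_gt0//.
  rewrite /= -[h *: 1]/(h * 1) mulr1.
  have -> : H (h + t0) - H t0 - (S N (h + t0) - S N t0) =
      (H (h + t0) - H t0) - series (fun n => V n (h + t0) - V n t0) N.
    by rewrite /series /= sumrB.
  apply: le_trans (@tail_bound (fun n => V n (h + t0) - V n t0) _ `|h| N _ _ _) _ => //.
  - by move=> n; have := incr n tr; rewrite addrK.
  - exact: HV.
  - by rewrite mulrC ler_wpM2l.
have QNh : `|dS N - Q (S N) h| <= eps / 3 by near: h; exact: QN.
have -> : D - Q H h = (D - dS N) + (dS N - Q (S N) h) - (Q H h - Q (S N) h) by ring.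
apply: le_trans (ler_normB _ _) _; apply: le_trans (lerD (ler_normD _ _) (lexx _)) _.
by apply: le_trans (lerD (lerD dN QNh) key) _; lra.
Unshelve. all: by end_near. Qed.

End TermwiseDerivative.

(** * The density of states of one mode *)

Section ModePrimitive.
Context (R : realType) (alpha kap : R).
Hypothesis alpha0 : 0 < alpha.
Hypothesis kap0 : 0 < kap.
Notation leb := (@lebesgue_measure R).

(** The radius at which the symbol of the mode of index [n] takes the value
[t]. *)
Definition radius (n : nat) (t : R) : R := (t / (kap * n.+1%:R)) `^ alpha^-1.

Let kn n : 0 < kap * n.+1%:R. Proof. by rewrite mulr_gt0. Qed.

Lemma radius_gt0 n t : 0 < t -> 0 < radius n t.
Proof. by move=> t0; rewrite powR_gt0// divr_gt0. Qed.

Lemma radius_lt n t1 t2 : 0 < t1 -> t1 < t2 -> radius n t1 < radius n t2.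
Proof.
move=> t10 t12; have t20 := lt_trans t10 t12.
rewrite /radius gt0_ltr_powR ?invr_gt0// ?nnegrE ?divr_ge0 ?(ltW (kn n)) ?ltW//.
by rewrite ltr_pM2r// invr_gt0.
Qed.

Lemma radius_lt1 n t : 0 < t -> t < kap -> radius n t < 1.
Proof.
move=> t0 tk; have -> : (1 : R) = 1 `^ alpha^-1 by rewrite powR1.
rewrite /radius gt0_ltr_powR ?invr_gt0// ?nnegrE ?divr_ge0 ?(ltW (kn n)) ?ltW//.
rewrite ltr_pdivrMr// mul1r; apply: lt_le_trans tk _.
by rewrite ler_peMr ?ler1n// ltW.
Qed.

Lemma radius_powR_pred n s t : 0 < t ->
  radius n t `^ (2 * s - 1) * radius n t = radius n t `^ (2 * s).
Proof.
move=> t0; have r0 := radius_gt0 n t0.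
rewrite powRB; last by rewrite (gt_eqF r0) implybT.
by rewrite powRr1 ?ltW// divfK ?gt_eqF.
Qed.

Lemma radius_powR n s t : 0 < t -> radius n t `^ (2 * s) =
  t `^ (2 * s / alpha) * kap `^ (- (2 * s / alpha)) * n.+1%:R `^ (- (2 * s / alpha)).
Proof.
move=> t0; rewrite /radius -powRrM [alpha^-1 * _]mulrC.
have kn0 : 0 <= kap * n.+1%:R by exact/ltW.
have knV : 0 <= (kap * n.+1%:R)^-1 by rewrite invr_ge0.
rewrite (powRM _ (ltW t0) knV) -mulrA; congr (_ * _).
by rewrite -(powR_inv1 kn0) -powRrM mulN1r (powRM _ (ltW kap0) (ler0n _ _)).
Qed.

Lemma is_derive_radius n (t : R) : 0 < t ->
  is_derive t 1 (radius n) (radius n t / (alpha * t)).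
Proof.
move=> t0; have x0 : 0 < t / (kap * n.+1%:R) by rewrite divr_gt0.
have h1 := is_derive1_powR alpha^-1 x0.
have h2 := is_derive_mull (kap * n.+1%:R)^-1 (is_derive_id t 1).
have {}h2 : is_derive t 1 (fun t : R => t / (kap * n.+1%:R)) (kap * n.+1%:R)^-1.
  move: h2; rewrite mulr1.
  by have -> : (fun t0 : R => (kap * n.+1%:R)^-1 * t0) = (fun t : R => t / (kap * n.+1%:R))
    by apply/funext => x; rewrite mulrC.
have h := @is_derive1_comp R (fun x => x `^ alpha^-1) (fun t => t / (kap * n.+1%:R)) t _ _ h1 h2.
apply: (is_derive_eq h); rewrite /radius powRB; last by rewrite (gt_eqF x0) implybT.
rewrite powRr1; last exact: ltW.
by field; rewrite !gt_eqF//= kn.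
Qed.

Section Primitive.
Context (U : R -> R).
Hypothesis cU : continuous U.

Let integrable_U (a b : R) : leb.-integrable `[a, b]%classic (EFin \o U).
Proof.
apply: continuous_compact_integrable; first exact: segment_compact.
exact: continuous_subspaceT.
Qed.

(** An antiderivative, in the level [t], of the contribution of the mode of
index [n] to the density of states. *)
Definition primitive n t : R := Rintegral leb `[0, radius n t]%classic U.

Lemma is_derive_primitive n (t : R) : 0 < t ->
  is_derive t 1 (primitive n) (U (radius n t) * (radius n t / (alpha * t))).
Proof.
move=> t0; have r0 := radius_gt0 n t0.
have r1 : radius n t < radius n t + 1 by rewrite ltrDl.
have [dF F'] := continuous_FTC1_closed r1 (integrable_U 0 _) r0 (@cU _).
have h1 : is_derive (radius n t) 1 (fun x => Rintegral leb `[0, x]%classic U) (U (radius n t)).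
  by split; [exact: dF|rewrite -derive1E].
exact: is_derive1_comp h1 (is_derive_radius n t0).
Qed.

Lemma primitiveB n t1 t2 : 0 < t1 -> t1 < t2 ->
  primitive n t2 - primitive n t1 =
  Rintegral leb `]radius n t1, radius n t2]%classic U.
Proof.
move=> t10 t12; have rr := radius_lt n t10 t12.
have r0 := radius_gt0 n t10.
rewrite /primitive Rintegral_itvB//; first by rewrite bnd_simp ltW.
by rewrite bnd_simp ltW.
Qed.

Lemma primitive_bound (s B : R) n t :
  (forall m, 0 < m <= 1 -> `|U m| <= B * m `^ (2 * s - 1)) ->
  0 < t -> t < kap ->
  `|U (radius n t) * (radius n t / (alpha * t))| <=
  B / alpha * kap `^ (- (2 * s / alpha)) * n.+1%:R `^ (- (2 * s / alpha))
   * t `^ (2 * s / alpha - 1).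
Proof.
move=> UB t0 tk; have r0 := radius_gt0 n t0; have r1 := radius_lt1 n t0 tk.
have at0 : 0 < alpha * t by rewrite mulr_gt0.
rewrite normrM (ger0_norm (_ : 0 <= _ / _)); last by rewrite divr_ge0 ?ltW.
have h : `|U (radius n t)| <= B * radius n t `^ (2 * s - 1) by apply: UB; rewrite r0 ltW.
apply: le_trans (ler_wpM2r _ h) _; first by rewrite divr_ge0 ?ltW.
have e1 := radius_powR_pred n s t0; have e2 := radius_powR n s t0.
have e3 : t `^ (2 * s / alpha - 1) = t `^ (2 * s / alpha) / t.
  rewrite powRB ?powRr1 ?ltW//; by rewrite (gt_eqF t0) implybT.
have -> : B * radius n t `^ (2 * s - 1) * (radius n t / (alpha * t)) =
   B / (alpha * t) * (radius n t `^ (2 * s - 1) * radius n t) by ring.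
rewrite e1 e2 e3 le_eqVlt; apply/orP; left; apply/eqP; field.
by rewrite !gt_eqF.
Qed.

End Primitive.

(** The exponent may have either sign. *)
Lemma powR_le_ends (a b x e : R) : 0 < a -> a <= x <= b -> x `^ e <= a `^ e + b `^ e.
Proof.
move=> a0 /andP[ax xb]; have x0 := lt_le_trans a0 ax; have b0 := lt_le_trans x0 xb.
have [e0|e0] := leP 0 e.
  have h : x `^ e <= b `^ e.
    by apply: (ge0_ler_powR e0 _ _ xb); rewrite nnegrE ltW.
  by apply: le_trans h _; rewrite lerDr powR_ge0.
have h : x `^ e <= a `^ e.
  rewrite -[e]opprK !(powRN _ (- e)) lef_pV2 ?posrE ?powR_gt0//.
  have e0' : 0 <= - e by lra.
  by apply: (ge0_ler_powR e0' _ _ ax); rewrite nnegrE ltW.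
by apply: le_trans h _; rewrite lerDl powR_ge0.
Qed.

Section Density.
Context (s gam B r : R) (U : nat -> R -> R) (H : R -> R).
Hypothesis cU : forall n, continuous (U n).
Hypothesis B0 : 0 <= B.
Hypothesis UB : forall n m, 0 < m <= 1 ->
  `|U n m| <= B * n.+1%:R `^ (- (2 * gam)) * m `^ (2 * s - 1).
Hypothesis rk : r <= kap.
Hypothesis beta1 : 1 < 2 * gam + 2 * s / alpha.
Hypothesis HU : forall t1 t2, 0 < t1 -> t1 < t2 -> t2 < r ->
  \sum_(0 <= n < N) Rintegral leb `]radius n t1, radius n t2]%classic (U n)
     @[N --> \oo] --> H t2 - H t1.

Let beta := 2 * gam + 2 * s / alpha.
Let p := 2 * s / alpha.
Let A := B / alpha * kap `^ (- p).

Let A0 : 0 <= A. Proof. by rewrite mulr_ge0 ?powR_ge0// divr_ge0// ltW. Qed.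

Let V n := primitive (U n) n.
Let dV n t := U n (radius n t) * (radius n t / (alpha * t)).

Let dVP n (t : R) : 0 < t -> is_derive t 1 (V n) (dV n t).
Proof. exact: is_derive_primitive. Qed.

Let dV_bound n t : 0 < t -> t < r -> `|dV n t| <= A * t `^ (p - 1) * zeta_term beta n.
Proof.
move=> t0 tr; have tk := lt_le_trans tr rk.
apply: le_trans (primitive_bound n (UB n) t0 tk) _.
rewrite /zeta_term /beta opprD (@powRD _ n.+1%:R); last by rewrite (gt_eqF (ltr0Sn R n)) implybT.
by rewrite le_eqVlt; apply/orP; left; apply/eqP; rewrite /A /p; ring.
Qed.

Let HV (t x : R) : 0 < t -> t < r -> 0 < x -> x < r ->
  \sum_(0 <= n < N) (V n x - V n t) @[N --> \oo] --> H x - H t.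
Proof.
move=> t0 tr x0 xr; case: (ltgtP t x) => tx; last first.
- rewrite tx subrr; under eq_fun do under eq_bigr do rewrite subrr.
  rewrite (_ : (fun N => _) = (fun=> 0)); first exact: cvg_cst.
  by apply/funext => N; rewrite big1_eq.
- have := HU x0 tx tr => h.
  have -> : H x - H t = - (H t - H x) by rewrite opprB.
  rewrite (_ : (fun N => _) = (fun N => - \sum_(0 <= n < N)
    Rintegral leb `]radius n x, radius n t]%classic (U n))); first exact: cvgN h.
  apply/funext => N; rewrite -sumrN; apply: eq_bigr => n _.
  by rewrite -(primitiveB (cU (n := n)) n x0 tx) opprB.
- rewrite (_ : (fun N => _) = (fun N => \sum_(0 <= n < N)
    Rintegral leb `]radius n t, radius n x]%classic (U n))); first exact: HU.
  apply/funext => N; apply: eq_bigr => n _.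
  by rewrite -(primitiveB (cU (n := n)) n t0 tx).
Qed.

(** By [primitive_bound] the derivatives of the terms are dominated, uniformly
near [t], by a multiple of [n.+1%:R `^ (- beta)], which is summable since
[beta] exceeds 1. *)
Lemma density_derivative (t : R) : 0 < t -> t < r -> exists D : R,
  is_derive t 1 H D /\
  `|D| <= alpha^-1 * kap `^ (- p) * (1 + (beta - 1)^-1) * B * t `^ (p - 1).
Proof.
move=> t0 tr; pose d := Order.min (t / 2) (r - t).
have d0 : 0 < d by rewrite lt_min divr_gt0//= subr_gt0.
have dt : d <= t / 2 by rewrite ge_min lexx.
have dr : d <= r - t by rewrite ge_min lexx orbT.
pose T := (t / 2) `^ (p - 1) + (3 / 2 * t) `^ (p - 1).
have inr x : `|x - t| < d -> [/\ 0 < x, x < r & t / 2 <= x <= 3 / 2 * t].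
  rewrite ltr_norml => /andP[h1 h2]; split; lra.
have dVM n x : `|x - t| < d -> `|dV n x| <= A * T * zeta_term beta n.
  move=> /inr[x0 xr xt]; apply: le_trans (dV_bound n x0 xr) _.
  apply: ler_wpM2r; first exact: zeta_term_ge0.
  by apply: ler_wpM2l => //; apply: powR_le_ends => //; rewrite divr_gt0.
have cM : cvgn (series (fun n => A * T * zeta_term beta n)).
  exact: is_cvg_seriesZ (zeta_cvg beta1).
have dVP' n (x : R) : `|x - t| < d -> is_derive x 1 (V n) (dV n x).
  by move=> /inr[x0 _ _]; exact: dVP.
have HV' x : `|x - t| < d ->
    \sum_(0 <= n < N) (V n x - V n t) @[N --> \oo] --> H x - H t.
  by move=> /inr[x0 xr _]; exact: HV.
have [h1 h2] := termwise_derivative d0 dVP' dVM cM HV'.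
exists (limn (series (dV ^~ t))); split; first exact: h1.
apply: (cvgr_to_le (cvg_norm h2)); apply: nearW => N.
apply: le_trans (ler_norm_sum _ _ _) _.
apply: (@le_trans _ _ (\sum_(0 <= n < N) A * t `^ (p - 1) * zeta_term beta n)).
  by apply: ler_sum => n _; exact: dV_bound.
rewrite -mulr_sumr.
apply: le_trans (ler_wpM2l _ (zeta_sum_le N beta1)) _.
  by rewrite mulr_ge0 ?powR_ge0.
by rewrite le_eqVlt; apply/orP; left; apply/eqP; rewrite /A; ring.
Qed.

End Density.
End ModePrimitive.

(** * Termwise integration *)

Section StationarySeries.
Context (R : realType) (d : measure_display) (T : measurableType d).
Context (mu : {measure set T -> \bar R}) (D : set T) (mD : measurable D).
Context (A : nat -> set T) (U : nat -> T -> R) (B w : nat -> R) (F : T -> R).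
Hypothesis mA : forall n, measurable (A n).
Hypothesis AD : forall n, A n `<=` D.
Hypothesis muA : forall n, mu (A n) = (w n)%:E.
Hypothesis Ui : forall n, mu.-integrable D (EFin \o U n).
Hypothesis UB : forall n x, A n x -> `|U n x| <= B n.
Hypothesis B0 : forall n, 0 <= B n.
Hypothesis cB : cvgn (series (fun n => B n * w n)).
Hypothesis mF : measurable_fun D F.
Hypothesis FE : {ae mu, forall x, D x -> exists N0, forall N, (N0 <= N)%N ->
  F x = \sum_(0 <= n < N) \1_(A n) x * U n x}.

Let S N x := \sum_(0 <= n < N) \1_(A n) x * U n x.

Let g x : \bar R := (\sum_(n <oo) (\1_(A n) x * B n)%:E)%E.

Let m1 n : measurable_fun D (fun x => (\1_(A n) x * B n)%:E).
Proof.
apply/measurable_EFinP; apply: measurable_funM; last exact: measurable_cst.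
exact: measurable_indic.
Qed.

Let term0 n x : (0 <= (\1_(A n) x * B n)%:E)%E.
Proof. by rewrite lee_fin mulr_ge0// indicE. Qed.

Let mg : measurable_fun D g.
Proof. by apply: ge0_emeasurable_sum => n *; [exact: term0|exact: m1]. Qed.

Let gi : mu.-integrable D g.
Proof.
apply/integrableP; split; first exact: mg.
rewrite (eq_integral g) => [|x _]; last first.
  by rewrite gee0_abs//; apply: nneseries_ge0 => n _ _; exact: term0.
rewrite integral_nneseries; [|exact: mD|exact: m1|by move=> n x _; exact: term0].
have e n : (\int[mu]_(x in D) (\1_(A n) x * B n)%:E = (B n * w n)%:E)%E.
  under eq_integral do rewrite mulrC EFinM.
  rewrite ge0_integralZl_EFin//.
  - rewrite integral_indic// setIidl; last exact: AD.
    by rewrite muA -EFinM.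
  - by apply/measurable_EFinP; exact: measurable_indic.
rewrite (eq_eseriesr (fun n _ => e n)).
rewrite (_ : (fun n => _) = EFin \o series (fun n => B n * w n)).
  by rewrite EFin_lim// ltry.
by apply/funext => n; rewrite /series /= sumEFin.
Qed.

Let Si N : mu.-integrable D (EFin \o S N) /\
  Rintegral mu D (S N) = \sum_(0 <= n < N) Rintegral mu (A n) (U n).
Proof.
have Ai n : mu.-integrable D (EFin \o (fun x => \1_(A n) x * U n x)).
  apply: (le_integrable mD _ _ (Ui n)).
    apply/measurable_EFinP; apply: measurable_funM; first exact: measurable_indic.
    exact/measurable_EFinP/(measurable_int _ (Ui n)).
  move=> x Dx; rewrite /= lee_fin normrM indicE.
  by case: (x \in A n); rewrite ?normr1 ?mul1r// normr0 mul0r.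
elim: N => [|N [IH1 IH2]].
  have -> : S 0%N = fun=> 0 by apply/funext => x; rewrite /S big_geq.
  rewrite big_geq//; split; first exact: integrable0.
  by rewrite /Rintegral integral0.
have -> : S N.+1 = fun x => 1 * S N x + 1 * (\1_(A N) x * U N x).
  by apply/funext => x; rewrite /S big_nat_recr//= !mul1r.
split; first exact: (integrable_lin mD 1 1 IH1 (Ai N)).
rewrite (Rintegral_lin mD 1 1 IH1 (Ai N)) big_nat_recr//= !mul1r IH2; congr (_ + _).
rewrite Rintegral_mkcond [RHS]Rintegral_mkcond; apply: eq_Rintegral => x _.
rewrite !patchE indicE; have [xA|xA] := boolP (x \in A N).
  by rewrite (mem_set (AD (set_mem xA))) mul1r.
by rewrite mul0r; case: ifP.
Qed.

(** The series of the bounds [B n] on the sets [A n] is integrable and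
dominates the partial sums, which are eventually constant at almost every
point. *)
Lemma stationary_series_cvg :
  \sum_(0 <= n < N) Rintegral mu (A n) (U n) @[N --> \oo] --> Rintegral mu D F.
Proof.
have mS N : measurable_fun D (fun x => (S N x)%:E) by exact: measurable_int (Si N).1.
have mF' : measurable_fun D (EFin \o F) by exact/measurable_EFinP.
have cS : {ae mu, forall x, D x -> (S N x)%:E @[N --> \oo] --> (F x)%:E}.
  apply: aeS FE => x h Dx; have [N0 e] := h Dx.
  apply: cvg_near_cst; exists N0 => // N /= /e.
  by rewrite -/(S N x) => ->.
have Sg : {ae mu, forall x N, D x -> (`|(S N x)%:E| <= g x)%E}.
  apply: aeW => x N Dx; apply: (@le_trans _ _ (\sum_(0 <= n < N) \1_(A n) x * B n)%:E).
    rewrite lee_fin; apply: le_trans (ler_norm_sum _ _ _) _; apply: ler_sum => n _.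
    rewrite normrM indicE; have [xA|xA] := boolP (x \in A n).
      by rewrite normr1 !mul1r; apply: UB; exact: set_mem.
    by rewrite normr0 !mul0r.
  rewrite -sumEFin; apply: nneseries_lim_ge => n _ _; exact: term0.
have [Fi _ h] := dominated_convergence mD mS mF' cS gi Sg.
have E n : (\int[mu]_(x in D) (S n x)%:E =
    (\sum_(0 <= i < n) Rintegral mu (A i) (U i))%:E)%E.
  by rewrite -(Si n).2 /Rintegral fineK//; apply: integrable_fin_num => //; exact: (Si n).1.
have Ef : (\int[mu]_(x in D) (F x)%:E = (Rintegral mu D F)%:E)%E.
  by rewrite /Rintegral fineK//; exact: integrable_fin_num.
have h' : (fun n => (\sum_(0 <= i < n) Rintegral mu (A i) (U i))%:E) @ \oo -->
    (Rintegral mu D F)%:E.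
  rewrite -Ef; apply: cvg_trans h; apply: near_eq_cvg; apply: nearW => n.
  exact: E.
exact: fine_cvg h'.
Qed.

End StationarySeries.

(** * Fourier coefficients of Sobolev functions *)

Section LowerIntegral.
Context (R : realType) (d : measure_display) (T : measurableType d).
Context (mu : {measure set T -> \bar R}) (D : set T) (mD : measurable D).

(** Integrals of nonnegative functions are suprema over simple functions, which
allows a larger function that is not measurable. *)
Lemma ge0_integral_le_ae (f h : T -> \bar R) : measurable_fun D f ->
  (forall x, D x -> (0 <= f x)%E) -> (forall x, D x -> (0 <= h x)%E) ->
  {ae mu, forall x, D x -> (f x <= h x)%E} ->
  (\int[mu]_(x in D) f x <= \int[mu]_(x in D) h x)%E.
Proof.
move=> mf f0 h0 [N [mN N0 sub]].
rewrite (ge0_negligible_integral mN mD mf f0 N0) !ge0_integralE//; last first.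
  by move=> x [Dx _]; exact: f0.
apply: ereal_sup_le => _ /= [k hk <-]; exists k => // x; apply: le_trans (hk x) _.
rewrite !patchE; case: ifPn => [/set_mem[Dx Nx]|_].
  rewrite (mem_set Dx); apply: contrapT => fh; apply: Nx; apply: sub => /=.
  by move=> /(_ Dx).
by case: ifPn => // /set_mem; exact: h0.
Qed.

End LowerIntegral.

Section SobolevModes.
Context (R : realType).
Notation leb := (@lebesgue_measure R).
Notation I := (@unit_itv R).
Notation normc := Normc.normc.
Implicit Types (g h : R -> R[i]) (gamma : R).

Let mI : @measurable _ (measurableTypeR R) I := @measurable_unit_itv R.

Lemma normc_Re_le (z : R[i]) : `|complex.Re z| <= normc z.
Proof.
rewrite -ler_sqr ?nnegrE ?sqrtr_ge0//; last by case: z => a b; exact: sqrtr_ge0.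
by rewrite sqr_normc real_normK ?num_real// lerDl sqr_ge0.
Qed.

Lemma normc_Im_le (z : R[i]) : `|complex.Im z| <= normc z.
Proof.
rewrite -ler_sqr ?nnegrE//; last by case: z => a b; exact: sqrtr_ge0.
by rewrite sqr_normc real_normK ?num_real// lerDr sqr_ge0.
Qed.

Lemma normc_ge0 (z : R[i]) : 0 <= normc z.
Proof. by case: z => a b; exact: sqrtr_ge0. Qed.

Lemma normcN (z : R[i]) : normc (- z) = normc z.
Proof. by case: z => a b /=; rewrite !sqrrN. Qed.

Lemma ReB (z w : R[i]) : complex.Re (z - w) = complex.Re z - complex.Re w.
Proof. by rewrite !cE. Qed.

Lemma ImB (z w : R[i]) : complex.Im (z - w) = complex.Im z - complex.Im w.
Proof. by rewrite !cE. Qed.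

Lemma normc_le_ReIm (z : R[i]) : normc z <= `|complex.Re z| + `|complex.Im z|.
Proof.
rewrite -ler_sqr ?nnegrE ?normc_ge0 ?addr_ge0// sqr_normc.
rewrite sqrrD !real_normK ?num_real//.
by have := mulr_ge0 (normr_ge0 (complex.Re z)) (normr_ge0 (complex.Im z)); lra.
Qed.

Let weight gamma (k : int) (z : R[i]) : \bar R :=
  (`|k%:~R| `^ (2 * gamma) * normc z ^+ 2)%:E.

Let weight_ge0 gamma k z : (0 <= weight gamma k z)%E.
Proof. by rewrite lee_fin mulr_ge0 ?powR_ge0 ?sqr_ge0. Qed.

Lemma sqnormH_ge0 gamma g : (0 <= sqnormH gamma g)%E.
Proof. by apply: esum_ge0 => k _; exact: weight_ge0. Qed.

Lemma sqnormH_ge_mode gamma g k : k != 0 ->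
  ((`|k%:~R| `^ (2 * gamma) * normc (fourier g k) ^+ 2)%:E <= sqnormH gamma g)%E.
Proof.
move=> k0; apply: esum_ge; exists [set k]; last by rewrite fsbig_set1.
by split; [exact: finite_set1|move=> _ ->].
Qed.

Lemma sqnormH_sub_lty gamma g h : inH gamma g -> inH gamma h ->
  (sqnormH gamma (fun t => (g t - h t)%R) < +oo)%E.
Proof.
move=> [gi _ gf] [hi _ hf].
apply: (@le_lt_trans _ _ ((sqnormH gamma g + sqnormH gamma g) +
    (sqnormH gamma h + sqnormH gamma h))%E); last first.
  exact: (lte_add_pinfty (lte_add_pinfty gf gf) (lte_add_pinfty hf hf)).
have w0 u k : k != 0 -> (0 <= weight gamma k (fourier u k))%E by [].
rewrite /sqnormH -!esumD; try by move=> k k0; rewrite ?adde_ge0 ?w0.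
apply: le_esum => k k0; rewrite fourierB// -!EFinD lee_fin.
have key : normc (fourier g k - fourier h k) ^+ 2 <=
    2 * (normc (fourier g k) ^+ 2 + normc (fourier h k) ^+ 2).
  rewrite !sqr_normc !cE.
  set a := complex.Re (fourier g k); set b := complex.Im (fourier g k).
  set p := complex.Re (fourier h k); set q := complex.Im (fourier h k).
  by have := sqr_ge0 (a + p); have := sqr_ge0 (b + q); lra.
apply: le_trans (ler_wpM2l (powR_ge0 _ _) key) _.
by rewrite le_eqVlt; apply/orP; left; apply/eqP; ring.
Qed.

Lemma powR_half_sqr (x gamma : R) : (x `^ gamma) ^+ 2 = x `^ (2 * gamma).
Proof. by rewrite mulrC powRrM powR_mulrn// powR_ge0. Qed.

Lemma normH_ge_mode gamma g k : k != 0 -> (sqnormH gamma g < +oo)%E ->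
  `|k%:~R| `^ gamma * normc (fourier g k) <= normH gamma g.
Proof.
move=> k0 gf; rewrite -ler_sqr ?nnegrE ?sqrtr_ge0 ?mulr_ge0 ?powR_ge0 ?normc_ge0//.
rewrite /normH sqr_sqrtr; last by rewrite fine_ge0// sqnormH_ge0.
rewrite exprMn powR_half_sqr -lee_fin fineK; first exact: sqnormH_ge_mode.
by rewrite ge0_fin_numE// sqnormH_ge0.
Qed.

Lemma fourier_ae g h k : L2circle g -> L2circle h -> aeq_circle g h ->
  fourier g k = fourier h k.
Proof.
move=> gi hi gh; rewrite !fourierE; apply: aeqc_ipL2 => //; try exact: inL2_expi.
exact: aeW.
Qed.

End SobolevModes.

Section ContinuousModes.
Context (R : realType).
Notation leb := (@lebesgue_measure R).
Notation I := (@unit_itv R).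
Notation leb2 := (leb \x leb)%E.
Notation annulus := (@annulus R).
Notation normc := Normc.normc.

Let mI : @measurable _ (measurableTypeR R) I := @measurable_unit_itv R.

Definition clamp (m : R) : R := Num.max 0 (Num.min m 1).

Lemma clamp_unit m : I (clamp m).
Proof. by rewrite /unit_itv /= in_itv/= le_max lexx ge_max ler01 ge_min lexx orbT. Qed.

Lemma clamp_id m : I m -> clamp m = m.
Proof.
rewrite /unit_itv /= in_itv/= => /andP[m0 m1].
by rewrite /clamp min_l// max_r.
Qed.

Lemma continuous_clamp : continuous clamp.
Proof.
move=> m; apply: (@continuous_max R R (fun=> 0) (fun m => Num.min m 1)).
  exact: cst_continuous.
by apply: (@continuous_min R R id (fun=> 1)); [exact: cvg_id|exact: cst_continuous].
Qed.

Section Modes.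
Context (s gamma : R) (f : R * R -> R[i]) (u : R -> R -> R[i]).
Hypothesis gamma0 : 0 <= gamma.
Hypothesis hf : inHH s gamma f.
Hypothesis hu : continuous_representative gamma f u.

(** The Fourier coefficients of the continuous representative, extended to the
line by constants. *)
Definition mode (k : int) (m : R) : R[i] := fourier (u (clamp m)) k.

Let uH m : inH gamma (u (clamp m)).
Proof. by have [h _ _] := hu; apply: h; exact: clamp_unit. Qed.

Lemma intr_norm_ge1 (k : int) : k != 0 -> 1 <= `|k%:~R : R|.
Proof. by move=> k0; rewrite -intr_norm ler1z -gtz0_ge1 normr_gt0. Qed.

Lemma weight_ge1 (k : int) : k != 0 -> 1 <= `|k%:~R : R| `^ gamma.
Proof.
move=> k0; have e1 : (1 : R) `^ gamma = 1 by rewrite powR1.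
rewrite -[X in X <= _]e1.
by apply: (ge0_ler_powR gamma0); rewrite ?nnegrE//; exact: intr_norm_ge1.
Qed.

Lemma mode_cvg k (m0 : R) : k != 0 ->
  normc (mode k m0 - mode k m) @[m --> m0] --> (0 : R).
Proof.
move=> k0; have [_ /(_ _ (clamp_unit m0)) cu _] := hu.
have {}cu : normH gamma (fun t => u (clamp m) t - u (clamp m0) t) @[m --> m0] --> (0 : R).
  have h : clamp m @[m --> m0] --> within I (nbhs (clamp m0)).
    move=> A /= hA; have h1 : \forall y \near clamp m0, I y -> A y by exact: hA.
    have h2 : \forall x \near m0, I (clamp x) -> A (clamp x) by exact: continuous_clamp h1.
    change (\forall x \near m0, A (clamp x)).
    by apply: filterS h2 => x; apply; exact: clamp_unit.
  exact: (@cvg_comp _ _ _ clamp (fun y => normH gamma (fun t => u y t - u (clamp m0) t)) _ _ _ h cu).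
apply/cvgrPdist_le => e e0; have /cvgrPdist_le/(_ _ e0) := cu.
apply: filterS => m; rewrite !sub0r !normrN; apply: le_trans.
rewrite (ger0_norm (normc_ge0 _)); apply: le_trans (ler_norm _).
have [i1 _ _] := uH m; have [i2 _ _] := uH m0.
rewrite -normcN opprB /mode -(fourierB _ i1 i2).
apply: le_trans (normH_ge_mode k0 (sqnormH_sub_lty (uH m) (uH m0))).
by rewrite ler_peMl ?normc_ge0// weight_ge1.
Qed.

Lemma mode_ae : {ae leb, forall m, I m ->
  [/\ L2circle (fiber f m), fourier (fiber f m) 0 = 0 &
      forall k, fourier (fiber f m) k = mode k m]}.
Proof.
have [_ fH _] := hf; have [_ _ fu] := hu.
apply: aeS2 fH fu => m h1 h2 Im; have [i1 i2 _] := h1 Im; split=> // k.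
have [j1 _ _] := uH m; rewrite /mode; apply: fourier_ae => //.
by rewrite clamp_id//; exact: h2.
Qed.

Lemma mode0 k : aeq_circle (u 0) (fun=> 0) -> mode k 0 = 0.
Proof.
move=> u0; have c0 : clamp 0 = 0.
  by apply: clamp_id; rewrite /unit_itv /= in_itv/= lexx ler01.
have [i1 _ _] := uH 0; rewrite /mode.
have -> : fourier (u (clamp 0)) k = fourier (fun=> 0) k.
  by apply: fourier_ae => //; [exact: inL2_0|rewrite c0].
rewrite /fourier -[RHS](cintegral0 leb I); apply: eq_cintegral => t _.
by rewrite mul0r.
Qed.

Section Part.
Context (part : R[i] -> R).
Hypothesis partB : forall z w, part (z - w) = part z - part w.
Hypothesis part_le : forall z, `|part z| <= normc z.

Let part0 : part 0 = 0. Proof. by rewrite -(subrr 0) partB subrr. Qed.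

Let wmode k m : R := `|k%:~R| `^ gamma * part (mode k m).

Lemma continuous_part_mode k : k != 0 -> continuous (fun m => part (mode k m)).
Proof.
move=> k0 m0; apply/cvgrPdist_le => e e0.
have /cvgrPdist_le/(_ _ e0) := mode_cvg m0 k0; apply: filterS => m.
rewrite sub0r normrN (ger0_norm (normc_ge0 _)); apply: le_trans.
by rewrite -partB.
Qed.

(** One Fourier coefficient contributes at most the whole norm. The integrand of
[sqnormHH] bounds the other one at almost all pairs of radii, and
[ge0_integral_le_ae] asks for the measurability of the smaller one only. *)
Lemma wmode_energy k : k != 0 ->
  (\int[leb2]_(p in annulus) (gagliardo s (wmode k) p)%:E <= sqnormHH s gamma f)%E.
Proof.
move=> k0; pose ker (m m' : R) := (`|m - m'| `^ (1 + 2 * s))^-1.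
pose en m m' := (sqnormH gamma (fun t => (fiber f m t - fiber f m' t)%R) * (ker m m')%:E)%E.
have ker0 m m' : 0 <= ker m m' by rewrite invr_ge0 powR_ge0.
have en0 m m' : (0 <= en m m')%E by rewrite mule_ge0 ?lee_fin ?sqnormH_ge0.
have cw : continuous (wmode k).
  move=> m; apply: cvgM; first exact: cvg_cst.
  exact: continuous_part_mode.
have mG : @measurable_fun _ _ (measurableTypeR R * measurableTypeR R)%type _ annulus
    (gagliardo s (wmode k)).
  by apply: measurable_funTS; exact: measurable_gagliardo.
have mGE : @measurable_fun _ _ (measurableTypeR R * measurableTypeR R)%type _ annulus
    (fun p => (gagliardo s (wmode k) p)%:E) by exact/measurable_EFinP.
have G0 p : (0 <= (gagliardo s (wmode k) p)%:E)%E by rewrite lee_fin gagliardo_ge0.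
have [mF ->] := @tonelli_rectangle R _ _ _ _ leb leb I I mI mI _ mGE (fun p _ => G0 p).
apply: (@le_trans _ _ (\int[leb]_(m in I) \int[leb]_(m' in I) en m m')%E); last first.
  by rewrite /sqnormHH leeDr// integral_ge0// => m _; exact: sqnormH_ge0.
apply: ge0_integral_le_ae => //.
- by move=> m _; apply: integral_ge0.
- by move=> m _; apply: integral_ge0.
apply: aeS mode_ae => m /= hm Im; have {hm}[i1 _ e1] := hm Im.
apply: ge0_integral_le_ae => //.
  apply/measurable_EFinP.
  exact: (@measurable_section R _ _ _ _ I I mI mI _ m Im mG).
apply: aeS mode_ae => m' /= hm' Im'; have {hm'}[i2 _ e2] := hm' Im'.
rewrite /gagliardo /= EFinM; apply: lee_wpmul2r; first by rewrite lee_fin.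
apply: le_trans (sqnormH_ge_mode _ _ k0); rewrite lee_fin fourierB// e1 e2.
rewrite /wmode -mulrBr exprMn powR_half_sqr -partB.
apply: ler_wpM2l; first exact: powR_ge0.
by rewrite -[X in X <= _]real_normK ?num_real// ler_sqr ?nnegrE ?normc_ge0.
Qed.

Lemma part_mode_bound k (m : R) : k != 0 -> 1 / 2 < s ->
  aeq_circle (u 0) (fun=> 0) -> 0 < m <= 1 ->
  `|k%:~R| `^ gamma * `|part (mode k m)| <=
  2 * morrey_const s * (m `^ (s - 1 / 2) * normHH s gamma f).
Proof.
move=> k0 s12 u0 m01; have s0 : 0 < s by apply: lt_trans s12.
have cw : continuous (wmode k).
  move=> x; apply: cvgM; first exact: cvg_cst.
  exact: continuous_part_mode.
have [_ _ fin] := hf.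
have N0 : (0 <= sqnormHH s gamma f)%E.
  apply: adde_ge0; apply: integral_ge0 => x _; first exact: sqnormH_ge0.
  apply: integral_ge0 => y _; apply: mule_ge0; first exact: sqnormH_ge0.
  by rewrite lee_fin invr_ge0 powR_ge0.
have NE : sqnormHH s gamma f = (normHH s gamma f ^+ 2)%:E.
  rewrite /normHH sqr_sqrtr; last exact: fine_ge0.
  by rewrite fineK// ge0_fin_numE.
have nn0 : 0 <= normHH s gamma f by exact: sqrtr_ge0.
set A := 2 * morrey_const s * m `^ (s - 1 / 2).
(* [fractional_morrey] asks for a positive bound of the energy, hence [e] *)
have bnd e : 0 < e -> `|k%:~R| `^ gamma * `|part (mode k m)| <= A * (normHH s gamma f + e).
  move=> e0; have K0 : 0 < normHH s gamma f + e by rewrite ltr_wpDl.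
  have en : (\int[leb2]_(p in annulus) (gagliardo s (wmode k) p)%:E <=
      ((normHH s gamma f + e) ^+ 2)%:E)%E.
    apply: le_trans (wmode_energy k0) _; rewrite NE lee_fin ler_sqr ?nnegrE ?(ltW K0)//.
    by rewrite lerDl ltW.
  have := fractional_morrey cw s0 K0 en s12 m01.
  rewrite /wmode (mode0 k u0) part0 mulr0 subr0 normrM (ger0_norm (powR_ge0 _ _)).
  by rewrite /A -!mulrA.
have A0 : 0 <= A.
  by rewrite mulr_ge0 ?powR_ge0// mulr_ge0// morrey_const_ge0.
rewrite mulrA; apply/ler_addgt0Pr => e e0.
have A1 : 0 < A + 1 by rewrite ltr_wpDl.
apply: le_trans (bnd (e / (A + 1)) _) _; first by rewrite divr_gt0.
rewrite mulrDr lerD2l mulrA ler_pdivrMr// mulrC ler_pM2l//; lra.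
Qed.

End Part.

(** Fractional Sobolev regularity in the radius makes every Fourier coefficient
vanish at the centre at the rate given by the Morrey inequality, with the
decay in the frequency due to the regularity in the angle. *)
Lemma mode_bound k (m : R) : k != 0 -> 1 / 2 < s ->
  aeq_circle (u 0) (fun=> 0) -> 0 < m <= 1 ->
  `|k%:~R| `^ gamma * normc (mode k m) <=
  4 * morrey_const s * (m `^ (s - 1 / 2) * normHH s gamma f).
Proof.
move=> k0 s12 u0 m01.
have h1 := part_mode_bound (@ReB R) (@normc_Re_le R) k0 s12 u0 m01.
have h2 := part_mode_bound (@ImB R) (@normc_Im_le R) k0 s12 u0 m01.
apply: le_trans (ler_wpM2l (powR_ge0 _ _) (normc_le_ReIm _)) _.
rewrite mulrDr; apply: le_trans (lerD h1 h2) _.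
by rewrite le_eqVlt; apply/orP; left; apply/eqP; ring.
Qed.

End Modes.
End ContinuousModes.

(** * The symbol near the degenerate circle *)

Section DegenerateSymbol.
Context (R : realType) (phi : R -> R) (m0 c alpha r : R).
Notation leb := (@lebesgue_measure R).
Notation I := (@unit_itv R).
Hypothesis phi0 : forall m, 0 <= m <= 1 -> 0 <= phi m.
Hypothesis m00 : 0 < m0.
Hypothesis c0 : 0 < c.
Hypothesis alpha0 : 0 < alpha.
Hypothesis phiE : forall m, 0 <= m <= 1 -> m < m0 -> phi m = c * m `^ alpha.

Let mI : @measurable _ (measurableTypeR R) I := @measurable_unit_itv R.

Lemma bmeas_degenerate : {within `[m0, 1], continuous phi} -> bmeas phi.
Proof.
move=> cphi; split.
  have -> : I = (I `&` `[0, m0[%classic) `|` `[m0, 1]%classic.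
    apply/seteqP; split => m; rewrite /unit_itv /= !in_itv/=.
      move=> /andP[h1 h2]; have [h|h] := ltP m m0; [left|right].
        by rewrite h1 h2.
      by rewrite h2.
    move=> [[] //|/andP[h1 h2]]; by rewrite h2 (le_trans (ltW m00) h1).
  have mA : @measurable _ (measurableTypeR R) (I `&` `[0, m0[%classic).
    by apply: measurableI; [exact: mI|exact: measurable_itv].
  apply/measurable_funU; [exact: mA|exact: measurable_itv|split].
    apply: (@eq_measurable_fun _ _ _ _ _ (fun m => c * m `^ alpha)).
      move=> m /set_mem; rewrite /unit_itv /= !in_itv/= => -[h /andP[_ h']].
      by rewrite phiE.
    apply: measurable_funM; first exact: measurable_cst.
    by apply: measurable_funTS; exact: measurable_powR.
  by apply: subspace_continuous_measurable_fun => //; exact: measurable_itv.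
have [M phiM] : exists M, forall m, m0 <= m <= 1 -> phi m <= M.
  have [m01|m01] := leP m0 1; last first.
    by exists 0 => m /andP[h1 h2]; have := le_lt_trans h2 m01; rewrite ltNge h1.
  by have [x _ h] := EVT_max m01 cphi; exists (phi x) => m hm; apply: h; rewrite in_itv.
exists (c + `|M|) => m; rewrite /unit_itv /= in_itv/= => hm.
rewrite ger0_norm ?phi0//; have [h|h] := ltP m m0.
  rewrite phiE//; apply: (@le_trans _ _ c); last by rewrite lerDl.
  have /andP[h0 h1] := hm.
  rewrite ger_pMr//; have e1 : (1 : R) `^ alpha = 1 by rewrite powR1.
  by rewrite -[X in _ <= X]e1; apply: (ge0_ler_powR (ltW alpha0)); rewrite ?nnegrE.
apply: (@le_trans _ _ `|M|); last by rewrite lerDr ltW.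
by apply: le_trans (ler_norm M); apply: phiM; rewrite h; case/andP: hm.
Qed.

Let kap := 2 * pi * c.

Let kap0 : 0 < kap. Proof. by rewrite /kap !mulr_gt0// pi_gt0. Qed.

(* levels below [r] are attained only at radii less than [m0], where [phi] is a
power *)
Hypothesis r_far : forall m, m0 <= m <= 1 -> r <= 2 * pi * phi m.
Hypothesis r_near : r <= kap * m0 `^ alpha.

Local Notation rad := (radius alpha kap).

Let symbolE n m : symbol phi n.+1 m = n.+1%:R * (2 * pi * phi m).
Proof. by rewrite /symbol -pmulrn; ring. Qed.

Let kn n : 0 < kap * n.+1%:R. Proof. by rewrite mulr_gt0. Qed.

Let rad_powR n t : 0 < t -> rad n t `^ alpha = t / (kap * n.+1%:R).
Proof.
move=> t0; rewrite /radius -powRrM mulVf ?gt_eqF// powRr1//.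
by rewrite divr_ge0 ?(ltW t0)// ltW.
Qed.

Let rad_m0 n t : 0 < t -> t < r -> rad n t < m0.
Proof.
move=> t0 tr; rewrite ltNge; apply/negP => h.
have : m0 `^ alpha <= rad n t `^ alpha.
  apply: (ge0_ler_powR (ltW alpha0) _ _ h); rewrite nnegrE ltW//.
  exact: lt_le_trans h.
rewrite rad_powR// ler_pdivlMr// => h1.
have h2 : m0 `^ alpha * kap <= m0 `^ alpha * (kap * n.+1%:R).
  by rewrite ler_wpM2l ?powR_ge0// ler_peMr ?(ltW kap0)// ler1n.
have := le_trans h2 h1; rewrite mulrC leNgt => /negP; apply.
exact: lt_le_trans tr r_near.
Qed.

Let symbol_near n m : I m -> m < m0 -> symbol phi n.+1 m = kap * n.+1%:R * m `^ alpha.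
Proof.
rewrite /unit_itv /= in_itv/= => Im mm0.
by rewrite symbolE phiE// /kap; ring.
Qed.

Let symbol_far n m t : I m -> m0 <= m -> t < r -> t < symbol phi n.+1 m.
Proof.
rewrite /unit_itv /= in_itv/= => /andP[_ m1] mm0 tr; rewrite symbolE.
have h : r <= 2 * pi * phi m by apply: r_far; rewrite mm0.
apply: lt_le_trans tr (le_trans h _).
rewrite ler_peMl ?ler1n// mulr_ge0 ?mulr_ge0 ?pi_ge0//.
by apply: phi0; rewrite m1 andbT (le_trans (ltW m00)).
Qed.

Lemma symbol_gt_radius n m t : I m -> 0 < t -> t < r ->
  (t < symbol phi n.+1 m) = (rad n t < m).
Proof.
move=> Im t0 tr; have [h|h] := ltP m m0; last first.
  rewrite (symbol_far n Im h tr); apply/esym.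
  exact: lt_le_trans (rad_m0 n t0 tr) h.
have m_ge0 : 0 <= m by move: Im; rewrite /unit_itv /= in_itv/= => /andP[].
rewrite (symbol_near n Im h) mulrC -ltr_pdivrMr// -rad_powR//.
apply/idP/idP => [|h'].
  rewrite !ltNge; apply: contra => h'.
  by apply: (ge0_ler_powR (ltW alpha0) _ _ h'); rewrite nnegrE// ltW// radius_gt0.
by apply: (gt0_ltr_powR alpha0 _ _ h'); rewrite nnegrE// ltW// radius_gt0.
Qed.

Lemma symbol_lt_radius n m t : I m -> 0 < t -> t < r ->
  (symbol phi n.+1 m < t) = (m < rad n t).
Proof.
move=> Im t0 tr; have [h|h] := ltP m m0; last first.
  rewrite ltNge (ltW (symbol_far n Im h tr)); apply/esym/negbTE.
  by rewrite -leNgt ltW// (lt_le_trans (rad_m0 n t0 tr) h).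
have m_ge0 : 0 <= m by move: Im; rewrite /unit_itv /= in_itv/= => /andP[].
rewrite (symbol_near n Im h) mulrC -ltr_pdivlMr// -rad_powR//.
apply/idP/idP => [|h'].
  rewrite !ltNge; apply: contra => h'.
  by apply: (ge0_ler_powR (ltW alpha0) _ _ h'); rewrite nnegrE// ltW// radius_gt0.
by apply: (gt0_ltr_powR alpha0 _ _ h'); rewrite nnegrE// ltW// radius_gt0.
Qed.

Lemma symbol_gt0 n m : I m -> 0 < m -> 0 < r -> 0 < symbol phi n.+1 m.
Proof.
move=> Im mp r0; have [h|h] := ltP m m0; last exact: symbol_far.
by rewrite (symbol_near n Im h) mulr_gt0 ?powR_gt0.
Qed.

Lemma symbolN k m : symbol phi (- k) m = - symbol phi k m.
Proof. by rewrite /symbol rmorphN /=; ring. Qed.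

Lemma symbol_pos_ge0 (n : nat) m : I m -> 0 <= symbol phi n m.
Proof.
rewrite /unit_itv /= in_itv/= => Im.
by rewrite /symbol -pmulrn !mulr_ge0 ?pi_ge0 ?phi0.
Qed.

Let symbol_eq_radius n m t : I m -> 0 < t -> t < r ->
  symbol phi n.+1 m = t -> m = rad n t.
Proof.
move=> Im t0 tr e; apply/eqP; rewrite eq_le !leNgt.
by rewrite -(symbol_gt_radius _ Im t0 tr) -(symbol_lt_radius _ Im t0 tr) e ltxx.
Qed.

Lemma ae_neq (x : R) : {ae leb, forall m, m != x}.
Proof.
exists [set x]; split; [exact: measurable_set1|exact: lebesgue_measure_set1|].
by move=> m /= /negP; rewrite negbK => /eqP.
Qed.

(** A nonzero level below [r] is attained by the symbol of a mode at one radius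
at most. *)
Lemma ae_symbol_neq k l : l != 0 -> - r < l -> l < r ->
  {ae leb, forall m, I m -> symbol phi k m != l}.
Proof.
move=> l0 rl lr.
suff [x hx] : exists x, forall m, I m -> symbol phi k m = l -> m = x.
  by apply: aeS (ae_neq x) => m h Im; apply: contra h => /eqP/(hx m Im) ->.
have [lp|ln] := ltP 0 l.
  case: k => [[|n]|n].
  - exists 0 => m _; rewrite /symbol mulr0 mul0r => e.
    by move: l0; rewrite -e eqxx.
  - by exists (rad n l) => m Im; exact: symbol_eq_radius.
  - exists 0 => m Im; rewrite NegzE symbolN => e.
    by have := symbol_pos_ge0 n.+1 Im; move: lp; rewrite -e; lra.
have {}ln : l < 0 by rewrite lt_neqAle l0.
case: k => [n|n].
  exists 0 => m Im e.
  by have := symbol_pos_ge0 n Im; move: ln; rewrite -e; lra.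
exists (rad n (- l)) => m Im; rewrite NegzE symbolN => e.
by apply: symbol_eq_radius => //; rewrite -?e ?opprK//; lra.
Qed.

End DegenerateSymbol.

Lemma small_level (R : realType) (phi : R -> R) (m0 c alpha delta : R) :
  0 < m0 -> 0 < c -> 0 < delta ->
  (forall m, m0 <= m <= 1 -> delta <= phi m) ->
  exists r : R, [/\ 0 < r, r <= 2 * pi * c,
    forall m, m0 <= m <= 1 -> r <= 2 * pi * phi m &
    r <= 2 * pi * c * m0 `^ alpha].
Proof.
move=> m00 c0 d0 dphi; have p0 : 0 < 2 * pi :> R by rewrite mulr_gt0// pi_gt0.
exists (Num.min (2 * pi * c) (Num.min (2 * pi * delta) (2 * pi * c * m0 `^ alpha))).
split; rewrite ?lt_min ?ge_min ?lexx ?orbT//.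
  by rewrite !mulr_gt0 ?powR_gt0// pi_gt0.
move=> m hm; rewrite !ge_min; apply/orP; right; apply/orP; left.
by rewrite ler_pM2l// dphi.
Qed.

(** * Increments of the spectral projections *)

Section SpectralIncrement.
Context (R : realType) (phi : R -> R) (r : R) (rad : nat -> R -> R).
Context (E : R -> (R * R -> R[i]) -> R * R -> R[i]).
Notation leb := (@lebesgue_measure R).
Notation I := (@unit_itv R).
Notation leb2 := (leb \x leb)%E.
Notation annulus := (@annulus R).
Hypothesis bphi : bmeas phi.
Hypothesis hE : spectral_resolution leb2 annulus (transport_op phi) E.
Hypothesis symbol_gt : forall n m t, I m -> 0 < t -> t < r ->
  (t < symbol phi n.+1 m) = (rad n t < m).
Hypothesis symbol_neq : forall k l, l != 0 -> - r < l -> l < r ->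
  {ae leb, forall m, I m -> symbol phi k m != l}.
Hypothesis symbol_ge0 : forall (n : nat) m, I m -> 0 <= symbol phi n m.
Hypothesis symbol_pos : forall n m, I m -> 0 < m -> 0 < symbol phi n.+1 m.

(** The frequencies of one sign; [b] tells whether they are negative. *)
Definition kappa (b : bool) (n : nat) : int := if b then - n.+1%:Z else n.+1%:Z.

Lemma kappa_inj b : injective (kappa b).
Proof. by case: b => n n' /=; [move=> /oppr_inj|]; case. Qed.

Lemma kappa_neq0 b n : kappa b n != 0.
Proof. by case: b. Qed.

Lemma norm_kappa b n : `|(kappa b n)%:~R : R| = n.+1%:R.
Proof. by case: b; rewrite /kappa ?rmorphN /= ?normrN -pmulrn ger0_norm. Qed.

Lemma kappaP b (k : int) : (exists n, k = kappa b n) \/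
  (exists n : nat, k = if b then n%:Z else - n%:Z).
Proof.
case: b k => -[n|n].
- by right; exists n.
- by left; exists n; rewrite NegzE.
- case: n => [|n]; last by left; exists n.
  by right; exists 0%N.
- by right; exists n.+1; rewrite NegzE.
Qed.

(** What the spectral projection gains when the distance of the level to zero
grows from [t1] to [t2], on the side of zero given by [b]. *)
Definition increment (b : bool) t1 t2 f : R * R -> R[i] :=
  if b then fun p => E (- t1) f p - E (- t2) f p
  else fun p => E t2 f p - E t1 f p.

Lemma L2annulus_proj l f : L2annulus f -> L2annulus (E l f).
Proof. by have [[/(_ l)[+ _ _ _ _] _ _ _ _] _] := hE; exact. Qed.

Lemma L2annulus_increment b t1 t2 f : L2annulus f -> L2annulus (increment b t1 t2 f).
Proof.
by move=> fi; case: b; apply: inL2B; try exact: L2annulus_proj;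
  exact: measurable_annulus.
Qed.

Lemma ae_forall_int (P : int -> R -> Prop) :
  (forall k, {ae leb, forall m, I m -> P k m}) ->
  {ae leb, forall m, I m -> forall k, P k m}.
Proof.
move=> h; have h1 := ae_foralln (fun n : nat => h n).
have h2 := ae_foralln (fun n : nat => h (Negz n)).
by apply: aeS2 h1 h2 => m e1 e2 Im [n|n]; [exact: e1|exact: e2].
Qed.

Let aeI (P Q : R -> Prop) : {ae leb, forall m, P m} -> {ae leb, forall m, Q m} ->
  {ae leb, forall m, P m /\ Q m}.
Proof. by apply: aeS2 => m p q; split. Qed.

Let belowE k l m : I m -> \1_(below phi k l) m = (symbol phi k m < l)%R%:R :> R.
Proof.
move=> Im; rewrite indicE; congr ((nat_of_bool _)%:R).
by apply/idP/idP => [/set_mem[]//|h]; apply/mem_set; split.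
Qed.

Let fourier_proj_all l f : L2annulus f -> l != 0 -> - r < l -> l < r ->
  {ae leb, forall m, I m -> L2circle (fiber (E l f) m) /\
    forall k, fourier (fiber (E l f) m) k =
      ((symbol phi k m < l)%R%:R)%:C * fourier (fiber f m) k}.
Proof.
move=> fi l0 rl lr.
have h := ae_forall_int (fun k => fourier_proj bphi hE fi (symbol_neq k l0 rl lr)).
apply: aeS2 h (ae_L2circle_fiber (L2annulus_proj l fi)) => m h1 h2 Im.
by split=> [|k]; [exact: h2|rewrite h1// belowE].
Qed.

(** Since [phi] is nonnegative, the symbols of the frequencies outside the range
of [kappa b] lie on the same side of both levels. For the others, the levels
themselves are attained on null sets only, so that it does not matter whether
the ends of the intervals are included. *)
Lemma fourier_increment b t1 t2 f : L2annulus f -> 0 < t1 -> t1 < t2 -> t2 < r ->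
  {ae leb, forall m, I m ->
    (forall n, fourier (fiber (increment b t1 t2 f) m) (kappa b n) =
       (\1_(`]rad n t1, rad n t2]%classic) m)%:C * fourier (fiber f m) (kappa b n)) /\
    (forall k, fourier (fiber (increment b t1 t2 f) m) k != 0 ->
       exists n, k = kappa b n)}.
Proof.
move=> fi t10 t12 t2r; have t20 := lt_trans t10 t12; have t1r := lt_trans t12 t2r.
have S n m : I m -> \1_(`]rad n t1, rad n t2]%classic) m =
    (t1 < symbol phi n.+1 m <= t2)%R%:R :> R.
  move=> Im; rewrite indicE; congr ((nat_of_bool _)%:R).
  rewrite (symbol_gt n Im t10 t1r) [_ <= t2]leNgt (symbol_gt n Im t20 t2r) -leNgt.
  by apply/idP/idP => [/set_mem|h]; [|apply/mem_set]; rewrite /= in_itv.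
case: b.
  have h1 : {ae leb, forall m, I m -> L2circle (fiber (E (- t1) f) m) /\
      forall k, fourier (fiber (E (- t1) f) m) k =
      ((symbol phi k m < - t1)%R%:R)%:C * fourier (fiber f m) k}.
    by apply: fourier_proj_all => //; rewrite ?oppr_eq0 ?gt_eqF//; lra.
  have h2 : {ae leb, forall m, I m -> L2circle (fiber (E (- t2) f) m) /\
      forall k, fourier (fiber (E (- t2) f) m) k =
      ((symbol phi k m < - t2)%R%:R)%:C * fourier (fiber f m) k}.
    by apply: fourier_proj_all => //; rewrite ?oppr_eq0 ?gt_eqF//; lra.
  apply: aeS2 h1 h2 => m h1 h2 Im; have [i1 e1] := h1 Im; have [i2 e2] := h2 Im.
  have e k : fourier (fiber (increment true t1 t2 f) m) k =
      ((symbol phi k m < - t1)%R%:R - (symbol phi k m < - t2)%R%:R : R)%:C *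
      fourier (fiber f m) k.
    rewrite (_ : fiber _ m = fun t => fiber (E (- t1) f) m t - fiber (E (- t2) f) m t)//.
    by rewrite fourierB// e1 e2 -mulrBl -rmorphB.
  split=> [n|k].
    rewrite e S// symbolN !ltrN2; congr (_%:C * _).
    rewrite [_ <= t2]leNgt; have [h|h] := ltP t2 (symbol phi n.+1 m).
      by rewrite (lt_trans t12 h) subrr.
    by rewrite subr0 andbT.
  have [[n ->]|[n ->]] := kappaP true k; first by move=> _; exists n.
  have s0 := symbol_ge0 n Im.
  rewrite e !ltNge !(le_trans _ s0) ?oppr_le0 ?(ltW t10) ?(ltW t20)//.
  by rewrite subrr mul0r eqxx.
have h1 : {ae leb, forall m, I m -> L2circle (fiber (E t1 f) m) /\
    forall k, fourier (fiber (E t1 f) m) k =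
    ((symbol phi k m < t1)%R%:R)%:C * fourier (fiber f m) k}.
  by apply: fourier_proj_all => //; rewrite ?gt_eqF//; lra.
have h2 : {ae leb, forall m, I m -> L2circle (fiber (E t2 f) m) /\
    forall k, fourier (fiber (E t2 f) m) k =
    ((symbol phi k m < t2)%R%:R)%:C * fourier (fiber f m) k}.
  by apply: fourier_proj_all => //; rewrite ?gt_eqF//; lra.
have h3 : {ae leb, forall m, I m -> forall k, symbol phi k m != t1}.
  by apply: ae_forall_int => k; apply: symbol_neq; rewrite ?gt_eqF//; lra.
have h4 : {ae leb, forall m, I m -> forall k, symbol phi k m != t2}.
  by apply: ae_forall_int => k; apply: symbol_neq; rewrite ?gt_eqF//; lra.
apply: aeS2 (aeI h1 h2) (aeI h3 h4) => m [H1 H2] [H3 H4] Im.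
have [i1 e1] := H1 Im; have [i2 e2] := H2 Im; have n1 := H3 Im; have n2 := H4 Im.
have e k : fourier (fiber (increment false t1 t2 f) m) k =
    ((symbol phi k m < t2)%R%:R - (symbol phi k m < t1)%R%:R : R)%:C *
    fourier (fiber f m) k.
  rewrite (_ : fiber _ m = fun t => fiber (E t2 f) m t - fiber (E t1 f) m t)//.
  by rewrite fourierB// e1 e2 -mulrBl -rmorphB.
split=> [n|k].
  rewrite e S//; congr (_%:C * _).
  rewrite le_eqVlt (negbTE (n2 _)) /= [t1 < _]lt_neqAle eq_sym n1 /= leNgt.
  have [h|h] := ltP (symbol phi n.+1 m) t1; first by rewrite (lt_trans h t12) subrr.
  by rewrite subr0.
have [[n ->]|[n ->]] := kappaP false k; first by move=> _; exists n.
have s0 : symbol phi (- n%:Z) m <= 0 by rewrite symbolN oppr_le0 symbol_ge0.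
by rewrite e !(le_lt_trans s0)// subrr mul0r eqxx.
Qed.

(** At a positive radius the symbol grows linearly with the frequency, so only
finitely many modes stay below the level [t2] and [fourier_finite] applies. *)
Lemma ip_fiber_increment b t1 t2 f g (v w : int -> R -> R[i]) :
  L2annulus f -> L2annulus g ->
  {ae leb, forall m, I m -> forall k, fourier (fiber f m) k = v k m} ->
  {ae leb, forall m, I m -> forall k, fourier (fiber g m) k = w k m} ->
  0 < t1 -> t1 < t2 -> t2 < r ->
  {ae leb, forall m, I m -> exists N0, forall N, (N0 <= N)%N ->
    ipL2 leb I (fiber (increment b t1 t2 f) m) (fiber g m) =
    \sum_(0 <= n < N) (\1_(`]rad n t1, rad n t2]%classic) m)%:C *
       (v (kappa b n) m * (w (kappa b n) m)^*)}.
Proof.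
move=> fi gi fv gw t10 t12 t2r.
have h1 := fourier_increment b fi t10 t12 t2r.
have h2 := ae_L2circle_fiber (L2annulus_increment b t1 t2 fi).
have h3 := ae_L2circle_fiber gi.
apply: aeS2 (aeI (aeI h1 h2) h3) (aeI (aeI fv gw) (ae_neq 0)).
move=> m [[H1 H2] H3] [[H4 H5] m0] Im; have [e1 e2] := H1 Im.
have i1 := H2 Im; have i2 := H3 Im; have ev := H4 Im; have ew := H5 Im.
have mp : 0 < m.
  by rewrite lt_neqAle eq_sym m0; move: Im; rewrite /unit_itv /= in_itv/= => /andP[].
have a0 := symbol_pos 0 Im mp.
exists (Num.truncn (t2 / symbol phi 1 m)).+1 => N NN.
have := @fourier_finite R _ _ (kappa b) N i1 i2 (@kappa_inj b) => ->; last first.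
  move=> k hk; have [n kn] := e2 k hk; exists n => //.
  move: hk; rewrite kn e1; have [/set_mem/=|mS] := boolP (m \in `]rad n t1, rad n t2]%classic); last first.
    by rewrite indicE (negbTE mS) mul0r eqxx.
  rewrite in_itv/= => /andP[_ hm] _; apply: leq_trans NN.
  have : symbol phi n.+1 m <= t2 by rewrite leNgt (symbol_gt n Im) ?(lt_trans t10 t12)// -leNgt.
  have -> : symbol phi n.+1 m = n.+1%:R * symbol phi 1 m.
    by rewrite /symbol -!pmulrn; ring.
  rewrite -ler_pdivlMr// => h; apply: ltnW; rewrite -(ltr_nat R).
  apply: le_lt_trans h _; exact: truncnS_gt.
by apply: eq_bigr => n _; rewrite e1 ev ew mulrA.
Qed.

End SpectralIncrement.

Section ModeSeries.
Context (R : realType) (alpha kap s gam B t1 t2 : R).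
Context (U : nat -> R -> R) (F : R -> R).
Notation leb := (@lebesgue_measure R).
Notation I := (@unit_itv R).
Hypothesis alpha0 : 0 < alpha.
Hypothesis kap0 : 0 < kap.
Hypothesis s12 : 1 / 2 < s.
Hypothesis B0 : 0 <= B.
Hypothesis cU : forall n, continuous (U n).
Hypothesis UB : forall n m, 0 < m <= 1 ->
  `|U n m| <= B * n.+1%:R `^ (- (2 * gam)) * m `^ (2 * s - 1).
Hypothesis beta1 : 1 < 2 * gam + 2 * s / alpha.
Hypothesis t10 : 0 < t1.
Hypothesis t12 : t1 < t2.
Hypothesis t2k : t2 < kap.
Local Notation rad := (radius alpha kap).
Hypothesis mF : @measurable_fun _ _ (measurableTypeR R) R I F.
Hypothesis FE : {ae leb, forall m, I m -> exists N0, forall N, (N0 <= N)%N ->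
  F m = \sum_(0 <= n < N) \1_(`]rad n t1, rad n t2]%classic) m * U n m}.

Let mI : @measurable _ (measurableTypeR R) I := @measurable_unit_itv R.

Let t20 : 0 < t2. Proof. exact: lt_trans t12. Qed.

Let bnd n : R := B * n.+1%:R `^ (- (2 * gam)) * rad n t2 `^ (2 * s - 1).

Let bnd0 n : 0 <= bnd n.
Proof. by rewrite /bnd !mulr_ge0 ?powR_ge0. Qed.

Let rad0 n : 0 < rad n t1. Proof. exact: radius_gt0. Qed.
Let rad12 n : rad n t1 < rad n t2. Proof. exact: radius_lt. Qed.
Let rad1 n : rad n t2 < 1. Proof. exact: radius_lt1. Qed.

(** The integral over the [n]-th annulus is bounded by a multiple of
[n.+1%:R `^ (- (2 * gam + 2 * s / alpha))]. *)
Lemma mode_series_cvg :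
  \sum_(0 <= n < N) Rintegral leb `]rad n t1, rad n t2]%classic (U n) @[N --> \oo]
    --> Rintegral leb I F.
Proof.
apply: (@stationary_series_cvg R _ (measurableTypeR R) leb I mI
  (fun n => `]rad n t1, rad n t2]%classic) U bnd (fun n => rad n t2 - rad n t1) F).
- by move=> n; exact: measurable_itv.
- move=> n m; rewrite /unit_itv /= !in_itv/= => /andP[h1 h2].
  by rewrite (ltW (lt_trans (rad0 n) h1)) (le_trans h2 (ltW (rad1 n))).
- move=> n; etransitivity; first exact: lebesgue_measure_itv.
  by rewrite /= lte_fin rad12.
- move=> n; have [mU [M UM]] := continuous_bounded_unit (@cU n).
  exact: (bounded_integrable mI (lebesgue_unit_itv_lty R) mU UM).
- move=> n m; rewrite /= in_itv/= => /andP[h1 h2].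
  have m0 := lt_trans (rad0 n) h1.
  apply: le_trans (UB n _) _; first by rewrite m0 (le_trans h2 (ltW (rad1 n))).
  rewrite /bnd; apply: ler_wpM2l; first by rewrite mulr_ge0 ?powR_ge0.
  have s1 : 0 <= 2 * s - 1 by have h := s12; lra.
  by apply: (ge0_ler_powR s1 _ _ h2); rewrite nnegrE ltW// (lt_trans (rad0 n)).
- exact: bnd0.
- pose K := B * (t2 `^ (2 * s / alpha) * kap `^ (- (2 * s / alpha))).
  have cK : cvgn (series (fun n => K * zeta_term (2 * gam + 2 * s / alpha) n)).
    exact: is_cvg_seriesZ (zeta_cvg beta1).
  have K0 : 0 <= K by rewrite !mulr_ge0 ?powR_ge0.
  apply: (series_le_cvg _ _ _ cK) => n.
  + by rewrite mulr_ge0 ?bnd0// subr_ge0 ltW.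
  + by rewrite mulr_ge0 ?zeta_term_ge0.
  apply: (@le_trans _ _ (bnd n * rad n t2)).
    by rewrite ler_wpM2l ?bnd0// gerBl ltW.
  rewrite /bnd -mulrA (radius_powR_pred _ kap0 n s t20) (radius_powR _ kap0 n s t20).
  rewrite /zeta_term opprD (@powRD _ n.+1%:R); last first.
    by rewrite (gt_eqF (ltr0Sn R n)) implybT.
  by rewrite le_eqVlt; apply/orP; left; apply/eqP; rewrite /K; ring.
- exact: mF.
- exact: FE.
Qed.

End ModeSeries.

(** * The density of states of the operator *)

Section ComplexPart.
Context (R : realType).
Notation normc := Normc.normc.
Implicit Types z w : R[i].

(** The real part or the imaginary part, which are treated alike. *)
Definition part (q : bool) z : R := if q then complex.Im z else complex.Re z.

Lemma partB q z w : part q (z - w) = part q z - part q w.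
Proof. by case: q; rewrite /part !cE. Qed.

Lemma part_le q z : `|part q z| <= normc z.
Proof. by case: q; [exact: normc_Im_le|exact: normc_Re_le]. Qed.

Lemma part_sum q (N : nat) (F : nat -> R[i]) :
  part q (\sum_(0 <= n < N) F n) = \sum_(0 <= n < N) part q (F n).
Proof.
elim: N => [|N IH]; first by rewrite !big_geq//; case: q.
by rewrite !big_nat_recr//= -IH /part; case: ifP => _; rewrite !cE.
Qed.

Lemma part_real_mul q (a : R) z : part q (a%:C * z) = a * part q z.
Proof. by case: q; rewrite /part !cE /= mul0r ?subr0 ?addr0. Qed.

Lemma continuous_part_mul_conj q (v w : R -> R[i]) :
  (forall p, continuous (fun x => part p (v x))) ->
  (forall p, continuous (fun x => part p (w x))) ->
  continuous (fun x => part q (v x * (w x)^*)).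
Proof.
move=> cv cw x; have rv := cv false x; have iv := cv true x.
have rw_ := cw false x; have iw := cw true x; rewrite /part in rv iv rw_ iw *.
case: q.
  rewrite (_ : (fun x => _) = fun x => complex.Im (v x) * complex.Re (w x) -
     complex.Re (v x) * complex.Im (w x)).
    by apply: cvgB; apply: cvgM.
  by apply/funext => y; rewrite !cE; ring.
rewrite (_ : (fun x => _) = fun x => complex.Re (v x) * complex.Re (w x) +
   complex.Im (v x) * complex.Im (w x)).
  by apply: cvgD; apply: cvgM.
by apply/funext => y; rewrite !cE; ring.
Qed.

Lemma normc_mul_conj z w : normc (z * w^*) = normc z * normc w.
Proof.
by rewrite Normc.normcM; congr (_ * _); case: w => a b /=; rewrite sqrrN.
Qed.

End ComplexPart.

Section DensityOfParts.
Context (R : realType) (phi : R -> R) (alpha kap r s gamma : R).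
Context (E : R -> (R * R -> R[i]) -> R * R -> R[i]).
Notation leb := (@lebesgue_measure R).
Notation I := (@unit_itv R).
Notation leb2 := (leb \x leb)%E.
Notation annulus := (@annulus R).
Notation normc := Normc.normc.
Local Notation rad := (radius alpha kap).
Hypothesis alpha0 : 0 < alpha.
Hypothesis kap0 : 0 < kap.
Hypothesis rk : r <= kap.
Hypothesis s12 : 1 / 2 < s.
Hypothesis gamma0 : 0 <= gamma.
Hypothesis beta1 : 1 < 2 * gamma + 2 * s / alpha.
Hypothesis bphi : bmeas phi.
Hypothesis hE : spectral_resolution leb2 annulus (transport_op phi) E.
Hypothesis symbol_gt : forall n m t, I m -> 0 < t -> t < r ->
  (t < symbol phi n.+1 m) = (rad n t < m).
Hypothesis symbol_neq : forall k l, l != 0 -> - r < l -> l < r ->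
  {ae leb, forall m, I m -> symbol phi k m != l}.
Hypothesis symbol_ge0 : forall (n : nat) m, I m -> 0 <= symbol phi n m.
Hypothesis symbol_pos : forall n m, I m -> 0 < m -> 0 < symbol phi n.+1 m.

Context (f g : R * R -> R[i]) (uf ug : R -> R -> R[i]).
Hypothesis hf : inHH s gamma f.
Hypothesis hg : inHH s gamma g.
Hypothesis huf : continuous_representative gamma f uf.
Hypothesis hug : continuous_representative gamma g ug.
Hypothesis uf0 : aeq_circle (uf 0) (fun=> 0).
Hypothesis ug0 : aeq_circle (ug 0) (fun=> 0).

Let fi : L2annulus f. Proof. by case: hf. Qed.
Let gi : L2annulus g. Proof. by case: hg. Qed.

Let B : R := (4 * morrey_const s) ^+ 2 * normHH s gamma f * normHH s gamma g.

Let B0 : 0 <= B.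
Proof.
have n0 h : 0 <= normHH s gamma h by exact: sqrtr_ge0.
exact: (mulr_ge0 (mulr_ge0 (sqr_ge0 _) (n0 _)) (n0 _)).
Qed.

Let W b n m : R[i] := mode uf (kappa b n) m * (mode ug (kappa b n) m)^*.

Let cW q b n : continuous (fun m => part q (W b n m)).
Proof.
apply: continuous_part_mul_conj => p.
  exact: (continuous_part_mode gamma0 huf (@partB R p) (@part_le R p) (kappa_neq0 b n)).
exact: (continuous_part_mode gamma0 hug (@partB R p) (@part_le R p) (kappa_neq0 b n)).
Qed.

Let WB q b n m : 0 < m <= 1 ->
  `|part q (W b n m)| <= B * n.+1%:R `^ (- (2 * gamma)) * m `^ (2 * s - 1).
Proof.
move=> m01; have /andP[m0 _] := m01.
apply: le_trans (part_le _ _) _; rewrite /W normc_mul_conj.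
have hv := mode_bound gamma0 hf huf (kappa_neq0 b n) s12 uf0 m01.
have hw := mode_bound gamma0 hg hug (kappa_neq0 b n) s12 ug0 m01.
rewrite norm_kappa in hv hw.
set x : R := n.+1%:R `^ gamma in hv hw.
have x0 : 0 < x by rewrite powR_gt0.
have -> : n.+1%:R `^ (- (2 * gamma)) = (x ^+ 2)^-1 :> R.
  by rewrite powRN powR_half_sqr.
have e : m `^ (2 * s - 1) = m `^ (s - 1 / 2) * m `^ (s - 1 / 2).
  rewrite -powRD; last by rewrite (gt_eqF m0) implybT.
  by congr (_ `^ _); field.
have xv0 := mulr_ge0 (ltW x0) (normc_ge0 (mode uf (kappa b n) m)).
have xw0 := mulr_ge0 (ltW x0) (normc_ge0 (mode ug (kappa b n) m)).
have h := ler_pM xv0 xw0 hv hw.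
have x20 : 0 < x ^+ 2 by rewrite exprn_gt0.
have r1 (k a d y : R) : 4 * k * (y * a) * (4 * k * (y * d)) =
    (4 * k) ^+ 2 * a * d * (y * y) by ring.
have r2 (a d : R) : a * d * x ^+ 2 = x * a * (x * d) by ring.
by rewrite mulrAC ler_pdivlMr// e r2 /B -r1.
Qed.

(* with this sign the increments of [H q b] come from [increment E b] on both
sides of zero *)
Let H q (b : bool) t : R :=
  if b then - part q (ip_annulus (E (- t) f) g) else part q (ip_annulus (E t f) g).

Let H_increment q b t1 t2 : 0 < t1 -> t1 < t2 -> t2 < r ->
  \sum_(0 <= n < N) Rintegral leb `]rad n t1, rad n t2]%classic
     (fun m => part q (W b n m)) @[N --> \oo] --> H q b t2 - H q b t1.
Proof.
move=> t10 t12 t2r.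
have ui := L2annulus_increment hE b t1 t2 fi.
have [ci ei] := ip_annulusE ui gi.
have -> : H q b t2 - H q b t1 =
    Rintegral leb I (fun m => part q (ipL2 leb I (fiber (increment E b t1 t2 f) m) (fiber g m))).
  transitivity (part q (ip_annulus (increment E b t1 t2 f) g)); last first.
    by rewrite ei; case: (q).
  have p1 l : L2annulus (E l f) := L2annulus_proj hE l fi.
  rewrite /H /increment /ip_annulus; case: (b);
    (rewrite ipL2Bl; [|exact: measurable_annulus|exact: p1|exact: p1|exact: gi]).
    by rewrite partB opprK addrC.
  by rewrite partB.
have mf : {ae leb, forall m, I m -> forall k, fourier (fiber f m) k = mode uf k m}.
  by apply: aeS (mode_ae hf huf) => m h Im; case: (h Im).
have mg : {ae leb, forall m, I m -> forall k, fourier (fiber g m) k = mode ug k m}.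
  by apply: aeS (mode_ae hg hug) => m h Im; case: (h Im).
apply: (mode_series_cvg alpha0 kap0 s12 B0 (@cW q b) (@WB q b) beta1 t10 t12).
- exact: lt_le_trans t2r rk.
- have [c1 c2] := cintegrable_cmeasurable ci.
  by case: (q); [exact: c2|exact: c1].
- have := ip_fiber_increment bphi hE symbol_gt symbol_neq symbol_ge0 symbol_pos b
    fi gi mf mg t10 t12 t2r.
  apply: aeS => m h Im; have [N0 hN] := h Im; exists N0 => N /hN ->.
  rewrite part_sum; apply: eq_bigr => n _; exact: part_real_mul.
Qed.

Let K : R := alpha^-1 * kap `^ (- (2 * s / alpha)) *
  (1 + (2 * gamma + 2 * s / alpha - 1)^-1).

Let part_density q (lam : R) : - r < lam < r -> lam != 0 -> exists D : R,
  is_derive lam 1 (fun x => part q (ip_annulus (E x f) g)) D /\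
  `|D| <= K * B * `|lam| `^ (2 * s / alpha - 1).
Proof.
move=> /andP[rl lr] l0.
have dens b t := @density_derivative R alpha kap alpha0 kap0 s gamma B r
  (fun n m => part q (W b n m)) (H q b) (@cW q b) B0 (@WB q b) rk beta1
  (@H_increment q b) t.
have [lp|ln] := ltP 0 lam.
  have [D [dD bD]] := dens false lam lp lr.
  by exists D; rewrite (ger0_norm (ltW lp)).
have {}ln : lam < 0 by rewrite lt_neqAle l0.
have lp : 0 < - lam by rewrite oppr_gt0.
have lr' : - lam < r by rewrite ltrNl.
have [D [dD bD]] := dens true (- lam) lp lr'.
exists D; rewrite (ltr0_norm ln); split; last exact: bD.
have dN : is_derive lam 1 (fun x : R => - x) (-1).
  by apply: (is_derive_eq (is_deriveN (is_derive_id lam 1))).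
have h := @is_derive1_comp R (H q true) (fun x => - x) lam _ _ dD dN.
have h' := is_deriveN h.
have -> : (fun x => part q (ip_annulus (E x f) g)) = - (H q true \o (fun x => - x)).
  by apply/funext => x; rewrite /H /= !fctE /= opprK opprK.
by apply: (is_derive_eq h'); rewrite mulrN1 opprK.
Qed.

(** By [mode_bound] the [n]-th term of the scalar product of the fibers at
radius [m] is bounded by a multiple of
[n.+1%:R `^ (- (2 * gamma)) * m `^ (2 * s - 1)], as [density_derivative]
requires; it applies to the real and the imaginary part on either side of
zero. *)
Lemma density_of_states (lam : R) : - r < lam < r -> lam != 0 -> exists D : R[i],
  is_cderive (fun x => ip_annulus (E x f) g) lam D /\
  normc D <= 2 * K * (4 * morrey_const s) ^+ 2 * `|lam| `^ (2 * s / alpha - 1) *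
    normHH s gamma f * normHH s gamma g.
Proof.
move=> lr l0; have [D1 [d1 b1]] := part_density false lr l0.
have [D2 [d2 b2]] := part_density true lr l0.
exists (D1 +i* D2); split; first by split.
apply: le_trans (normc_le_ReIm _) _; apply: le_trans (lerD b1 b2) _.
have r1 (k m a d y : R) : k * (m * a * d) * y + k * (m * a * d) * y =
    2 * k * m * y * a * d by ring.
by rewrite /B r1.
Qed.

End DensityOfParts.

Theorem proposition3p5 (R : realType) (phi : R -> R) (m0 c alpha : R)
    (E : R -> (R * R -> R[i]) -> R * R -> R[i]) (s gamma : R) :
  (forall m, 0 <= m <= 1 -> 0 <= phi m) ->
  0 < m0 -> 0 < c -> 0 < alpha ->
  (forall m, 0 <= m <= 1 -> m < m0 -> phi m = c * m `^ alpha) ->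
  {within `[m0, 1], continuous phi} ->
  (exists2 delta : R, 0 < delta & forall m, m0 <= m <= 1 -> delta <= phi m) ->
  spectral_resolution (lebesgue_measure \x lebesgue_measure)%E (@annulus R)
    (transport_op phi) E ->
  1 / 2 < s < 1 -> 0 <= gamma ->
  1 / 2 < gamma + s / alpha ->
  exists r C : R, [/\ 0 < r, 0 < C &
    forall lam : R, - r < lam < r -> lam != 0 ->
    forall f g : R * R -> R[i], inHH0 s gamma f -> inHH0 s gamma g ->
    exists D : R[i],
      is_cderive (fun x => ip_annulus (E x f) g) lam D /\
      Normc.normc D <= C * `|lam| `^ (2 * s / alpha - 1)
                 * normHH s gamma f * normHH s gamma g].
Proof.
move=> phi0 m00 c0 alpha0 phiE cphi [delta d0 dphi] hE /andP[s12 _] gamma0 hs.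
have [r [r0 rk r_far r_near]] := small_level alpha m00 c0 d0 dphi.
have kap0 : 0 < 2 * pi * c by rewrite !mulr_gt0// pi_gt0.
have beta1 : 1 < 2 * gamma + 2 * s / alpha.
  by move: hs; rewrite -(mulrA 2 s); set y := s / alpha => hs; lra.
have bphi := bmeas_degenerate phi0 m00 c0 alpha0 phiE cphi.
pose K := alpha^-1 * (2 * pi * c) `^ (- (2 * s / alpha)) *
  (1 + (2 * gamma + 2 * s / alpha - 1)^-1).
pose C := 2 * K * (4 * morrey_const s) ^+ 2.
have K0 : 0 <= K.
  rewrite /K; apply: mulr_ge0; first by rewrite mulr_ge0 ?powR_ge0 ?invr_ge0 ?ltW.
  by rewrite addr_ge0// invr_ge0 subr_ge0 ltW.
have C0 : 0 <= C by rewrite /C; apply: mulr_ge0; [rewrite mulr_ge0|exact: sqr_ge0].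
(* adding 1 only serves to make the constant positive *)
exists r, (C + 1); split => //; first by rewrite ltr_wpDl.
move=> lam hlam lam0 f g [hf [uf [huf uf0]]] [hg [ug [hug ug0]]].
have gt := fun n m t => @symbol_gt_radius R phi m0 c alpha r phi0 m00 c0 alpha0
  phiE r_far r_near n m t.
have neq := fun k l => @ae_symbol_neq R phi m0 c alpha r phi0 m00 c0 alpha0
  phiE r_far r_near k l.
have pos := fun n m Im mp => @symbol_gt0 R phi m0 c alpha r phi0 m00 c0
  phiE r_far n m Im mp r0.
have [D [dD bD]] := density_of_states alpha0 kap0 rk s12 gamma0 beta1 bphi hE
  gt neq (symbol_pos_ge0 phi0) pos hf hg huf hug uf0 ug0 hlam lam0.
exists D; split=> //; apply: le_trans bD _.
have n0 h : 0 <= normHH s gamma h by exact: sqrtr_ge0.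
do 3 (apply: ler_wpM2r; first by [exact: n0|exact: powR_ge0]).
by rewrite -/K -/C lerDl.
Qed.
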